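(* Let $n\ge3$, $m=n-2$, and let $U\subset Z\to Y=\mathbb A^n$ be as in the context. Let $\Gamma$ be a variety with a morphism $g:\Gamma\to Y$. Put $Z_\Gamma=Z\times_Y\Gamma$ and $U_\Gamma=U\times_Y\Gamma$, the preimage of $\Gamma$ in the source. Then $U_\Gamma$ is open in $Z_\Gamma$. A point of $Z_\Gamma$ over $\gamma\in\Gamma$, written $(\gamma,[t],a)$ in the finite chart or $(\gamma,u,v)$ in the infinity chart, lies in $U_\Gamma$ if and only if \begin{enumerate} \item $[t]$ is a simple projective root of $P_{g(\gamma)}$, and \item $a=1$ when $t=0$. \end{enumerate} If $\Gamma$ is smooth, then $U_\Gamma$ is smooth, and its irreducible and connected components coincide.
   Context: All varieties are over $\mathbb C$. The map $K_n$. On $\mathbb A^n$ with coordinates $(x,y,z_3,\ldots,z_n)$ put $p=1+xy$ and $$\Phi_n(T)=(1-yT)^{n-1}(pT-x)+(pT-x)^2\Bigl[ny\bigl(yT+\tfrac12\bigr)+z_3\bigl(pT+\tfrac x2\bigr)+\sum_{j=4}^n z_jT^{j-2}\Bigr]$$ (empty sum for $n=3$). The coefficient of $T$ is $1$; write $\Phi_n(T)=\sum_{j=3}^n C_jT^j+A_2T^2+T-A_0$ and $K_n=(C_3,\ldots,C_n,A_2,A_0):\mathbb A^n\to Y=\mathbb A^n$. For $\eta\in Y$ let $P_\eta(T)=\sum_{j=3}^nC_jT^j+A_2T^2+T-A_0$ be the polynomial with the coefficients given by $\eta$, and $P_{\eta,h}(X_1,X_0)=X_0^nP_\eta(X_1/X_0)$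 its degree-$n$ homogenization; $t=X_1/X_0$. Projective roots of $P_\eta$ are the roots $[X_1:X_0]\in\mathbb P^1$ of $P_{\eta,h}$. The variety $Z$. It is glued from two charts over $Y$. Finite chart: points $(\eta,t,a)$ with $P_\eta(t)=0$, $a^m=P_\eta'(t)$. Infinity chart: with $Q_\eta(u)=u^nP_\eta(1/u)=P_{\eta,h}(1,u)$, points $(\eta,u,v)$ with $Q_\eta(u)=0$, $v^m=-Q_\eta'(u)$. The gluing is $u=1/t$, $v=ua$. In the finite chart $[t]$ denotes the projective root $[t:1]$, and a point $(\eta,u,v)$ of the infinity chart has projective root $[t]=[1:u]$. $Z$ is smooth, finite flat of degree $nm$ over $Y$, and is the normalization of $Y$ in the function field of the source of $K_n$. The source $\mathbb A^n$ of $K_n$ maps to $Z$ over $Y$ by sending a point to the projective root $[x:p]$ with $a=1/p$ where $p\ne0$ and $v=1/x$ where $x\ne0$; this is an open immersion, and $U\subset Z$ denotes its image. *)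

(* Defs.v *)
From HB Require Import structures.
From mathcomp Require Import all_boot all_order all_algebra.
From mathcomp Require Import all_classical reals topology.
From mathcomp Require Import complex mpoly.

Set Implicit Arguments.
Unset Strict Implicit.
Unset Printing Implicit Defensive.

Import GRing.Theory.
Local Open Scope classical_set_scope.
Local Open Scope ring_scope.

(* Varieties are taken in the sense of Serre: a topological space (the closed
   points with the Zariski topology) with a sheaf of K-valued functions,
   covered by finitely many affine algebraic sets, and separated.  They need
   not be irreducible.  The sheaf is given by its stalks: [regular_at x f]
   says that f is regular on a neighbourhood of x; the values of f away from x
   are irrelevant. *)
HB.mixin Record Topological_isFunSpace (K : Type) T of Topological T := {
  regular_at : T -> set (T -> K)
}.

#[short(type="funSpaceType")]
HB.structure Definition FunSpace (K : Type) :=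
  { T of Topological T & Topological_isFunSpace K T }.

Definition regular_on (K : Type) (X : funSpaceType K) (U : set X) :
  set (X -> K) := [set f | forall x, U x -> regular_at x f].

Definition morphism (K : Type) (X Y : funSpaceType K) (f : X -> Y) : Prop :=
  continuous f /\
  forall x (h : Y -> K), regular_at (f x) h -> regular_at x (h \o f).

(* The functions at s induced from X along phi : S -> X. *)
Definition induced_regular (K : Type) (S : topologicalType)
    (X : funSpaceType K) (phi : S -> X) (s : S) : set (S -> K) :=
  [set f | exists2 h : X -> K, regular_at (phi s) h &
                               \forall t \near s, f t = h (phi t)].

(* A subset with the topology and the functions induced from the ambient
   space (on closed sets, the reduced structure). *)
HB.instance Definition _ (K : Type) (X : funSpaceType K) (A : set X) :=
  Topological_isFunSpace.Build K (set_type A)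
    (induced_regular (set_val : set_type A -> X)).

Definition affspace (K : closedFieldType) (n : nat) : Type := 'rV[K]_n.

HB.instance Definition _ K n := Choice.copy (affspace K n) 'rV[K]_n.

(* The Zariski topology, generated by the principal open sets. *)
HB.instance Definition _ K n := isSubBaseTopological.Build (affspace K n)
  [set W | exists p : {mpoly K[n]}, W = [set x : 'rV_n | p.@[x 0] != 0]] id.

HB.instance Definition _ (K : closedFieldType) n :=
  Topological_isFunSpace.Build K (affspace K n)
    (fun x => [set f | exists p q : {mpoly K[n]},
       q.@[(x : 'rV_n) 0] != 0 /\
       \forall y \near x, f y = p.@[(y : 'rV_n) 0] / q.@[(y : 'rV_n) 0]]).

(* phi identifies the open subset U of X with a closed algebraic subset of
   affine N-space, as spaces with functions. *)
Record affine_chart (K : closedFieldType) (X : funSpaceType K) (U : set X)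
    (N : nat) (phi : X -> affspace K N) : Prop := AffineChart {
  chart_open : open U;
  chart_inj : {in U &, injective phi};
  chart_closed : closed (phi @` U);
  chart_topology : forall W, W `<=` U ->
    (open W <-> exists2 O, open O & W = U `&` phi @^-1` O);
  chart_regular : forall x, U x -> forall f : X -> K,
    regular_at x f <-> induced_regular phi x f
}.

(* The product of varieties; its topology is not the product topology. *)
Definition zprod (K : Type) (X Y : funSpaceType K) : Type := (X * Y)%type.

HB.instance Definition _ K (X Y : funSpaceType K) :=
  Choice.copy (zprod X Y) (X * Y)%type.

Definition tensor_on (K : closedFieldType) (X Y : funSpaceType K)
    (U : set X) (V : set Y) : set (zprod X Y -> K) :=
  [set h | exists k (a : 'I_k -> X -> K) (b : 'I_k -> Y -> K),
     [/\ forall i, regular_on U (a i), forall i, regular_on V (b i) &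
         h = fun q => \sum_(i < k) a i q.1 * b i q.2]].

HB.instance Definition _ (K : closedFieldType) (X Y : funSpaceType K) :=
  isSubBaseTopological.Build (zprod X Y)
    [set W | exists (U : set X) (V : set Y) (h : zprod X Y -> K),
       [/\ open U, open V, tensor_on U V h &
           W = [set q | (U `*` V) q /\ h q != 0]]] id.

HB.instance Definition _ (K : closedFieldType) (X Y : funSpaceType K) :=
  Topological_isFunSpace.Build K (zprod X Y)
    (fun q => [set f | exists (U : set X) (V : set Y) (h d : zprod X Y -> K),
       [/\ [/\ open U, open V & (U `*` V) q],
           tensor_on U V h /\ tensor_on U V d,
           d q != 0 &
           \forall r \near q, f r = h r / d r]]).

Definition variety (K : closedFieldType) (X : funSpaceType K) : Prop :=
  (exists (k : nat) (U : 'I_k -> set X) (N : 'I_k -> nat)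
          (phi : forall i, X -> affspace K (N i)),
     (forall i, affine_chart (U i) (phi i)) /\ \bigcup_i U i = setT) /\
  closed [set q : zprod X X | q.1 = q.2].

(* The underlying space of the fibre product of f and g. *)
Definition fibre_product (K : closedFieldType) (X Y S : funSpaceType K)
  (f : X -> S) (g : Y -> S) : set (zprod X Y) := [set q | f q.1 = g q.2].

Definition irreducible (X : topologicalType) (A : set X) : Prop :=
  A !=set0 /\ forall F G : set X, closed F -> closed G ->
    A `<=` F `|` G -> A `<=` F \/ A `<=` G.

Definition irreducible_components (X : topologicalType) (A : set X) :
  set (set X) :=
  [set B | [/\ B `<=` A, irreducible B &
    forall C, C `<=` A -> irreducible C -> B `<=` C -> C = B]].

Definition connected_components (X : topologicalType) (A : set X) :
  set (set X) := [set connected_component A x | x in A].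

Definition ideal_gen (K : closedFieldType) N (S : set {mpoly K[N]}) :
  set {mpoly K[N]} :=
  [set p | exists k (a s : 'I_k -> {mpoly K[N]}),
     (forall i, S (s i)) /\ p = \sum_(i < k) a i * s i].

Definition vanishing_ideal (K : closedFieldType) N (A : set (affspace K N)) :
  set {mpoly K[N]} :=
  [set p | forall x : 'rV_N, A x -> p.@[x 0] = 0].

(* The closed subscheme of affine N-space defined by the ideal I, not
   necessarily radical, is smooth at its point x: in the local ring of affine
   space at x, I is generated by c elements whose differentials at x are
   linearly independent. *)
Definition smooth_at (K : closedFieldType) N (I : set {mpoly K[N]})
    (x : 'rV[K]_N) : Prop :=
  (forall p, I p -> p.@[x 0] = 0) /\
  exists (c : nat) (f : 'I_c -> {mpoly K[N]}),
    [/\ forall i, I (f i),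
        forall p, I p -> exists2 q : {mpoly K[N]}, q.@[x 0] != 0 &
                           ideal_gen (range f) (q * p) &
        row_free (\matrix_(i < c, j < N) (mderiv j (f i)).@[x 0])].

Definition smooth_variety (K : closedFieldType) (X : funSpaceType K) : Prop :=
  forall x : X, exists (U : set X) N (phi : X -> affspace K N),
    [/\ affine_chart U phi, U x &
        smooth_at (vanishing_ideal (phi @` U)) (phi x)].

Definition polyl (K : closedFieldType) M N (p : {mpoly K[M]}) :
  {mpoly K[M + N]} := p \mPo [tuple 'X_(lshift N i) | i < M].

Definition polyr (K : closedFieldType) M N (p : {mpoly K[N]}) :
  {mpoly K[M + N]} := p \mPo [tuple 'X_(rshift M i) | i < N].

(* The scheme-theoretic fibre product of f and g over affine n-space is smooth
   at (x, y).  On affine opens U and V embedded in affine spaces, where f and g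
   are given by polynomials F i and G i, the fibre product is the spectrum of
   K[U] (x)_{K[affine n-space]} K[V], that is, the closed subscheme defined by
   the ideals of U and V and the F i - G i; it may be non-reduced. *)
Definition fibre_product_smooth_at (K : closedFieldType)
    (X Y : funSpaceType K) n (f : X -> affspace K n) (g : Y -> affspace K n)
    (q : zprod X Y) : Prop :=
  exists (U : set X) M (phi : X -> affspace K M) (F : 'I_n -> {mpoly K[M]})
         (V : set Y) N (psi : Y -> affspace K N) (G : 'I_n -> {mpoly K[N]}),
  [/\ [/\ affine_chart U phi, affine_chart V psi & (U `*` V) q],
      forall x, U x -> forall i,
        (f x : 'rV_n) 0 i = (F i).@[(phi x : 'rV_M) 0],
      forall y, V y -> forall i,
        (g y : 'rV_n) 0 i = (G i).@[(psi y : 'rV_N) 0] &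
      smooth_at
        (ideal_gen ([set polyl N p | p in vanishing_ideal (phi @` U)] `|`
                    [set polyr M p | p in vanishing_ideal (psi @` V)] `|`
                    [set polyl N (F i) - polyr M (G i) | i in setT]))
        (row_mx (phi q.1 : 'rV_M) (psi q.2 : 'rV_N))].

Section Kn.
Variables (K : closedFieldType) (n : nat).

(* The k-th coordinate, counted from 0.  With n >= 3, the coordinates are
   (x, y, z_3, .., z_n) on the source and (C_3, .., C_n, A_2, A_0) on the
   target. *)
Definition coord (k : nat) (s : 'rV[K]_n) : K :=
  if insub k is Some i then s 0 i else 0.

Definition cx (s : 'rV[K]_n) : K := coord 0 s.
Definition cy (s : 'rV[K]_n) : K := coord 1 s.
Definition cz (j : nat) (s : 'rV[K]_n) : K := coord j.-1 s.
Definition cp (s : 'rV[K]_n) : K := 1 + cx s * cy s.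

Definition Phi (s : 'rV[K]_n) : {poly K} :=
  let x := cx s in let y := cy s in let p := cp s in
  (1 - y *: 'X) ^+ (n - 1) * (p *: 'X - x%:P) +
  (p *: 'X - x%:P) ^+ 2 *
    ((n%:R * y) *: (y *: 'X + (2^-1)%:P) +
     cz 3 s *: (p *: 'X + (x / 2)%:P) +
     \sum_(4 <= j < n.+1) cz j s *: 'X^(j - 2)).

Definition Kmap (s : affspace K n) : affspace K n :=
  \row_(i < n) if (i < n - 2)%N then (Phi s)`_(i + 3)
               else if i == (n - 2)%N :> nat then (Phi s)`_2
               else - (Phi s)`_0.

Definition P_ (eta : 'rV[K]_n) : {poly K} :=
  \sum_(3 <= j < n.+1) coord (j - 3) eta *: 'X^j
  + coord (n - 2) eta *: 'X^2 + 'X - (coord (n - 1) eta)%:P.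

(* The degree-n homogenization; the variable 0 is X_1 and the variable 1 is
   X_0. *)
Definition Ph (eta : 'rV[K]_n) : {mpoly K[2]} :=
  \sum_(j < n.+1) (P_ eta)`_j *: ('X_ord0 ^+ j * 'X_ord_max ^+ (n - j)).

Definition Q_ (eta : 'rV[K]_n) : {poly K} :=
  \sum_(j < n.+1) (P_ eta)`_j *: 'X^(n - j).

(* [b : c] is a root of multiplicity one of the form F(X_1, X_0). *)
Definition simple_proj_root (F : {mpoly K[2]}) (b c : K) : Prop :=
  exists2 G : {mpoly K[2]},
    F = (c *: 'X_ord0 - b *: 'X_ord_max) * G &
    G.@[fun i => if i == ord0 then b else c] != 0.

(* Both charts lie in affine (n + 2)-space, with coordinates (eta, t, a) and
   (eta, u, v) respectively. *)
Definition peta (w : affspace K (n + 2)) : affspace K n :=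
  lsubmx (w : 'rV[K]_(n + 2)).
Definition pfst (w : affspace K (n + 2)) : K :=
  (w : 'rV[K]_(n + 2)) 0 (rshift n ord0).
Definition psnd (w : affspace K (n + 2)) : K :=
  (w : 'rV[K]_(n + 2)) 0 (rshift n ord_max).

Definition finite_chart : set (affspace K (n + 2)) :=
  [set w | (P_ (peta w)).[pfst w] = 0 /\
           psnd w ^+ (n - 2) = (P_ (peta w))^`().[pfst w]].

Definition infinity_chart : set (affspace K (n + 2)) :=
  [set w | (Q_ (peta w)).[pfst w] = 0 /\
           psnd w ^+ (n - 2) = - (Q_ (peta w))^`().[pfst w]].

(* The gluing u = 1 / t, v = u a. *)
Definition glued (w w' : affspace K (n + 2)) : bool :=
  [&& peta w == peta w', pfst w' * pfst w == 1 &
      psnd w' == pfst w' * psnd w].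

Definition glue_rel (z z' : finite_chart + infinity_chart) : bool :=
  match z, z' with
  | inl w, inl w' => w == w'
  | inr w, inr w' => w == w'
  | inl w, inr w' => glued (set_val w) (set_val w')
  | inr w', inl w => glued (set_val w) (set_val w')
  end.

Lemma chart_eq (A : set (affspace K (n + 2))) (w w' : A) :
  peta (set_val w) = peta (set_val w') ->
  pfst (set_val w) = pfst (set_val w') ->
  psnd (set_val w) = psnd (set_val w') -> w = w'.
Proof.
move=> e1 e2 e3; apply: val_inj; apply/rowP => i.
case: (split_ordP i) => j ->.
  by move/rowP: e1 => /(_ j); rewrite !mxE.
case: j => [[|[|//]] Hj].
- by move: e2; rewrite /pfst (_ : Ordinal Hj = ord0) //; apply: val_inj.
- by move: e3; rewrite /psnd (_ : Ordinal Hj = ord_max) //; apply: val_inj.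
Qed.

Lemma glue_refl : reflexive glue_rel.
Proof. by case=> w /=. Qed.

Lemma glue_sym : ssrbool.symmetric glue_rel.
Proof. by case=> w [] w' //=; rewrite eq_sym. Qed.

Lemma glued_inl (w1 w2 w' : affspace K (n + 2)) :
  glued w1 w' -> glued w2 w' ->
  [/\ peta w1 = peta w2, pfst w1 = pfst w2 & psnd w1 = psnd w2].
Proof.
case/and3P=> /eqP e1 /eqP f1 /eqP g1 /and3P[/eqP e2 /eqP f2 /eqP g2].
have u0 : pfst w' != 0.
  by apply: contra_eq_neq f1 => ->; rewrite mul0r eq_sym oner_eq0.
split; first by rewrite e1 e2.
- by apply: (mulfI u0); rewrite f1 f2.
- by apply: (mulfI u0); rewrite -g1 -g2.
Qed.

Lemma glued_inr (w w1 w2 : affspace K (n + 2)) :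
  glued w w1 -> glued w w2 ->
  [/\ peta w1 = peta w2, pfst w1 = pfst w2 & psnd w1 = psnd w2].
Proof.
case/and3P=> /eqP e1 /eqP f1 /eqP g1 /and3P[/eqP e2 /eqP f2 /eqP g2].
have t0 : pfst w != 0.
  by apply: contra_eq_neq f1 => ->; rewrite mulr0 eq_sym oner_eq0.
have e : pfst w1 = pfst w2 by apply: (mulIf t0); rewrite f1 f2.
by split; [rewrite -e1 e2 | | rewrite g1 g2 e].
Qed.

Lemma glue_trans : transitive glue_rel.
Proof.
case=> w2 [] w1 [] w3 //=.
- by move=> /eqP ->.
- by move=> /eqP ->.
- by move=> h /eqP <-.
- move=> h1 h2; have [e1 e2 e3] := glued_inr h1 h2.
  by apply/eqP; apply: chart_eq.
- move=> h1 h2; have [e1 e2 e3] := glued_inl h1 h2.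
  by apply/eqP; apply: chart_eq.
- by move=> h /eqP <-.
- by move=> /eqP ->.
- by move=> /eqP ->.
Qed.

Canonical glue_equiv := EquivRel glue_rel glue_refl glue_sym glue_trans.

Definition Z : Type := {eq_quot glue_rel}%qT.

HB.instance Definition _ := Choice.copy Z {eq_quot glue_rel}%qT.

Definition zfin (w : finite_chart) : Z := (\pi_{eq_quot glue_rel} (inl w))%qT.
Definition zinf (w : infinity_chart) : Z := (\pi_{eq_quot glue_rel} (inr w))%qT.

Definition Z_open : set (set Z) :=
  [set W | open (zfin @^-1` W) /\ open (zinf @^-1` W)].

Lemma Z_openT : Z_open setT.
Proof. by split; rewrite preimage_setT; exact: openT. Qed.

Lemma Z_openI : setI_closed Z_open.
Proof.
by move=> A B [A1 A2] [B1 B2]; split; rewrite preimage_setI; exact: openI.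
Qed.

Lemma Z_open_bigU (I : Type) (f : I -> set Z) :
  (forall i, Z_open (f i)) -> Z_open (\bigcup_i f i).
Proof.
by move=> fo; split; rewrite preimage_bigcup; apply: bigcup_open => i _;
  case: (fo i).
Qed.

HB.instance Definition _ :=
  isOpenTopological.Build Z Z_openT Z_openI Z_open_bigU.

HB.instance Definition _ := Topological_isFunSpace.Build K Z
  (fun z => [set f : Z -> K |
     (forall w, zfin w = z -> regular_at w (f \o zfin)) /\
     (forall w, zinf w = z -> regular_at w (f \o zinf))]).

(* The structure morphism Z -> Y. *)
Definition zproj (z : Z) : affspace K n :=
  match repr z with
  | inl w => peta (set_val w)
  | inr w => peta (set_val w)
  end.

(* z is the image of the source point s: its projective root is [x : p], with
   a = 1 / p in the finite chart and v = 1 / x in the infinity chart. *)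
Definition source_image (s : affspace K n) (z : Z) : Prop :=
  (cp s != 0 /\ exists w : finite_chart,
     [/\ z = zfin w, peta (set_val w) = Kmap s,
         pfst (set_val w) = cx s / cp s & psnd (set_val w) = (cp s)^-1]) \/
  (cx s != 0 /\ exists w : infinity_chart,
     [/\ z = zinf w, peta (set_val w) = Kmap s,
         pfst (set_val w) = cp s / cx s & psnd (set_val w) = (cx s)^-1]).

Definition U_ : set Z := [set z | exists s, source_image s z].

Section pullback.
Variables (Gam : funSpaceType K) (g : Gam -> affspace K n).

Definition ZG : set (zprod Z Gam) := fibre_product zproj g.

Definition UG : set ZG := [set q | U_ (set_val q).1].

End pullback.

End Kn.

Arguments finite_chart : clear implicits.
Arguments infinity_chart : clear implicits.
Arguments UG {K n Gam} g _.

(* Main.v *)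
(* On both charts Z is the m-fold cyclic cover a^m = dE/dt of the graph of a
   polynomial function E, so that its ideal is generated by two explicit
   equations, whose Jacobian in (t, a) is invertible where a is nonzero.  Given
   a root t with a^m = P'(t) nonzero, and a = 1 if t = 0, put p = 1/a, x = t/a;
   then P - (1 - yT)^(n-1) (pT - x) is divisible by (pT - x)^2, and comparing
   the coefficients of 1, T and T^2 shows that the quotient is a bracket as in
   the definition of Phi_n for suitable y and z_j.  This describes U, which
   lies where a is nonzero; hence Z x_Y Gamma is smooth along it by the
   Jacobian criterion.

   A space in which every point has an irreducible open neighbourhood has the
   same irreducible and connected components, so it remains to show that the
   zero set of a smooth ideal I is irreducible near the point x.  Newton's
   iteration parametrizes it formally by the tangent space at x, and the
   polynomials which vanish along this formal branch form a prime ideal that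
   contains I.  By Krull's intersection theorem the two ideals agree near x,
   and the Nullstellensatz converts this into irreducibility of the zero set. *)

From HB Require Import structures.
Require Import Defs.
From mathcomp Require Import all_boot all_order all_algebra.
From mathcomp Require Import finmap all_classical reals topology.
From mathcomp Require Import complex mpoly separable zify ring.
From mathcomp Require lebesgue_measure.

Set Implicit Arguments.
Unset Strict Implicit.
Unset Printing Implicit Defensive.

Import GRing.Theory.
Local Open Scope classical_set_scope.
Local Open Scope ring_scope.

(** * Ideals and Noetherian rings *)

(** Components concern points, while smoothness concerns a fibre product that may be non-reduced;
    the prime ideal of the formal branch links the two. No completion is built: the branch is a
    sequence of polynomial maps [newton k] that agree to higher and higher order, p vanishes along
    it when p composed with [newton k] has order above k for every k, and primality is additivity of
    the order. The complex numbers enter through two facts. They are uncountable, which gives a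
    Nullstellensatz by counting linear dependencies, and positive integers are nonzero in them, so
    that 2 and m can be inverted and [X^m - c] is separable for c nonzero. In the description of U
    the coefficients of the bracket from T^2 on are the free coordinates z_j, so only its
    coefficients b_0 and b_1 are constrained. If x is nonzero, p = 1 + xy fixes y, z_3 is chosen to
    fit b_0, and b_1 then fits because P has T-coefficient 1. If x = 0, then p = 1, which is the
    origin of the condition a = 1; now z_3 is chosen to fit b_1, and b_0 fits once y satisfies (2 -
    n) y = 2 A_2. *)

Definition idealg (R : comNzRingType) (S : set R) : set R :=
  [set p | exists k (a s : 'I_k -> R),
     (forall i, S (s i)) /\ p = \sum_(i < k) a i * s i].

Definition is_ideal (R : comNzRingType) (J : set R) : Prop :=
  [/\ J 0, forall x y, J x -> J y -> J (x + y) & forall a x, J x -> J (a * x)].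

Section Ideals.
Variable R : comNzRingType.
Implicit Types (S J : set R) (x y a : R).

Lemma idealg_ideal S : is_ideal (idealg S).
Proof.
split.
- by exists 0%N, (fun=> 0), (fun=> 0); split=> [[]//|]; rewrite big_ord0.
- move=> _ _ [k [a [s [Ss ->]]]] [l [b [t [St ->]]]].
  exists (k + l)%N, (fun i => match fintype.split i with inl i => a i | inr i => b i end),
    (fun i => match fintype.split i with inl i => s i | inr i => t i end).
  split; first by move=> i; case: (fintype.split i).
  rewrite big_split_ord /=; congr (_ + _); apply: eq_bigr => i _.
  - by rewrite -/(unsplit (inl i)) unsplitK.
  - by rewrite -/(unsplit (inr i)) unsplitK.
- move=> c _ [k [a [s [Ss ->]]]].
  exists k, (fun i => c * a i), s; split=> //.
  by rewrite mulr_sumr; apply: eq_bigr => i _; rewrite mulrA.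
Qed.

Lemma idealg_sub S x : S x -> idealg S x.
Proof.
by move=> Sx; exists 1%N, (fun=> 1), (fun=> x); rewrite big_ord1 mul1r.
Qed.

Lemma ideal_sum J (I : Type) (r : seq I) (P : pred I) (F : I -> R) :
  is_ideal J -> (forall i, P i -> J (F i)) -> J (\sum_(i <- r | P i) F i).
Proof. by case=> J0 JD _ JF; elim/big_ind: _. Qed.

Lemma idealN J x : is_ideal J -> J x -> J (- x).
Proof. by case=> _ _ JM Jx; rewrite -mulN1r; apply: JM. Qed.

Lemma idealB J x y : is_ideal J -> J x -> J y -> J (x - y).
Proof. by move=> Ji Jx Jy; case: (Ji) => _ JD _; apply: JD => //; apply: idealN. Qed.

Lemma idealMr J x a : is_ideal J -> J x -> J (x * a).
Proof. by case=> _ _ JM Jx; rewrite mulrC; apply: JM. Qed.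

Lemma idealg_min S J : is_ideal J -> S `<=` J -> idealg S `<=` J.
Proof.
move=> Ji SJ _ [k [a [s [Ss ->]]]]; apply: ideal_sum => // i _.
by case: Ji => _ _; apply; apply: SJ.
Qed.

Lemma idealgS S S' : S `<=` S' -> idealg S `<=` idealg S'.
Proof.
move=> SS'; apply: idealg_min (idealg_ideal _) _ => x /SS'; exact: idealg_sub.
Qed.

Lemma ideal_add J1 J2 : is_ideal J1 -> is_ideal J2 ->
  is_ideal [set x | exists y z, [/\ J1 y, J2 z & x = y + z]].
Proof.
move=> [J10 J1D J1M] [J20 J2D J2M]; split.
- by exists 0, 0; rewrite addr0.
- move=> _ _ [y1 [z1 [h1 h2 ->]]] [y2 [z2 [h3 h4 ->]]].
  by exists (y1 + y2), (z1 + z2); rewrite addrACA; split; auto.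
- move=> a _ [y [z [h1 h2 ->]]].
  by exists (a * y), (a * z); rewrite mulrDr; split; auto.
Qed.

End Ideals.

Lemma idealg_range (R : comNzRingType) (I : finType) (f : I -> R) x :
  idealg (range f) x -> exists a : I -> R, x = \sum_i a i * f i.
Proof.
move: x; apply: idealg_min.
  split.
  - by exists (fun=> 0); rewrite big1 // => i _; rewrite mul0r.
  - move=> _ _ [a ->] [b ->]; exists (fun i => a i + b i).
    by rewrite -big_split; apply: eq_bigr => i _; rewrite mulrDl.
  - move=> c _ [a ->]; exists (fun i => c * a i).
    by rewrite mulr_sumr; apply: eq_bigr => i _; rewrite mulrA.
move=> _ [i _ <-]; exists (fun j => (j == i)%:R).
rewrite (bigD1 i) //= eqxx mul1r big1 ?addr0 // => j /negPf ->.
by rewrite mul0r.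
Qed.

(** The ascending chain condition in sequence form: there is no bad sequence, that is, none whose
    terms all escape the ideal of their predecessors. *)
Definition noetherian (R : comNzRingType) : Prop :=
  forall u : nat -> R, exists n, idealg [set u i | i in `I_n] (u n).

Lemma noetherian_image (R S : comNzRingType) (f : {rmorphism R -> S}) :
  (forall y, exists x, f x = y) -> noetherian R -> noetherian S.
Proof.
move=> fsurj nR u; have [v fv] := choice (fun n => fsurj (u n)).
have [n [k [a [s [Ss e]]]]] := nR v.
exists n, k, (f \o a), (f \o s); split.
  by move=> i; have [j jn e'] := Ss i; exists j => //=; rewrite -e' fv.
by rewrite -fv e rmorph_sum; apply: eq_bigr => i _; rewrite rmorphM.
Qed.

Lemma noetherian_field (F : fieldType) : noetherian F.
Proof.
move=> u; have [u0|u0] := eqVneq (u 0%N) 0.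
  by exists 0%N; rewrite u0; case: (idealg_ideal [set u i | i in `I_0]).
exists 1%N; rewrite -[u 1%N](divfK u0).
by have [_ _] := idealg_ideal [set u i | i in `I_1]; apply; apply: idealg_sub; exists 0%N.
Qed.

Lemma idealg_initialS (R : comNzRingType) (F : set R) (u : nat -> R) m n : (m <= n)%N ->
  idealg (F `|` [set u i | i in `I_m]) `<=` idealg (F `|` [set u i | i in `I_n]).
Proof.
move=> mn; apply: idealgS => x [Fx|[i im <-]]; [by left|right; exists i => //].
exact: leq_trans im mn.
Qed.

(** An ideal combination involves only finitely many u i. The set F is carried along in order to
    work modulo an ideal later. *)
Lemma idealg_initial (R : comNzRingType) (F : set R) (u : nat -> R) p :
  idealg (F `|` range u) p -> exists n, idealg (F `|` [set u i | i in `I_n]) p.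
Proof.
move: p; apply: idealg_min.
  split.
  - by exists 0%N; case: (idealg_ideal (F `|` [set u i | i in `I_0])).
  - move=> x y [n nx] [m my]; exists (maxn n m).
    case: (idealg_ideal (F `|` [set u i | i in `I_(maxn n m)])) => _ + _; apply.
      exact: (idealg_initialS (leq_maxl _ _) nx).
    exact: (idealg_initialS (leq_maxr _ _) my).
  - move=> a x [n nx]; exists n.
    by case: (idealg_ideal (F `|` [set u i | i in `I_n])) => _ _; apply.
move=> p [Fp|[i _ <-]]; first by exists 0%N; apply: idealg_sub; left.
by exists i.+1; apply: idealg_sub; right; exists i => /=.
Qed.

(** Otherwise every finite list of elements of J could be prolonged by an element of J outside its
    ideal, and the prolongations would form a bad sequence. *)
Lemma noetherian_fg (R : comNzRingType) (J : set R) : noetherian R ->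
  exists k (s : 'I_k -> R), (forall i, J (s i)) /\ J `<=` idealg (range s).
Proof.
move=> nR; apply: contrapT => noJ.
have pick (l : seq R) : exists x, J x /\
    ((forall y, y \in l -> J y) -> ~ idealg [set` l] x).
  (* [choice] asks for a prolongation of every list, so a list not inside J gets any element of J;
     if J is empty, the empty family generates it. *)
  case: (pselect (forall y, y \in l -> J y)) => [lJ|nl]; last first.
    case: (pselect (exists x, J x)) => [[x Jx]|nJ]; first by exists x.
    case: noJ; exists 0%N, (fun=> 0); split=> [[]//|x Jx].
    by case: nJ; exists x.
  apply: contrapT => nx; apply: noJ.
  exists (size l), (fun i => l`_i); split.
    by move=> i; apply: lJ; rewrite mem_nth.
  move=> x Jx; apply: contrapT => nlx; apply: nx; exists x; split=> // _ lx.
  apply: nlx; apply: idealgS lx => y /= yl.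
  have yi : (index y l < size l)%N by rewrite index_mem.
  by exists (Ordinal yi) => //=; rewrite nth_index.
have [f fP] := choice pick.
pose L := fix L n := if n is n'.+1 then rcons (L n') (f (L n')) else [::].
have LJ n y : y \in L n -> J y.
  elim: n => // n IH /=; rewrite mem_rcons inE => /orP[/eqP ->|]; last exact: IH.
  by case: (fP (L n)).
have LS n i : (i < n)%N -> f (L i) \in L n.
  elim: n => // n IH; rewrite ltnS leq_eqVlt /= mem_rcons inE => /orP[/eqP ->|/IH ->].
    by rewrite eqxx.
  by rewrite orbT.
have [n] := nR (f \o L).
have [_ /(_ (@LJ n)) nf] := fP (L n); move=> h; apply: nf.
by apply: idealgS h => _ [i /= lin <-]; apply: LS.
Qed.

(* Hilbert's basis theorem; a bad sequence of polynomials of minimal degrees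
   has a bad sequence of leading coefficients. *)
Theorem noetherian_poly (R : comNzRingType) :
  noetherian R -> noetherian {poly R}.
Proof.
move=> nR u; apply: contrapT => bad.
pose I := idealg (range u).
have Ii : is_ideal I := idealg_ideal _.
have stage p : I p -> exists n, idealg [set u i | i in `I_n] p.
  rewrite /I -[range u]set0U => /idealg_initial[n np].
  by exists n; rewrite -[[set u i | i in `I_n]]set0U.
have out (l : seq {poly R}) : (forall p, p \in l -> I p) ->
    exists p, I p /\ ~ idealg [set` l] p.
  move=> lI.
  have [n nl] : exists n, forall p, p \in l -> idealg [set u i | i in `I_n] p.
    elim: l lI => [|p l IH] lI; first by exists 0%N.
    have [n nl] : exists n, forall p, p \in l -> idealg [set u i | i in `I_n] p.
      by apply: IH => q ql; apply: lI; rewrite inE ql orbT.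
    have [m mp] : exists n, idealg [set u i | i in `I_n] p.
      by apply: stage; apply: lI; rewrite mem_head.
    exists (maxn n m) => q; rewrite inE => /orP[/eqP ->|/nl].
      by apply: idealgS mp => _ [i im <-]; exists i => //=; rewrite /= leq_max im orbT.
    by apply: idealgS => _ [i im <-]; exists i => //=; rewrite /= leq_max im.
  exists (u n); split; first by apply: idealg_sub; exists n.
  move=> h; apply: bad; exists n.
  by apply: idealg_min h; [exact: idealg_ideal | exact: nl].
have pick (l : seq {poly R}) : exists p, (forall q, q \in l -> I q) ->
    [/\ I p, ~ idealg [set` l] p &
        forall q, I q -> ~ idealg [set` l] q -> (size p <= size q)%N].
  case: (pselect (forall q, q \in l -> I q)) => [lI|]; last by exists 0.
  have [p [Ip lp]] := out _ lI.
  have ex : exists k, `[< exists q, [/\ I q, ~ idealg [set` l] q & size q = k] >].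
    by exists (size p); apply/asboolP; exists p.
  case: (ex_minnP ex) => k /asboolP[q [Iq lq sq]] kmin.
  exists q => _; split=> // r Ir lr; rewrite sq; apply: kmin.
  by apply/asboolP; exists r.
have [f fP] := choice pick.
pose L := fix L n := if n is n'.+1 then rcons (L n') (f (L n')) else [::].
have LI n q : q \in L n -> I q.
  elim: n q => // n IH q /=; rewrite mem_rcons inE => /orP[/eqP ->|]; last exact: IH.
  by case: (fP (L n) IH).
have LS n i : (i < n)%N -> f (L i) \in L n.
  elim: n => // n IH; rewrite ltnS leq_eqVlt /= mem_rcons inE => /orP[/eqP ->|/IH ->].
    by rewrite eqxx.
  by rewrite orbT.
have Lsub m n : (m <= n)%N -> idealg [set` L m] `<=` idealg [set` L n].
  move=> mn; apply: idealgS => q /=; elim: n mn => [|n IH].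
    by rewrite leqn0 => /eqP ->.
  rewrite leq_eqVlt => /orP[/eqP -> //|]; rewrite ltnS => /IH h /h.
  by rewrite /= mem_rcons inE => ->; rewrite orbT.
pose v n := f (L n).
have vP n := fP (L n) (LI n).
have smono m n : (m <= n)%N -> (size (v m) <= size (v n))%N.
  move=> mn; have [_ _ h] := vP m; have [Iv nv _] := vP n; apply: h => // /Lsub h.
  exact/nv/h.
have [n [k [a [s [Ss e]]]]] := nR (fun n => lead_coef (v n)).
have [Iv nv minv] := vP n.
have Ss' i : exists j, (j < n)%N /\ lead_coef (v j) = s i.
  by have [j] := Ss i; exists j.
have [c cP] := choice Ss'.
have cn i : (c i < n)%N by case: (cP i).
(* Sizes do not decrease along the bad sequence, so each earlier v (c i) can be shifted up to the
   degree of v n. Then w cancels the leading term of v n, and v n - w is smaller but still outside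
   the ideal, against minimality. *)
pose w := \sum_(i < k) (a i)%:P * 'X^(size (v n) - size (v (c i))) * v (c i).
have Lw : idealg [set` L n] w.
  apply: ideal_sum; first exact: idealg_ideal.
  move=> i _; case: (idealg_ideal [set` L n]) => _ _; apply; apply: idealg_sub.
  exact: LS.
have Iw : I w.
  by move: Lw; apply: idealg_min => //; exact: LI.
have nvw : ~ idealg [set` L n] (v n - w).
  move=> h; apply: nv; rewrite -/(v n) -[v n](subrK w).
  by case: (idealg_ideal [set` L n]) => _ + _; apply.
have := minv _ (idealB Ii Iv Iw) nvw; rewrite -/(v n).
have vn0 : v n != 0.
  apply: contra_notN nv => /eqP h; rewrite -/(v n) h.
  by case: (idealg_ideal [set` L n]).
have svn : (0 < size (v n))%N by rewrite size_poly_gt0.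
rewrite leqNgt => /negP; apply.
suff: (size (v n - w)%R <= (size (v n)).-1)%N by rewrite -ltnS prednK.
apply/leq_sizeP => j; rewrite leq_eqVlt => /orP[/eqP <-|].
  rewrite coefB -lead_coefE e /w coef_sum; apply/eqP; rewrite subr_eq0; apply/eqP.
  apply: eq_bigr => i _; rewrite -mulrA coefCM coefXnM.
  have [_ <-] := cP i; congr (_ * _).
  have sc := smono _ _ (ltnW (cn i)).
  have [sz|sz] := posnP (size (v (c i))).
    move/eqP: sz; rewrite size_poly_eq0 => /eqP ->.
    by rewrite lead_coef0 coef0 if_same.
  rewrite ltnNge -subn1 leq_sub2l //=.
  rewrite lead_coefE; congr (_`_ _).
  by rewrite -subn1 -subnDA addnC subnDA subKn // subn1.
rewrite prednK // => jn; rewrite coefB nth_default // coef_sum big1 ?subr0 // => i _.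
rewrite -mulrA coefCM coefXnM; case: ifP => _; first by rewrite mulr0.
rewrite nth_default ?mulr0 //.
have sc := smono _ _ (ltnW (cn i)).
by rewrite leq_subRL ?(leq_trans (leq_subr _ _)) // subnK.
Qed.

(** Reduces identities of ring morphisms, and congruences modulo ideals, to constants and
    variables. *)
Lemma mpoly_ring_ind (R : comNzRingType) n (P : {mpoly R[n]} -> Prop) :
  (forall c, P c%:MP) -> (forall i, P 'X_i) ->
  (forall p q, P p -> P q -> P (p + q)) ->
  (forall p q, P p -> P q -> P (p * q)) -> forall p, P p.
Proof.
move=> PC PX PD PM p; rewrite [p]mpolyE.
apply: (big_ind P) => [|x y|]; [by rewrite -mpolyC0; apply: PC|exact: PD|].
move=> m _; rewrite -mul_mpolyC; apply: (PM) => //.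
rewrite mpolyXE_id.
apply: (big_ind P) => [|x y|]; [by rewrite -mpolyC1; apply: PC|exact: PM|].
move=> i _; elim: (m i) => [|k IH]; first by rewrite expr0 -mpolyC1; apply: PC.
by rewrite exprS; apply: PM.
Qed.

Lemma noetherian_mpoly (R : comNzRingType) n :
  noetherian R -> noetherian {mpoly R[n]}.
Proof.
move=> nR; elim: n => [|n IH].
  apply: (noetherian_image (f := @mpolyC 0 R)) nR => p.
  elim/mpoly_ring_ind: p => [c|[]//|p q [x <-] [y <-]|p q [x <-] [y <-]].
  - by exists c.
  - by exists (x + y); rewrite rmorphD.
  - by exists (x * y); rewrite rmorphM.
(* The outer variable goes to the last one; the map is surjective, and Noetherianity passes to
   images. *)
pose g (x : {poly {mpoly R[n]}}) : {mpoly R[n.+1]} :=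
  (map_poly (@mwiden n R) x).['X_ord_max].
have gM : monoid_morphism g.
  by split=> [|x y]; rewrite /g ?rmorph1 ?hornerC // rmorphM hornerM.
have gD : zmod_morphism g by move=> x y; rewrite /g rmorphB hornerD hornerN.
pose gz := GRing.isZmodMorphism.Build _ _ g gD.
pose gm := GRing.isMonoidMorphism.Build _ _ g gM.
pose gr : {rmorphism {poly {mpoly R[n]}} -> {mpoly R[n.+1]}} :=
  HB.pack g gz gm.
apply: (noetherian_image (f := gr)) (noetherian_poly IH) => p.
elim/mpoly_ring_ind: p => [c|i|p q [x <-] [y <-]|p q [x <-] [y <-]].
- by exists (c%:MP)%:P; rewrite /= /g map_polyC hornerC /= mwidenC.
- case: (unliftP ord_max i) => [j ->|->]; last first.
    by exists 'X; rewrite /= /g map_polyX hornerX.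
  exists ('X_j)%:P; rewrite /= /g map_polyC hornerC /= mwidenX; congr 'X_[_].
  by rewrite mnmwiden1; congr U_(_)%MM; apply: val_inj; rewrite /= /bump leqNgt ltn_ord.
- by exists (x + y); rewrite rmorphD.
- by exists (x * y); rewrite rmorphM.
Qed.

(** Noetherianity of the quotient by F, stated without forming it: finitely many generators of the
    ideal of F and all u i already occur at a finite stage. *)
Lemma noetherian_mod (R : comNzRingType) (F : set R) (u : nat -> R) :
  noetherian R -> exists n, idealg (F `|` [set u i | i in `I_n]) (u n).
Proof.
move=> nR; have [k [s [sJ sg]]] := noetherian_fg (idealg (F `|` range u)) nR.
have [n nP] := choice (fun i => idealg_initial (sJ i)).
exists (\max_i n i)%N.
have : idealg (range s) (u (\max_i n i)%N).
  by apply: sg; apply: idealg_sub; right; exists (\max_i n i)%N.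
apply: idealg_min; first exact: idealg_ideal.
by move=> _ [i _ <-]; apply: idealg_initialS (nP i); apply: leq_bigmax.
Qed.

(** * Polynomials near a smooth point *)

Lemma mderivXU (R : nzRingType) n (i j : 'I_n) :
  mderiv i 'X_j = (i == j)%:R :> {mpoly R[n]}.
Proof.
rewrite mderivX mnm1E eq_sym; case: eqP => [->|_]; last by rewrite scale0r.
have -> : (U_(j) - U_(j) = 0 :> 'X_{1..n})%MM.
  by apply/mnmP => k; rewrite mnmBE subnn mnm0E.
by rewrite mpolyX0 scale1r.
Qed.

Lemma mderivXn (R : comNzRingType) N (i : 'I_N) e :
  mderiv i ('X_i ^+ e : {mpoly R[N]}) = e%:R * 'X_i ^+ e.-1.
Proof.
elim: e => [|e IH]; first by rewrite expr0 -mpolyC1 mderivC mul0r.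
rewrite exprS mderivM IH mderivXU eqxx mul1r /= mulrCA -{1}[_ ^+ e]mul1r.
case: e {IH} => [|e]; first by rewrite mul0r addr0.
by rewrite -exprS -mulrDl [in RHS]mulrS.
Qed.

Lemma mderivXn_neq (R : comNzRingType) N (i j : 'I_N) e : i != j ->
  mderiv i ('X_j ^+ e : {mpoly R[N]}) = 0.
Proof.
move=> ij; elim: e => [|e IH]; first by rewrite expr0 -mpolyC1 mderivC.
by rewrite exprS mderivM IH mderivXU (negPf ij) mul0r mulr0 addr0.
Qed.

Lemma meval_ideal (R : comNzRingType) N (v : 'I_N -> R) :
  is_ideal [set p : {mpoly R[N]} | p.@[v] = 0].
Proof.
split=> [|p q hp hq|a p hp] /=; first exact: meval0.
  by rewrite mevalD hp hq addr0.
by rewrite mevalM hp mulr0.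
Qed.

Section LocalRing.
Variables (K : fieldType) (N : nat) (x : 'I_N -> K).
Local Notation A := {mpoly K[N]}.
Implicit Types (p q : A) (I J M : set A).

(* The line through x and the generic point; the order of p at x is the
   order of [along p] in 'X.  The evaluation morphisms are locked because
   unification may otherwise unfold [mmap]. *)
Definition along : A -> {poly A} := locked
  (mmap (polyC \o @mpolyC N K) (fun i => (x i)%:MP%:P + ('X_i - (x i)%:MP) *: 'X)).

Fact along_zmod : zmod_morphism along.
Proof. by rewrite /along -lock; exact: mmap_is_additive. Qed.

Fact along_monoid : monoid_morphism along.
Proof. by rewrite /along -lock; split; [exact: rmorph1|exact: rmorphM]. Qed.

HB.instance Definition _ := GRing.isZmodMorphism.Build A {poly A} along along_zmod.
HB.instance Definition _ := GRing.isMonoidMorphism.Build A {poly A} along along_monoid.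

Lemma along0 : along 0 = 0. Proof. exact: rmorph0. Qed.
Lemma alongD p q : along (p + q) = along p + along q. Proof. exact: rmorphD. Qed.
Lemma alongM p q : along (p * q) = along p * along q. Proof. exact: rmorphM. Qed.

Lemma alongC c : along c%:MP = c%:MP%:P.
Proof. by rewrite /along -lock mmapC. Qed.

Lemma alongX i : along 'X_i = (x i)%:MP%:P + ('X_i - (x i)%:MP) *: 'X.
Proof. by rewrite /along -lock mmapX mmap1U. Qed.

Lemma along_horner1 p : (along p).[1] = p.
Proof.
elim/mpoly_ring_ind: p => [c|i|p q hp hq|p q hp hq].
- by rewrite alongC hornerC.
- by rewrite alongX hornerD hornerC hornerZ hornerX mulr1 addrC subrK.
- by rewrite alongD hornerD hp hq.
- by rewrite alongM hornerM hp hq.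
Qed.

Lemma along_coef0 p : (along p)`_0 = (p.@[x])%:MP.
Proof.
elim/mpoly_ring_ind: p => [c|i|p q hp hq|p q hp hq].
- by rewrite alongC coefC mevalC.
- by rewrite alongX coefD coefC coefZ coefX mulr0 addr0 mevalXU.
- by rewrite alongD coefD hp hq mevalD mpolyCD.
- by rewrite alongM coef0M hp hq mevalM mpolyCM.
Qed.

(** The k-th power of the maximal ideal at x. *)
Definition vanish_order (k : nat) : set A :=
  [set p | forall j, (j < k)%N -> (along p)`_j = 0].

Lemma vanish_order_ideal k : is_ideal (vanish_order k).
Proof.
split.
- by move=> j _; rewrite along0 coef0.
- by move=> p q hp hq j jk; rewrite alongD coefD hp // hq // addr0.
- move=> p q hq j jk; rewrite alongM coefM big1 // => i _.
  by rewrite hq ?mulr0 //; apply: leq_ltn_trans jk; apply: leq_subr.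
Qed.

Lemma vanish_orderS k l : (k <= l)%N -> vanish_order l `<=` vanish_order k.
Proof. by move=> kl p hp j jk; apply: hp; apply: leq_trans kl. Qed.

Lemma vanish_orderM k l p q : vanish_order k p -> vanish_order l q ->
  vanish_order (k + l) (p * q).
Proof.
move=> hp hq j jk; rewrite alongM coefM big1 // => -[i /= ij] _.
have [ik|ki] := ltnP i k; first by rewrite hp ?mul0r.
by rewrite hq ?mulr0 // ltn_subLR // (leq_trans jk) // leq_add2r.
Qed.

(** Orders add: the lowest nonzero coefficients along the generic line multiply to a nonzero element
    of the domain A. *)
Lemma vanish_order_prime k l p q : vanish_order (k + l).+1 (p * q) ->
  vanish_order k.+1 p \/ vanish_order l.+1 q.
Proof.
move=> hpq; apply: contrapT => /not_orP[np nq].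
have low m r : ~ vanish_order m.+1 r -> exists i, [/\ (i <= m)%N,
    (along r)`_i != 0 & forall j, (j < i)%N -> (along r)`_j = 0].
  move=> nr; have ex : exists i, (i <= m)%N && ((along r)`_i != 0).
    apply: contrapT => ne; apply: nr => i im; apply/eqP; apply: contrapT => /negP ri.
    by apply: ne; exists i; rewrite -ltnS im.
  case: (ex_minnP ex) => i /andP[im ri] imin; exists i; split=> // j ji.
  apply/eqP; apply: contraTT ji => rj; rewrite -leqNgt.
  have [//|ji] := leqP i j.
  by have := imin j; rewrite rj (leq_trans (ltnW ji) im) leqNgt ji => /(_ isT).
have [i [ik pi pmin]] := low _ _ np; have [j [jl qj qmin]] := low _ _ nq.
have /eqP : (along (p * q))`_(i + j) = 0 by apply: hpq; rewrite ltnS leq_add.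
have ij : (i < (i + j).+1)%N by rewrite ltnS leq_addr.
rewrite alongM coefM (bigD1 (Ordinal ij)) //= addKn big1 ?addr0.
  by rewrite mulf_eq0 (negPf pi) (negPf qj).
move=> [h hij] /=; rewrite -val_eqE /= neq_ltn => /orP[hi|ih].
  by rewrite pmin ?mul0r.
by rewrite qmin ?mulr0 //; lia.
Qed.

Lemma vanish_order1 p : vanish_order 1 p <-> p.@[x] = 0.
Proof.
split=> [/(_ 0%N isT)|px [|//] _]; rewrite along_coef0; last by rewrite px.
by move=> /(congr1 (meval x)); rewrite mevalC meval0.
Qed.

(** * The Rees algebra at a point and Krull's intersection theorem *)

Local Notation B := {mpoly A[N]}.

(** The image is the Rees algebra of the maximal ideal at x. Presenting it by a polynomial ring over
    A makes Noetherianity of B applicable. *)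
Definition rees : B -> {poly A} := locked
  (mmap (@polyC A) (fun i => ('X_i - (x i)%:MP) *: 'X)).

Fact rees_zmod : zmod_morphism rees.
Proof. by rewrite /rees -lock; exact: mmap_is_additive. Qed.

Fact rees_monoid : monoid_morphism rees.
Proof. by rewrite /rees -lock; split; [exact: rmorph1|exact: rmorphM]. Qed.

HB.instance Definition _ := GRing.isZmodMorphism.Build B {poly A} rees rees_zmod.
HB.instance Definition _ := GRing.isMonoidMorphism.Build B {poly A} rees rees_monoid.

Lemma rees0 : rees 0 = 0. Proof. exact: rmorph0. Qed.
Lemma reesD (p q : B) : rees (p + q) = rees p + rees q. Proof. exact: rmorphD. Qed.
Lemma reesM (p q : B) : rees (p * q) = rees p * rees q. Proof. exact: rmorphM. Qed.

Lemma reesC c : rees c%:MP = c%:P.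
Proof. by rewrite /rees -lock mmapC. Qed.

Lemma reesX i : rees 'X_i = ('X_i - (x i)%:MP) *: 'X.
Proof. by rewrite /rees -lock mmapX mmap1U. Qed.

Lemma rees_coef_gt0 (H : B) j : ((rees H)`_j.+1).@[x] = 0.
Proof.
elim/mpoly_ring_ind: H j => [c|i|p q hp hq|p q hp hq] j.
- by rewrite reesC coefC meval0.
- by rewrite reesX coefZ mevalM mevalB mevalXU mevalC subrr mul0r.
- by rewrite reesD coefD mevalD hp hq addr0.
- rewrite reesM coefM raddf_sum big1 //= => -[[|i] /= ij] _.
    by rewrite mevalM subn0 hq mulr0.
  by rewrite mevalM hp mul0r.
Qed.

(** The coefficient of degree j is a form of degree j in the X_i - x_i, hence lies in the k-th power
    of the maximal ideal for every k up to j. *)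
Lemma along_rees p j k : (k <= j)%N ->
  exists H, rees H = (along p)`_j *: 'X^k.
Proof.
elim/mpoly_ring_ind: p j k => [c|i|p q hp hq|p q hp hq] j k kj.
- rewrite alongC coefC; case: eqP => [j0|_]; last by exists 0; rewrite rees0 scale0r.
  move: kj; rewrite j0 leqn0 => /eqP ->.
  by exists (c%:MP)%:MP; rewrite reesC expr0 alg_polyC.
- rewrite alongX coefD coefC coefZ coefX.
  case: j kj => [|[|j]] kj.
  + move: kj; rewrite leqn0 => /eqP ->; exists ((x i)%:MP)%:MP.
    by rewrite reesC mulr0 addr0 expr0 alg_polyC.
  + rewrite add0r mulr1; case: k kj => [|[|//]] _.
      by exists ('X_i - (x i)%:MP)%:MP; rewrite reesC expr0 alg_polyC.
    by exists 'X_i; rewrite reesX expr1.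
  + by exists 0; rewrite rees0 mulr0 addr0 scale0r.
- have [G Gp] := hp _ _ kj; have [H Hq] := hq _ _ kj.
  by exists (G + H); rewrite reesD Gp Hq alongD coefD scalerDl.
- rewrite alongM coefM scaler_suml.
  elim/big_rec: _ => [|i y _ [H IH]].
  by exists 0; exact: rees0.
  (* The exponent k is shared between the factors of degrees i and j - i: the first takes as much as
     it can, and the rest fits because k <= j. *)
  have : (minn k i <= i)%N by rewrite geq_minr.
  move=> /hp[G1 e1].
  have : (k - minn k i <= j - i)%N by have := ltn_ord i; lia.
  move=> /hq[G2 e2].
  exists (G1 * G2 + H); rewrite reesD reesM e1 e2 IH; congr (_ + _).
  rewrite -scalerAl -scalerAr scalerA -exprD.
  by rewrite subnKC // geq_minl.
Qed.

Lemma vanish_order_rees k p : vanish_order k p -> exists H, rees H = p *: 'X^k.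
Proof.
move=> hp; rewrite -[p in p *: _]along_horner1 horner_coef scaler_suml.
elim/big_rec: _ => [|i y _ [H IH]]; first by exists 0; exact: rees0.
rewrite expr1n mulr1; have [ik|ki] := ltnP i k.
  by rewrite hp // scale0r add0r; exists H.
have [G Gp] := along_rees p ki.
by exists (G + H); rewrite reesD Gp IH.
Qed.

(* Krull's intersection theorem.  In the Rees algebra (Perdry's argument) the
   relation that Noetherianity gives between the homogeneous elements p_k X^k,
   with p_k congruent to p, is compared in degree k. *)
Lemma krull_intersection (F : set A) p :
  (forall k, exists q, vanish_order k q /\ idealg F (p - q)) ->
  exists2 q, q.@[x] != 0 & idealg F (q * p).
Proof.
move=> /choice[u uP].
have /choice[H HP] k : exists H, rees H = u k *: 'X^k.
  by apply: vanish_order_rees; case: (uP k).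
have Fi := idealg_ideal F.
have nB : noetherian B by do 2!apply: noetherian_mpoly; exact: noetherian_field.
have [n] := noetherian_mod [set f%:MP | f in F] H nB.
(* J consists of the h whose coefficient of T^n is, modulo F, of the form c p with c(x) = 0. The
   Noetherian relation puts u n T^n into J, so p is congruent to u n, hence to c p, and 1 - c is the
   wanted multiplier. *)
pose J : set {poly A} := [set h | exists c : A, c.@[x] = 0 /\ idealg F (h`_n - c * p)].
have JF h f : F f -> J (h * f%:P).
  move=> Ff; exists 0; rewrite mul0r subr0 coefMC meval0; split=> //.
  by case: Fi => _ _; apply; apply: idealg_sub.
have JD h1 h2 : J h1 -> J h2 -> J (h1 + h2).
  move=> [c1 [c10 h1F]] [c2 [c20 h2F]]; exists (c1 + c2).
  rewrite mevalD c10 c20 addr0 coefD mulrDl opprD addrACA; split=> //.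
  by case: Fi => _ + _; apply.
have JX G i : (i < n)%N -> J (rees G * (u i *: 'X^i)).
  move=> lin; exists (rees G)`_(n - i).
  (* Since i < n, the coefficient of [rees G] involved has positive degree and therefore vanishes at
     x. *)
  have -> : (n - i = (n - i).-1.+1)%N by rewrite prednK // subn_gt0.
  rewrite rees_coef_gt0; split=> //.
  rewrite prednK ?subn_gt0 // -scalerAr coefZ coefMXn ltnNge (ltnW lin) /=.
  rewrite mulrC -mulrBr.
  have -> : u i - p = - (p - u i) by rewrite opprB.
  by case: (Fi) => _ _; apply; apply: idealN => //; case: (uP i).
move=> [k [a [s [Ss e]]]].
have : J (rees (H n)).
  rewrite e rmorph_sum /=; elim/big_rec: _ => [|i h _ Jh].
    by exists 0; rewrite meval0 coef0 mul0r subr0; split=> //; case: Fi.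
  apply: JD => //; rewrite reesM; case: (Ss i) => [[f Ff <-]|[j jn <-]].
    by rewrite reesC; apply: JF.
  by rewrite HP; apply: JX.
move=> [c [c0]]; rewrite HP coefZ coefXn eqxx mulr1 => un.
exists (1 - c); first by rewrite mevalB meval1 c0 subr0 oner_neq0.
have -> : (1 - c) * p = (p - u n) + (u n - c * p).
  by rewrite mulrBl mul1r addrA subrK.
by case: (Fi) => _ + _; apply => //; case: (uP n).
Qed.

(** * Substitution and Taylor expansion *)

Definition psub (a : 'cV[A]_N) : A -> A := locked
  (mmap (@mpolyC N K) (fun i => a i 0)).

Fact psub_zmod a : zmod_morphism (psub a).
Proof. by rewrite /psub -lock; exact: mmap_is_additive. Qed.

Fact psub_monoid a : monoid_morphism (psub a).
Proof. by rewrite /psub -lock; split; [exact: rmorph1|exact: rmorphM]. Qed.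

HB.instance Definition _ a := GRing.isZmodMorphism.Build A A (psub a) (psub_zmod a).
HB.instance Definition _ a := GRing.isMonoidMorphism.Build A A (psub a) (psub_monoid a).

Lemma psubD a p q : psub a (p + q) = psub a p + psub a q. Proof. exact: rmorphD. Qed.
Lemma psubM a p q : psub a (p * q) = psub a p * psub a q. Proof. exact: rmorphM. Qed.

Lemma psubC a c : psub a c%:MP = c%:MP.
Proof. by rewrite /psub -lock mmapC. Qed.

Lemma psubX a i : psub a 'X_i = a i 0.
Proof. by rewrite /psub -lock mmapX mmap1U. Qed.

Lemma psub_id p : psub (\col_i 'X_i) p = p.
Proof.
elim/mpoly_ring_ind: p => [c|i|p q hp hq|p q hp hq].
- by rewrite psubC.
- by rewrite psubX mxE.
- by rewrite psubD hp hq.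
- by rewrite psubM hp hq.
Qed.

Lemma psub_congr I (a b : 'cV[A]_N) p : is_ideal I -> (forall i, I (a i 0 - b i 0)) ->
  I (psub a p - psub b p).
Proof.
move=> Ii ab; have [I0 ID IM] := Ii.
elim/mpoly_ring_ind: p => [c|i|p q hp hq|p q hp hq].
- by rewrite !psubC subrr.
- by rewrite !psubX.
- by rewrite !psubD opprD addrACA; apply: ID.
- rewrite !psubM.
  have -> : psub a p * psub a q - psub b p * psub b q =
      psub a q * (psub a p - psub b p) + psub b p * (psub a q - psub b q) by ring.
  by apply: ID; apply: IM.
Qed.

Lemma psub_center M (a : 'cV[A]_N) p : is_ideal M ->
  (forall i, M (a i 0 - (x i)%:MP)) -> M (psub a p - (p.@[x])%:MP).
Proof.
move=> Mi Ma; have -> : (p.@[x])%:MP = psub (\col_i (x i)%:MP) p.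
  elim/mpoly_ring_ind: p => [c|i|u v hu hv|u v hu hv].
  - by rewrite mevalC psubC.
  - by rewrite mevalXU psubX mxE.
  - by rewrite mevalD mpolyCD hu hv psubD.
  - by rewrite mevalM mpolyCM hu hv psubM.
by apply: psub_congr => // i; rewrite mxE.
Qed.

(** The derivative is frozen at x instead of being taken at a. This costs an error in M I besides
    the quadratic one in I I, but keeps the Jacobian a constant matrix over K. *)
Lemma taylor1 M I I' (a d : 'cV[A]_N) p : is_ideal M -> is_ideal I -> is_ideal I' ->
  (forall u v, M u -> I v -> I' (u * v)) -> (forall u v, I u -> I v -> I' (u * v)) ->
  (forall i, M (a i 0 - (x i)%:MP)) -> (forall i, I (d i 0)) ->
  I' (psub (a + d) p - psub a p - \sum_i ((mderiv i p).@[x])%:MP * d i 0).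
Proof.
move=> Mi Ii I'i MI II Ma Id.
have Ms q : M (psub a q - (q.@[x])%:MP) := psub_center q Mi Ma.
pose D q := \sum_i ((mderiv i q).@[x])%:MP * d i 0.
have ID q : I (D q).
  by apply: ideal_sum => // i _; case: Ii => _ _; apply.
rewrite -/(D p); have [I'0 I'D I'M] := I'i.
elim/mpoly_ring_ind: p => [c|i|p q hp hq|p q hp hq].
- rewrite !psubC subrr sub0r /D big1 ?oppr0 // => i _.
  by rewrite mderivC meval0 mpolyC0 mul0r.
- rewrite !psubX mxE [X in X - _]addrAC subrr add0r /D (bigD1 i) //= big1 ?addr0.
    by rewrite mderivXU eqxx meval1 mul1r subrr.
  by move=> j ji; rewrite mderivXU (negPf ji) meval0 mul0r.
- have -> : D (p + q) = D p + D q.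
    rewrite /D -big_split; apply: eq_bigr => i _.
    by rewrite mderivD mevalD mpolyCD mulrDl.
  rewrite !psubD.
  have -> : psub (a + d) p + psub (a + d) q - (psub a p + psub a q) - (D p + D q) =
     (psub (a + d) p - psub a p - D p) + (psub (a + d) q - psub a q - D q) by ring.
  exact: I'D.
- have -> : D (p * q) = (p.@[x])%:MP * D q + (q.@[x])%:MP * D p.
    rewrite /D !big_distrr -big_split; apply: eq_bigr => i _ /=.
    by rewrite mderivM mevalD !mevalM mpolyCD !mpolyCM; ring.
  rewrite !psubM.
  have -> : psub (a + d) p * psub (a + d) q - psub a p * psub a q -
      ((p.@[x])%:MP * D q + (q.@[x])%:MP * D p) =
    psub (a + d) q * (psub (a + d) p - psub a p - D p)
    + (psub a p + D p) * (psub (a + d) q - psub a q - D q)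
    + D p * D q + (psub a p - (p.@[x])%:MP) * D q + (psub a q - (q.@[x])%:MP) * D p.
    by ring.
  apply: (I'D); last exact: MI.
  apply: (I'D); last exact: MI.
  apply: (I'D); last exact: II.
  by apply: (I'D); apply: I'M.
Qed.

Lemma mulmx_ideal I m n l (P : 'M[A]_(m, n)) (v : 'M[A]_(n, l)) : is_ideal I ->
  (forall i j, I (v i j)) -> forall i j, I ((P *m v) i j).
Proof.
move=> Ii Iv i j; rewrite mxE; apply: ideal_sum => // k _.
by case: Ii => _ _; apply.
Qed.

(** * Newton's iteration at a smooth point *)

Section Hensel.
Variables (c : nat) (f : 'I_c -> A) (J : 'M[K]_(c, N)) (Jr : 'M[K]_(N, c)).
Hypothesis JE : J = \matrix_(i, j) (mderiv j (f i)).@[x].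
Hypothesis JJr : J *m Jr = 1%:M.
Hypothesis fx : forall i, (f i).@[x] = 0.

Local Notation lift := (map_mx (@mpolyC N K)).

Let F (a : 'cV[A]_N) : 'cV[A]_c := \col_i psub a (f i).
Let X : 'cV[A]_N := \col_i 'X_i.
Let x' : 'cV[A]_N := \col_i (x i)%:MP.
(** The projector onto the tangent space ker J along the image of [Jr]. *)
Let E := 1%:M - Jr *m J.

(* Newton's iteration starts from the projection to the tangent space. *)
Fixpoint newton k : 'cV[A]_N :=
  if k is k'.+1 then newton k' - lift Jr *m F (newton k')
  else x' + lift E *m (X - x').

Let EJr : E *m Jr = 0.
Proof. by rewrite mulmxBl mul1mx -mulmxA JJr mulmx1 subrr. Qed.

Let EE : E *m E = E.
Proof. by rewrite {2}/E mulmxBr mulmx1 mulmxA EJr mul0mx subr0. Qed.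

Let JJr' : lift J *m lift Jr = 1%:M.
Proof. by rewrite -map_mxM JJr map_mx1. Qed.

Let Xx i : vanish_order 1 ((X - x') i 0).
Proof. by apply/vanish_order1; rewrite !mxE mevalB mevalXU mevalC subrr. Qed.

Lemma taylorF M I I' (a d : 'cV[A]_N) : is_ideal M -> is_ideal I -> is_ideal I' ->
  (forall u v, M u -> I v -> I' (u * v)) -> (forall u v, I u -> I v -> I' (u * v)) ->
  (forall i, M (a i 0 - (x i)%:MP)) -> (forall i, I (d i 0)) ->
  forall i, I' ((F (a + d) - F a - lift J *m d) i 0).
Proof.
move=> Mi Ii I'i MI II Ma Id i.
have := taylor1 (f i) Mi Ii I'i MI II Ma Id.
rewrite !mxE; congr I'; congr (_ - _); apply: eq_bigr => j _.
by rewrite JE !mxE.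
Qed.

Lemma newton_center k i : vanish_order 1 (newton k i 0 - (x i)%:MP).
Proof.
have Vi := vanish_order_ideal 1.
elim: k i => [|k IH] i.
  have -> : newton 0 i 0 - (x i)%:MP = (lift E *m (X - x')) i 0.
    by rewrite /= !mxE [X in X - _]addrC addrK.
  by apply: mulmx_ideal => // l j; rewrite ord1.
have -> : newton k.+1 i 0 - (x i)%:MP =
    (newton k i 0 - (x i)%:MP) - (lift Jr *m F (newton k)) i 0.
  by rewrite /= !mxE addrAC.
apply: (idealB Vi) => //; apply: (mulmx_ideal _ Vi) => l j; rewrite [j]ord1 mxE.
by have := psub_center (f l) Vi IH; rewrite fx mpolyC0 subr0.
Qed.

(** The correction by - Jr F cancels F to first order since J Jr = 1. Because the Jacobian is
    frozen, each step gains one order of vanishing. *)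
Lemma newton_root k i : vanish_order k.+1 (F (newton k) i 0).
Proof.
elim: k i => [|k IH] i.
  have := psub_center (f i) (vanish_order_ideal 1) (newton_center 0).
  by rewrite fx mpolyC0 subr0 mxE.
have := @taylorF (vanish_order 1) (vanish_order k.+1) (vanish_order k.+2) (newton k)
  (- (lift Jr *m F (newton k))) (vanish_order_ideal _) (vanish_order_ideal _)
  (vanish_order_ideal _).
rewrite mulmxN mulmxA JJr' mul1mx opprK subrK; apply.
- by move=> u v; exact: vanish_orderM.
- move=> u v hu hv; apply: (vanish_orderS _ (vanish_orderM hu hv)).
  by rewrite addSn addnS ltnS leq_addr.
- exact: newton_center.
- move=> j; rewrite mxE; apply: (idealN (vanish_order_ideal _)).
  by apply: mulmx_ideal _ (vanish_order_ideal _) _ _ _ => l h; rewrite ord1.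
Qed.

Lemma newton_step k i : vanish_order k.+1 (newton k.+1 i 0 - newton k i 0).
Proof.
have -> : newton k.+1 i 0 - newton k i 0 = - (lift Jr *m F (newton k)) i 0.
  by rewrite /= !mxE addrAC subrr add0r.
apply: (idealN (vanish_order_ideal _)).
apply: mulmx_ideal _ (vanish_order_ideal _) _ _ _ => l h; rewrite ord1.
exact: newton_root.
Qed.

Let modf k := [set p | exists y z, [/\ idealg (range f) y, vanish_order k z & p = y + z]].

Let modf_ideal k : is_ideal (modf k).
Proof. exact: ideal_add (idealg_ideal _) (vanish_order_ideal k). Qed.

(** On the zero set of f the iteration reproduces the point itself up to order k. The difference X -
    newton k has no tangential part ([tang]); its normal part is Jr J (X - newton k), which Taylor's
    formula at X expresses by F (newton k) and F X, the latter lying in (f). *)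
Lemma newton_approx k i : modf k.+1 ('X_i - newton k i 0).
Proof.
have tang k' : lift E *m (X - newton k') = 0.
  elim: k' => [|k' IH] /=.
    by rewrite opprD addrA mulmxBr mulmxA -map_mxM EE subrr.
  by rewrite opprB addrCA addrC mulmxDr IH add0r mulmxA -map_mxM EJr map_mx0 mul0mx.
have vm k' : vanish_order k' `<=` modf k'.
  by move=> p hp; exists 0, p; rewrite add0r; split=> //; case: (idealg_ideal (range f)).
have fm k' p : idealg (range f) p -> modf k' p.
  by move=> hp; exists p, 0; rewrite addr0; split=> //; case: (vanish_order_ideal k').
have -> : 'X_i - newton k i 0 = (X - newton k) i 0 by rewrite !mxE.
elim: k i => [|k IH] i.
  have -> : X - newton 0 = lift Jr *m lift J *m (X - x').
    rewrite /= opprD addrA -[X in X - _]mul1mx -mulmxBl; congr (_ *m _).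
    by rewrite map_mxB map_mx1 map_mxM opprB addrC subrK.
  by apply: vm; apply: mulmx_ideal _ (vanish_order_ideal _) _ _ _ => l h; rewrite ord1.
have := @taylorF (vanish_order 1) (modf k.+1) (modf k.+2) X
  (- (X - newton k)) (vanish_order_ideal _) (modf_ideal _) (modf_ideal _).
have -> : X + - (X - newton k) = newton k by rewrite opprB addrC subrK.
rewrite mulmxN opprK => tay.
have {}tay j : modf k.+2 ((F (newton k) + lift J *m (X - newton k)) j 0).
  have -> : F (newton k) + lift J *m (X - newton k) =
     (F (newton k) - F X + lift J *m (X - newton k)) + F X by rewrite addrAC subrK.
  rewrite mxE; case: (modf_ideal k.+2) => _ + _; apply; last first.
    by rewrite mxE psub_id; apply: fm; apply: idealg_sub; exists j.
  apply: tay => {j}.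
  - move=> u v hu [y [z [yf zk ->]]]; exists (u * y), (u * z); rewrite mulrDr.
    split=> //; first by case: (idealg_ideal (range f)) => _ _; apply.
    exact: (vanish_orderM hu zk).
  - move=> u v [y [z [yf zk ->]]] [y' [z' [yf' zk' ->]]].
    exists (y * (y' + z') + z * y'), (z * z'); split; last by ring.
      case: (idealg_ideal (range f)) => _ hD hM; apply: hD; last exact: hM.
      exact: idealMr (idealg_ideal _) _.
    apply: (vanish_orderS _ (vanish_orderM zk zk')).
    by rewrite addSn addnS ltnS leq_addr.
  - by move=> j; have := Xx j; rewrite !mxE.
  - by move=> j; rewrite mxE; apply: (idealN (modf_ideal _)).
have -> : X - newton k.+1 =
    lift Jr *m (F (newton k) + lift J *m (X - newton k)).
  have := tang k; rewrite {1}/E map_mxB map_mx1 map_mxM mulmxBl mul1mx.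
  move=> /eqP; rewrite subr_eq0 => /eqP e.
  by rewrite mulmxDr [in RHS]mulmxA -e /= opprB addrCA.
by apply: mulmx_ideal _ (modf_ideal _) _ _ _ => l h; rewrite ord1.
Qed.

(** Later iterates change only terms of order above k, so order i along the branch can be tested on
    any iterate from i on. *)
Lemma newton_stable k l p i : (i <= k)%N -> (k <= l)%N ->
  vanish_order i.+1 (psub (newton l) p) <-> vanish_order i.+1 (psub (newton k) p).
Proof.
move=> ik kl; have Vi := vanish_order_ideal i.+1.
suff d : vanish_order i.+1 (psub (newton l) p - psub (newton k) p).
  have [_ VD _] := Vi; split=> h.
    by rewrite -[psub (newton k) p](subKr (psub (newton l) p)); apply: (idealB Vi).
  by rewrite -[psub (newton l) p](subrK (psub (newton k) p)); apply: VD.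
apply: psub_congr => // j.
elim: l kl => [|l IH] kl.
  by move: kl; rewrite leqn0 => /eqP ->; rewrite subrr; case: Vi.
move: kl; rewrite leq_eqVlt => /orP[/eqP ->|]; first by rewrite subrr; case: Vi.
rewrite ltnS => kl.
have -> : newton l.+1 j 0 - newton k j 0 =
   (newton l.+1 j 0 - newton l j 0) + (newton l j 0 - newton k j 0).
  by rewrite addrA subrK.
case: Vi => _ VD _; apply: VD; last exact: IH.
have il : (i.+1 <= l.+1)%N by rewrite ltnS (leq_trans ik).
exact: (vanish_orderS il (newton_step (k:=l) j)).
Qed.

(* The functions vanishing along the formal branch of the zero set of f at x
   form a prime ideal, which coincides with (f) near x. *)
Lemma branch_prime : exists P : set A,
  [/\ is_ideal P, forall p q, P (p * q) -> P p \/ P q,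
      forall p, P p -> p.@[x] = 0, forall i, P (f i) &
      forall p, P p -> exists2 q, q.@[x] != 0 & idealg (range f) (q * p)].
Proof.
(* These are the p that vanish on the formal limit of the iterates. *)
exists [set p | forall k, vanish_order k.+1 (psub (newton k) p)]; split.
- split.
  + by move=> k; rewrite rmorph0; case: (vanish_order_ideal k.+1).
  + move=> p q hp hq k; rewrite psubD.
    by case: (vanish_order_ideal k.+1) => _ + _; apply.
  + by move=> a p hp k; rewrite psubM; case: (vanish_order_ideal k.+1) => _ _; apply.
- move=> p q hpq; apply: contrapT => /not_orP[/existsNP[i np] /existsNP[j nq]].
  have ij := hpq (i + j)%N; rewrite psubM in ij.
  case: (vanish_order_prime ij) => [/(newton_stable p (leqnn i) (leq_addr _ _)) //|].
  by move=> /(newton_stable q (leqnn j) (leq_addl _ _)).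
- move=> p /(_ 0%N) hp; apply/vanish_order1.
  have Vi := vanish_order_ideal 1.
  have := psub_center p Vi (newton_center 0) => h.
  have := idealB Vi hp h; rewrite subKr => /vanish_order1; rewrite mevalC => px.
  by apply/vanish_order1.
- by move=> i k; have := @newton_root k i; rewrite mxE.
- move=> p hp; apply: krull_intersection => k.
  (* This puts p into (f) up to terms of order k + 1, as p composed with [newton k] itself has that
     order; this is the hypothesis of Krull's theorem. *)
  have : modf k.+1 (p - psub (newton k) p).
    rewrite -{1}[p]psub_id; apply: psub_congr => // i.
    by rewrite mxE; apply: newton_approx.
  case=> y [z [yf zk e]]; exists (z + psub (newton k) p); split.
    apply: (vanish_orderS (leqnSn k)).
    by case: (vanish_order_ideal k.+1) => _ + _; apply.
  have -> // : p - (z + psub (newton k) p) = y.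
  by rewrite opprD addrCA addrC e addrK.
Qed.

End Hensel.
End LocalRing.

(** * Nullstellensatz over an uncountable field *)

Section Nullstellensatz.
Variable K : closedFieldType.
Hypothesis unctbl : ~ countable [set: K].

(** Countably many sets cover the uncountable field, so one of them is infinite. *)
Lemma uncountable_fibre (D : nat -> nat -> set K) : (forall c, exists d e, D d e c) ->
  exists d e, exists2 c : nat -> K, injective c & forall j, D d e (c j).
Proof.
move=> Dc; apply: contrapT => nD; apply: unctbl.
have -> : [set: K] = \bigcup_(i in [set: nat * nat]) D i.1 i.2.
  apply/seteqP; split=> // c _; have [d [e De]] := Dc c.
  by exists (d, e).
apply: bigcup_countable => // -[d e] _; apply: finite_set_countable.
apply: contrapT => /infiniteP/card_leP[f]; apply: nD.
exists d, e, (fun j => set_val (f (SigSub (in_setT j)))); last by move=> j; exact: set_valP.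
by move=> i j /val_inj h; have [] := 'inj_f (in_setT _) (in_setT _) h.
Qed.

Variable N : nat.
Local Notation A := {mpoly K[N]}.
Implicit Types (p q : A) (J : set A).

(** There are more polynomials than monomials of degree less than d. *)
Lemma bounded_msize_dependent d (a : nat -> A) : (forall j, (msize (a j) <= d)%N) ->
  exists n (l : 'I_n -> K), (exists j, l j != 0) /\ \sum_(j < n) l j *: a j = 0.
Proof.
move=> ad; pose m := #|{: 'X_{1..N < d}}|.
pose G := \matrix_(j < m.+1, t < m) (a j)@_(enum_val t).
have : kermx G != 0.
  rewrite kermx_eq0 /row_free; apply/eqP => rG.
  by have := rank_leq_col G; rewrite rG ltnn.
case/rowV0Pn => l /sub_kermxP lG /rV0Pn[j lj].
exists m.+1, (l 0); split; first by exists j.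
apply/mpolyP => t; rewrite raddf_sum mcoeff0 /=.
have [td|dt] := ltnP (mdeg t) d.
  have /rowP/(_ (enum_rank (BMultinom td))) := lG.
  rewrite !mxE => lGt; rewrite -[RHS]lGt; apply: eq_bigr => i _.
  by rewrite mcoeffZ mxE enum_rankK.
rewrite big1 // => i _; rewrite mcoeffZ memN_msupp_eq0 ?mulr0 //.
by apply: msize_mdeg_ge; apply: leq_trans dt.
Qed.

(* Otherwise p ^+ k_c = (X_i - c) * g_c modulo J for all c; uncountably many c
   share k_c and a bound on deg g_c, so that the g_c are linearly dependent,
   and clearing the denominators X_i - c of the relation gives a nonzero
   polynomial h with h(X_i) * p ^+ k in J. *)
Lemma power_avoid_var J p (i : 'I_N) : is_ideal J -> (forall k, ~ J (p ^+ k)) ->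
  exists c, forall k b, ~ J (p ^+ k - b * ('X_i - c%:MP)).
Proof.
move=> Ji pJ; have [J0 JD JM] := Ji; apply: contrapT => noc.
have /choice[k /choice[g kg]] c : exists k b, J (p ^+ k - b * ('X_i - c%:MP)).
  apply: contrapT => nk; apply: noc; exists c => k b h; apply: nk.
  by exists k, b.
have [d [e [c cinj ce]]] := @uncountable_fibre
   (fun d e => [set c | (msize (g c) <= d)%N /\ k c = e])
   (fun c => ex_intro _ (msize (g c)) (ex_intro _ (k c) (conj (leqnn _) erefl))).
have [n [l [[j lj] lg]]] := @bounded_msize_dependent d (g \o c) (fun j => (ce j).1).
(* The numerator of the sum of the l j / (X - c j). It is nonzero since at c j only the j-th summand
   survives. *)
pose h := \sum_(j < n) l j *: \prod_(r < n | r != j) ('X - (c r)%:P).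
have h0 : h != 0.
  apply/eqP => /(congr1 (horner^~ (c j))); rewrite horner0 /h horner_sum (bigD1 j) //=.
  rewrite [X in _ + X]big1 ?addr0; last first.
    move=> r rj; rewrite hornerZ horner_prod (bigD1 j) 1?eq_sym //=.
    by rewrite hornerXsubC subrr mul0r mulr0.
  rewrite hornerZ horner_prod => /eqP; rewrite mulf_eq0 (negPf lj) /= => /prodf_eq0[r rj].
  by rewrite hornerXsubC subr_eq0 (inj_eq cinj) => /eqP/val_inj/esym/eqP; rewrite (negPf rj).
pose ev (q : {poly K}) : A := (map_poly (@mpolyC N K) q).['X_i].
have evX z : ev ('X - z%:P) = 'X_i - z%:MP.
  by rewrite /ev rmorphB /= map_polyX map_polyC hornerXsubC.
have Jh : J (p ^+ e * ev h).
  have evh : ev h = \sum_(j < n) (l j)%:MP * \prod_(r < n | r != j) ('X_i - (c r)%:MP).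
    rewrite /ev /h rmorph_sum horner_sum; apply: eq_bigr => r _ /=.
    rewrite map_polyZ hornerZ rmorph_prod horner_prod; congr (_ * _).
    by apply: eq_bigr => s _; exact: evX.
  (* The parts with g add up to the relation among the g (c j) times the full product, that is, to
     zero. *)
  pose w := \sum_(j < n) (l j)%:MP * \prod_(r < n | r != j) ('X_i - (c r)%:MP) *
              (p ^+ e - g (c j) * ('X_i - (c j)%:MP)).
  suff -> : p ^+ e * ev h = w.
    apply: ideal_sum => // r _; apply: JM.
    by have [_ <-] := ce r; apply: kg.
  apply/eqP; rewrite -subr_eq0 evh /w mulr_sumr -sumrB.
  have z : \sum_(j < n) l j *: g (c j) * \prod_(r < n) ('X_i - (c r)%:MP) = 0.
    by rewrite -mulr_suml lg mul0r.
  apply/eqP; rewrite -[RHS]z; apply: eq_bigr => r _.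
  rewrite [in RHS](bigD1 r) //= -mul_mpolyC; ring.
(* Each factor X_i - z of the split polynomial h can be traded for the power p ^ (k z), to which a
   multiple of it is congruent. *)
have hprod (s : seq K) e' : J (p ^+ e' * \prod_(z <- s) ('X_i - z%:MP)) ->
    exists e'', J (p ^+ e'').
  elim: s e' => [|z s IH] e'; first by rewrite big_nil mulr1; exists e'.
  rewrite big_cons => h1; apply: (IH (e' + k z)%N).
  rewrite exprD.
  have -> : p ^+ e' * p ^+ k z * \prod_(z <- s) ('X_i - z%:MP) =
     g z * (p ^+ e' * (('X_i - z%:MP) * \prod_(z <- s) ('X_i - z%:MP))) +
     (p ^+ e' * \prod_(z <- s) ('X_i - z%:MP)) * (p ^+ k z - g z * ('X_i - z%:MP)).
    by ring.
  by apply: JD; apply: JM.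
have [s hs] := closed_field_poly_normal h.
have [] := @hprod s e; last by move=> e' /pJ.
have -> : p ^+ e * \prod_(z <- s) ('X_i - z%:MP) = ((lead_coef h)^-1)%:MP * (p ^+ e * ev h).
  have -> : ev h = (lead_coef h)%:MP * \prod_(z <- s) ('X_i - z%:MP).
    rewrite {1}hs /ev map_polyZ hornerZ rmorph_prod horner_prod; congr (_ * _).
    by apply: eq_bigr => z _; exact: evX.
  rewrite [RHS]mulrCA; congr (_ * _).
  by rewrite mulrA -mpolyCM mulVf ?lead_coef_eq0 // mpolyC1 mul1r.
exact: JM.
Qed.

Lemma power_avoid_point J p : is_ideal J -> (forall k, ~ J (p ^+ k)) ->
  exists (y : 'I_N -> K) J', [/\ is_ideal J', J `<=` J', forall k, ~ J' (p ^+ k) &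
    forall i, J' ('X_i - (y i)%:MP)].
Proof.
move=> Ji pJ.
suff /(_ N (leqnn N)) [J' [J'i JJ' pJ' /choice[y yJ]]] : forall m, (m <= N)%N ->
    exists J', [/\ is_ideal J', J `<=` J', forall k, ~ J' (p ^+ k) &
    forall i : 'I_N, exists c, (i < m)%N -> J' ('X_i - c%:MP)].
  by exists y, J'; split=> // i; apply: yJ.
elim=> [|m IH] mN; first by exists J; split=> // i; exists 0.
have [J' [J'i JJ' pJ' J'X]] := IH (ltnW mN).
have [c cP] := power_avoid_var (Ordinal mN) J'i pJ'.
have [J0 JD JM] := J'i.
(* The ideal generated by J' and X_m - c. *)
pose J2 := [set q | exists b, J' (q - b * ('X_(Ordinal mN) - c%:MP))].
have J'2 : J' `<=` J2 by move=> q hq; exists 0; rewrite mul0r subr0.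
exists J2; split.
- split; first exact: J'2.
  + move=> u v [b hb] [b' hb']; exists (b + b').
    by rewrite mulrDl opprD addrACA; apply: JD.
  + by move=> a u [b hb]; exists (a * b); rewrite -mulrA -mulrBr; apply: JM.
- by move=> q /JJ'/J'2.
- by move=> k [b]; apply: cP.
- move=> i; have [c' c'P] := J'X i.
  have [im|mi] := ltnP i m; first by exists c' => _; apply/J'2/c'P.
  exists c; rewrite ltnS => im; exists 1; rewrite mul1r.
  have -> : i = Ordinal mN by apply: val_inj; apply/eqP; rewrite eqn_leq im mi.
  by rewrite subrr.
Qed.

(** If no power of p is in J, enlarge J to a J' that contains all X_i - y_i and still avoids the
    powers of p. Modulo J' every polynomial is its value at y; as 1 is not in J', y is a zero of J,
    so p(y) = 0 and p lies in J', a contradiction. *)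
Theorem nullstellensatz J p : is_ideal J ->
  (forall y : 'I_N -> K, (forall q, J q -> q.@[y] = 0) -> p.@[y] = 0) ->
  exists k, J (p ^+ k).
Proof.
move=> Ji pv; apply: contrapT => nk.
have [|y [J' [J'i JJ' pJ' yJ']]] := @power_avoid_point J p Ji.
  by move=> k pk; apply: nk; exists k.
have [J0 JD JM] := J'i.
have at_y q : J' (q - (q.@[y])%:MP).
  elim/mpoly_ring_ind: q => [c|i|q r hq hr|q r hq hr].
  - by rewrite mevalC subrr.
  - by rewrite mevalXU.
  - by rewrite mevalD mpolyCD opprD addrACA; apply: JD.
  - rewrite mevalM mpolyCM.
    have -> : q * r - (q.@[y])%:MP * (r.@[y])%:MP =
       r * (q - (q.@[y])%:MP) + (q.@[y])%:MP * (r - (r.@[y])%:MP) by ring.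
    by apply: JD; apply: JM.
have : p.@[y] = 0.
  apply: pv => q /JJ' hq; apply/eqP; apply: contrapT => /negP qy.
  have h : J' ((q.@[y])%:MP) by rewrite -[_%:MP](subKr q); apply: idealB.
  apply: (pJ' 0%N); rewrite expr0.
  have -> : 1 = ((q.@[y])^-1)%:MP * (q.@[y])%:MP :> A.
    by rewrite -mpolyCM mulVf // mpolyC1.
  exact: JM.
by move=> py; apply: (pJ' 1%N); have := at_y p; rewrite py mpolyC0 subr0 expr1.
Qed.

End Nullstellensatz.

(** * Smooth points are locally irreducible *)

Lemma meval_row (R : comNzRingType) N (y : 'I_N -> R) (p : {mpoly R[N]}) :
  p.@[(\row_i y i) 0] = p.@[y].
Proof. by apply: meval_eq => i; rewrite mxE. Qed.

Lemma smooth_at_irreducible (K : closedFieldType) N (I : set {mpoly K[N]})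
    (x : 'rV[K]_N) : ~ countable [set: K] -> smooth_at I x ->
  let V := [set y : 'rV[K]_N | forall p, I p -> p.@[y 0] = 0] in
  exists2 q : {mpoly K[N]}, q.@[x 0] != 0 & forall a b : {mpoly K[N]},
    (forall y : 'rV_N, V y -> q.@[y 0] != 0 -> a.@[y 0] * b.@[y 0] = 0) ->
    (forall y : 'rV_N, V y -> q.@[y 0] != 0 -> a.@[y 0] = 0) \/
    (forall y : 'rV_N, V y -> q.@[y 0] != 0 -> b.@[y 0] = 0).
Proof.
move=> unc [Ix [c [f [If Iloc Jfree]]]] V.
have /row_freeP[Jr JJr] := Jfree.
have [P [Pi Pprime Px Pf Ploc]] := branch_prime (erefl _) JJr (fun i => Ix _ (If i)).
have Fi := idealg_ideal (range f).
have [PO PD PM] := Pi.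
have Prange : idealg (range f) `<=` P.
  by apply: idealg_min => // _ [i _ <-].
have IP : I `<=` P.
  (* Some q p lies in (f), hence in P, and q is not in P because q(x) is nonzero. Here [ideal_gen]
     and [idealg] unfold to the same set. *)
  move=> p /Iloc[q q0 /Prange/Pprime[/Px/eqP|//]]; by rewrite (negPf q0).
have nA : noetherian {mpoly K[N]} by apply: noetherian_mpoly; exact: noetherian_field.
have [k [s [sP Ps]]] := noetherian_fg P nA.
have sq i : exists q, q.@[x 0] != 0 /\ idealg (range f) (q * s i).
  by have [q q0 qs] := Ploc _ (sP i); exists q.
have [q qP] := choice sq.
(* One denominator for all generators of P: where Q is nonzero, the zeros of I are zeros of P. *)
pose Q := \prod_i q i.
have QP p : P p -> idealg (range f) (Q * p).
  move=> /Ps; move: p; apply: idealg_min.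
    case: Fi => F0 FD FM; split; first by rewrite /= mulr0.
    - by move=> u v hu hv; rewrite /= mulrDr; apply: FD.
    - by move=> a u hu; rewrite /= mulrCA; apply: FM.
  move=> _ [i _ <-] /=; rewrite /Q (bigD1 i) //= mulrAC; apply: idealMr Fi _.
  by case: (qP i).
exists Q.
  by rewrite rmorph_prod; apply/prodf_neq0 => i _; case: (qP i).
have VP (y : 'rV_N) p : V y -> Q.@[y 0] != 0 -> P p -> p.@[y 0] = 0.
  move=> Vy Qy /QP/idealg_range[a e].
  have /eqP : (Q * p).@[y 0] = 0.
    rewrite e raddf_sum /= big1 // => i _; by rewrite mevalM (Vy _ (If i)) mulr0.
  by rewrite mevalM mulf_eq0 (negPf Qy) => /eqP.
move=> a b ab.
(* The factor Q allows the hypothesis on a b, which holds only where Q is nonzero, to be used at all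
   zeros of P. It drops out again because Q(x) is nonzero. *)
have [k' hk] : exists k, P ((Q * (a * b)) ^+ k).
  apply: nullstellensatz => // y Py.
  have Vy : V (\row_i y i) by move=> p /IP/Py; rewrite meval_row.
  rewrite -meval_row mevalM.
  have [->|Qy] := eqVneq Q.@[(\row_i y i) 0] 0; first by rewrite mul0r.
  by rewrite mevalM ab // mulr0.
have Pexp p e : P (p ^+ e) -> P p.
  elim: e => [|e IH]; last by rewrite exprS => /Pprime[].
  by rewrite expr0 => /PM -/(_ p); rewrite mulr1.
case: (Pprime _ _ (Pexp _ _ hk)) => [/Px/eqP|/Pprime[Pa|Pb]].
- have Qx : Q.@[x 0] != 0 by rewrite rmorph_prod; apply/prodf_neq0 => i _; case: (qP i).
  by rewrite (negPf Qx).
- by left=> y Vy Qy; apply: VP Pa.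
- by right=> y Vy Qy; apply: VP Pb.
Qed.

(** * Zariski topology, charts and products *)

(** A filter P that contains the subbasic sets around q contains every open set around q. *)
Lemma subbase_ind (T : Type) (D : set (set T)) (q : T) (P : set T -> Prop) :
  P setT -> (forall A B, P A -> P B -> P (A `&` B)) ->
  (forall A B : set T, A `<=` B -> P A -> P B) ->
  (forall A, D A -> A q -> P A) ->
  forall W, (exists2 D', D' `<=` finI_from D id & \bigcup_(i in D') i = W) ->
  W q -> P W.
Proof.
move=> PT PI PS PD W [D' D'f <-] [A D'A Aq].
apply: (PS A); first by move=> r Ar; exists A.
have [E ED EA] := D'f _ D'A; rewrite -{}EA /= in Aq *.
have {}ED B : B \in E -> D B by move=> /ED; rewrite inE.
suff h (s : seq (set T)) : (forall B, B \in s -> D B /\ B q) -> P (\bigcap_(i in [set` s]) i).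
  by apply: h => B BE; split; [exact: ED|exact: Aq].
elim: s => [|B s IH] sE.
  by apply: PS PT => r _ B /=.
apply: (PS (B `&` \bigcap_(i in [set` s]) i)).
  move=> r [Br sr] C /=; rewrite inE => /orP[/eqP -> //|]; exact: sr.
apply: PI.
  by have [] := sE B (mem_head _ _); exact: PD.
by apply: IH => C Cs; apply: sE; rewrite inE Cs orbT.
Qed.

Section Affspace.
Variable K : closedFieldType.

Lemma nbhs_affspace N (x : affspace K N) (W : set (affspace K N)) :
  nbhs x W <-> exists2 p : {mpoly K[N]}, p.@[(x : 'rV_N) 0] != 0 &
    forall y : affspace K N, p.@[(y : 'rV_N) 0] != 0 -> W y.
Proof.
split.
  rewrite nbhsE => -[O [oO Ox] OW].
  suff [p px pO] : exists2 p : {mpoly K[N]}, p.@[(x : 'rV_N) 0] != 0 &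
      forall y : affspace K N, p.@[(y : 'rV_N) 0] != 0 -> O y.
    by exists p => // y /pO/OW.
  move: O oO Ox {OW}; apply: subbase_ind.
  - by exists 1; rewrite ?meval1 ?oner_neq0.
  - move=> A B [p px pA] [q qx qB]; exists (p * q); first by rewrite mevalM mulf_neq0.
    by move=> y; rewrite mevalM mulf_eq0 negb_or => /andP[/pA ? /qB].
  - by move=> A B AB [p px pA]; exists p => // y /pA/AB.
  - by move=> _ [p ->] /= px; exists p.
move=> [p px pW]; rewrite nbhsE; exists [set y : 'rV_N | p.@[y 0] != 0] => //.
split=> //.
exists [set [set y : 'rV_N | p.@[y 0] != 0]]; last by rewrite bigcup_set1.
by move=> _ ->; apply: finI_from1; exists p.
Qed.

Lemma open_affspace N (W : set (affspace K N)) :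
  (forall x, W x -> exists2 p : {mpoly K[N]}, p.@[(x : 'rV_N) 0] != 0 &
    forall y : affspace K N, p.@[(y : 'rV_N) 0] != 0 -> W y) -> open W.
Proof.
move=> h; rewrite openE => x Wx; rewrite /interior.
by apply/nbhs_affspace; exact: h.
Qed.

Lemma principal_open N (p : {mpoly K[N]}) :
  open [set y : affspace K N | p.@[(y : 'rV_N) 0] != 0].
Proof. by apply: open_affspace => x px; exists p. Qed.

Lemma closed_affspace N (B : set (affspace K N)) (y : affspace K N) : closed B ->
  (forall p, vanishing_ideal B p -> p.@[(y : 'rV_N) 0] = 0) -> B y.
Proof.
move=> Bc By; apply: contrapT => nBy.
have : nbhs y (~` B) by apply: open_nbhs_nbhs; split=> //; exact: closed_openC.
move=> /nbhs_affspace[p py pB]; move/eqP: py; apply; apply: By => x Bx.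
by apply/eqP; apply: contrapT => /negP/pB.
Qed.

(** Multiplying numerator and denominator by a polynomial that cuts out the neighbourhood makes the
    fraction valid wherever its denominator is nonzero. *)
Lemma regular_affspace N (x : affspace K N) (h : affspace K N -> K) :
  regular_at x h <-> exists p q : {mpoly K[N]}, q.@[(x : 'rV_N) 0] != 0 /\
    forall y : affspace K N, q.@[(y : 'rV_N) 0] != 0 ->
      h y = p.@[(y : 'rV_N) 0] / q.@[(y : 'rV_N) 0].
Proof.
split=> [[p [q [qx /nbhs_affspace[r rx rE]]]]|[p [q [qx qE]]]]; last first.
  by exists p, q; split=> //; apply/nbhs_affspace; exists q.
exists (p * r), (q * r); rewrite mevalM mulf_neq0 //; split=> // y.
rewrite !mevalM mulf_eq0 negb_or => /andP[qy ry].
by rewrite rE // -mulf_div divff // mulr1.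
Qed.

Lemma regular_poly N (x : affspace K N) (p : {mpoly K[N]}) :
  regular_at x (fun y : affspace K N => p.@[(y : 'rV_N) 0]).
Proof.
apply/regular_affspace; exists p, 1; rewrite meval1 oner_neq0; split=> // y _.
by rewrite meval1 divr1.
Qed.

Lemma meval_rational M N (rho : affspace K N -> affspace K M) (q : {mpoly K[N]})
    (p : 'I_M -> {mpoly K[N]}) (P : {mpoly K[M]}) :
  (forall y : affspace K N, q.@[(y : 'rV_N) 0] != 0 -> forall i,
     (rho y : 'rV_M) 0 i = (p i).@[(y : 'rV_N) 0] / q.@[(y : 'rV_N) 0]) ->
  exists (p' : {mpoly K[N]}) e, forall y : affspace K N, q.@[(y : 'rV_N) 0] != 0 ->
    P.@[(rho y : 'rV_M) 0] = p'.@[(y : 'rV_N) 0] / q.@[(y : 'rV_N) 0] ^+ e.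
Proof.
move=> rhoE; elim/mpoly_ring_ind: P => [c|i|P1 P2 [p1 [e1 h1]] [p2 [e2 h2]]|
    P1 P2 [p1 [e1 h1]] [p2 [e2 h2]]].
- by exists c%:MP, 0%N => y qy; rewrite !mevalC expr0 divr1.
- by exists (p i), 1%N => y qy; rewrite mevalXU rhoE // expr1.
- exists (p1 * q ^+ e2 + p2 * q ^+ e1), (e1 + e2)%N => y qy.
  rewrite mevalD h1 // h2 // exprD mevalD !mevalM !rmorphXn /=.
  by rewrite addf_div ?expf_neq0.
- exists (p1 * p2), (e1 + e2)%N => y qy.
  by rewrite mevalM h1 // h2 // exprD mevalM mulf_div.
Qed.

Section Rational.
Variables (M N : nat) (rho : affspace K N -> affspace K M) (x : affspace K N).
Variables (q : {mpoly K[N]}) (p : 'I_M -> {mpoly K[N]}).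
Hypothesis qx : q.@[(x : 'rV_N) 0] != 0.
Hypothesis rhoE : forall y : affspace K N, q.@[(y : 'rV_N) 0] != 0 -> forall i,
     (rho y : 'rV_M) 0 i = (p i).@[(y : 'rV_N) 0] / q.@[(y : 'rV_N) 0].

Lemma rational_nbhs W : nbhs (rho x) W -> nbhs x (rho @^-1` W).
Proof.
move=> /nbhs_affspace[P Px PW]; have [p' [e h]] := meval_rational P rhoE.
apply/nbhs_affspace; exists (p' * q).
  rewrite mevalM mulf_neq0 //; apply: contra_neq Px => p'0.
  by rewrite h // p'0 mul0r.
move=> y; rewrite mevalM mulf_eq0 negb_or => /andP[p'y qy]; apply: PW.
by rewrite h // mulf_neq0 // invr_neq0 // expf_neq0.
Qed.

Lemma rational_regular h : regular_at (rho x) h -> regular_at x (h \o rho).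
Proof.
move=> /regular_affspace[P [Q [Qx hE]]].
have [P' [e Pe]] := meval_rational P rhoE; have [Q' [e' Qe]] := meval_rational Q rhoE.
apply/regular_affspace; exists (P' * q ^+ e' * q), (Q' * q ^+ e * q).
have Q0 (y : affspace K N) : q.@[(y : 'rV_N) 0] != 0 ->
    (Q.@[(rho y : 'rV_M) 0] != 0) = (Q'.@[(y : 'rV_N) 0] != 0).
  by move=> qy; rewrite Qe // mulf_eq0 invr_eq0 expf_eq0 (negPf qy) andbF orbF.
split.
  by rewrite !mevalM rmorphXn /= !mulf_neq0 // ?expf_neq0 // -Q0.
move=> y; rewrite !mevalM !rmorphXn /= !mulf_eq0 expf_eq0 !negb_or.
move=> /andP[/andP[Q'y _] qy]; rewrite hE ?Q0 // Pe // Qe //.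
have qe := expf_neq0 e qy; have qe' := expf_neq0 e' qy.
field; by rewrite qy Q'y !expf_neq0.
Qed.
End Rational.
End Affspace.

Section Chart.
Variables (K : closedFieldType) (X : funSpaceType K) (U : set X) (N : nat).
Variable phi : X -> affspace K N.
Hypothesis ch : affine_chart U phi.

Local Notation ev p x := (p.@[(phi x : 'rV_N) 0]).

Lemma chart_nbhs x W : U x -> nbhs x W <->
  exists2 p : {mpoly K[N]}, ev p x != 0 & forall y, U y -> ev p y != 0 -> W y.
Proof.
move=> Ux; split.
  rewrite nbhsE => -[O [oO Ox] OW].
  have oUO : open (U `&` O) by apply: openI => //; exact: chart_open ch.
  have [O' oO' e] := (chart_topology ch (@subIsetl _ U O)).1 oUO.
  have O'x : O' (phi x).
    by have : (U `&` O) x by []; rewrite e => -[].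
  have /nbhs_affspace[p px pO] : nbhs (phi x) O' by apply: open_nbhs_nbhs.
  exists p => // y Uy /pO O'y; apply: OW.
  by have : (U `&` phi @^-1` O') y by []; rewrite -e => -[].
move=> [p px pW]; rewrite nbhsE.
exists (U `&` phi @^-1` [set y : affspace K N | p.@[(y : 'rV_N) 0] != 0]); last first.
  by move=> y [Uy /= py]; apply: pW.
split=> //; apply/(chart_topology ch (@subIsetl _ _ _)).
by eexists; first exact: principal_open.
Qed.

Lemma chart_regularP x f : U x -> regular_at x f <->
  exists p q : {mpoly K[N]}, ev q x != 0 /\
    forall y, U y -> ev q y != 0 -> f y = ev p y / ev q y.
Proof.
move=> Ux; rewrite (chart_regular ch) //; split.
  move=> [h /regular_affspace[p [q [qx hE]]] /(chart_nbhs _ Ux)[r rx rE]].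
  exists (p * r), (q * r); rewrite mevalM mulf_neq0 //; split=> // y Uy.
  rewrite !mevalM mulf_eq0 negb_or => /andP[qy ry].
  by rewrite rE // hE // -mulf_div divff // mulr1.
move=> [p [q [qx fE]]].
exists (fun y : affspace K N => p.@[(y : 'rV_N) 0] / q.@[(y : 'rV_N) 0]).
  by apply/regular_affspace; exists p, q.
by apply/(chart_nbhs _ Ux); exists q.
Qed.

Lemma chart_regular_poly (p : {mpoly K[N]}) : regular_on U (fun x => ev p x).
Proof.
move=> x Ux; apply/(chart_regularP _ Ux); exists p, 1.
by rewrite meval1 oner_neq0; split=> // y _ _; rewrite meval1 divr1.
Qed.

Lemma chart_regular_common x k (a : 'I_k -> X -> K) : U x ->
  (forall i, regular_at x (a i)) ->
  exists (p : 'I_k -> {mpoly K[N]}) (q : {mpoly K[N]}), ev q x != 0 /\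
    forall y, U y -> ev q y != 0 -> forall i, a i y = ev (p i) y / ev q y.
Proof.
move=> Ux areg.
have ex i : exists pq : {mpoly K[N]} * {mpoly K[N]}, ev pq.2 x != 0 /\
    forall y, U y -> ev pq.2 y != 0 -> a i y = ev pq.1 y / ev pq.2 y.
  by have /(chart_regularP _ Ux)[p [q h]] := areg i; exists (p, q).
have [pq pqP] := choice ex.
exists (fun i => (pq i).1 * \prod_(j < k | j != i) (pq j).2), (\prod_j (pq j).2); split.
  by rewrite rmorph_prod; apply/prodf_neq0 => i _; case: (pqP i).
move=> y Uy; rewrite rmorph_prod => /prodf_neq0 qy i.
have [_ ->] := pqP i; rewrite ?qy //.
rewrite mevalM rmorph_prod [X in _ = _ / X](bigD1 i) //= -mulf_div divff ?mulr1 //.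
by apply/prodf_neq0 => j _; exact: qy.
Qed.

Lemma chart_closed_mem (y : affspace K N) :
  (forall p, vanishing_ideal (phi @` U) p -> p.@[(y : 'rV_N) 0] = 0) ->
  exists2 x, U x & phi x = y.
Proof. by move=> h; exact: (closed_affspace (chart_closed ch) h). Qed.

End Chart.

Section Products.
Variables (K : closedFieldType).

Lemma meval_polyl M N (p : {mpoly K[M]}) (a : 'rV[K]_M) (b : 'rV[K]_N) :
  (polyl N p).@[row_mx a b 0] = p.@[a 0].
Proof.
rewrite /polyl comp_mpoly_meval; apply: meval_eq => i.
by rewrite tnth_mktuple mevalXU row_mxEl.
Qed.

Lemma meval_polyr M N (p : {mpoly K[N]}) (a : 'rV[K]_M) (b : 'rV[K]_N) :
  (polyr M p).@[row_mx a b 0] = p.@[b 0].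
Proof.
rewrite /polyr comp_mpoly_meval; apply: meval_eq => i.
by rewrite tnth_mktuple mevalXU row_mxEr.
Qed.

(** Brings polynomials on a product of charts into the form used by [tensor_on]. *)
Lemma mpoly_tensor M N (p : {mpoly K[M + N]}) :
  exists k (a : 'I_k -> {mpoly K[M]}) (b : 'I_k -> {mpoly K[N]}),
    p = \sum_(i < k) polyl N (a i) * polyr M (b i).
Proof.
elim/mpoly_ring_ind: p => [c|i|p q [k [a [b e]]] [l [c [d e']]]|
    p q [k [a [b e]]] [l [c [d e']]]].
- exists 1%N, (fun=> c%:MP), (fun=> 1).
  by rewrite big_ord1 /polyl /polyr comp_mpolyC comp_mpoly1 mulr1.
- exists 1%N, (fun=> if fintype.split i is inl j then 'X_j else 1),
    (fun=> if fintype.split i is inr j then 'X_j else 1).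
  rewrite big_ord1 /polyl /polyr; case: splitP => j ij.
    rewrite comp_mpoly1 mulr1 comp_mpolyXU -tnth_nth tnth_mktuple.
    by congr 'X_[U_(_)]; apply: val_inj.
  rewrite comp_mpoly1 mul1r comp_mpolyXU -tnth_nth tnth_mktuple.
  by congr 'X_[U_(_)]; apply: val_inj.
- exists (k + l)%N, (fun i => match fintype.split i with inl i => a i | inr i => c i end),
    (fun i => match fintype.split i with inl i => b i | inr i => d i end).
  rewrite big_split_ord /= e e'; congr (_ + _); apply: eq_bigr => i _.
  + by rewrite -/(unsplit (inl i)) unsplitK.
  + by rewrite -/(unsplit (inr i)) unsplitK.
- pose u := @enum_val {: 'I_k * 'I_l} predT.
  exists #|{: 'I_k * 'I_l}|, (fun i => a (u i).1 * c (u i).2),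
    (fun i => b (u i).1 * d (u i).2).
  rewrite e e' mulr_suml; under eq_bigr do rewrite mulr_sumr.
  rewrite pair_big /= (reindex u) /=; last exact: onW_bij (enum_val_bij _).
  by apply: eq_bigr => i _; rewrite /polyl /polyr !rmorphM /=; ring.
Qed.

End Products.

Section Zprod.
Variables (K : closedFieldType) (X Y : funSpaceType K).

Lemma zprod_subbasic_open (W : set (zprod X Y)) :
  (exists (U : set X) (V : set Y) (h : zprod X Y -> K),
     [/\ open U, open V, tensor_on U V h & W = [set q | (U `*` V) q /\ h q != 0]]) ->
  open W.
Proof.
move=> hW; exists [set W]; last by rewrite bigcup_set1.
by move=> _ ->; apply: finI_from1.
Qed.

Variables (U : set X) (M : nat) (phi : X -> affspace K M).
Variables (V : set Y) (N : nat) (psi : Y -> affspace K N).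
Hypotheses (chU : affine_chart U phi) (chV : affine_chart V psi).

Definition chart_prod (q : zprod X Y) : 'rV[K]_(M + N) :=
  row_mx (phi q.1 : 'rV_M) (psi q.2 : 'rV_N).

Lemma zprod_principal_open (p : {mpoly K[M + N]}) :
  open [set q : zprod X Y | (U `*` V) q /\ p.@[chart_prod q 0] != 0].
Proof.
apply: zprod_subbasic_open; have [k [a [b ->]]] := mpoly_tensor p.
exists U, V, (fun q =>
  \sum_(i < k) (a i).@[(phi q.1 : 'rV_M) 0] * (b i).@[(psi q.2 : 'rV_N) 0]).
split; [exact: chart_open chU|exact: chart_open chV| |].
  exists k, (fun i x => (a i).@[(phi x : 'rV_M) 0]), (fun i y => (b i).@[(psi y : 'rV_N) 0]).
  by split=> // i; exact: chart_regular_poly.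
apply/seteqP; split=> q [UVq pq]; split=> //; move: pq;
  by rewrite raddf_sum /=; congr (_ != 0); apply: eq_bigr => i _;
     rewrite mevalM meval_polyl meval_polyr.
Qed.

(** With [zprod_principal_open] this shows that U x V carries the Zariski topology of the embedding
    [chart_prod]. The regular functions in a subbasic set have a common denominator near q on each
    factor, and clearing both leaves a polynomial. *)
Lemma zprod_open_principal (W : set (zprod X Y)) q : open W -> (U `*` V) q -> W q ->
  exists2 p : {mpoly K[M + N]}, p.@[chart_prod q 0] != 0 &
    forall r, (U `*` V) r -> p.@[chart_prod r 0] != 0 -> W r.
Proof.
move=> oW [Uq Vq] Wq; move: W oW Wq; apply: subbase_ind.
- by exists 1; rewrite ?meval1 ?oner_neq0.
- move=> A B [p px pA] [p' p'x p'B]; exists (p * p'); first by rewrite mevalM mulf_neq0.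
  by move=> r hr; rewrite mevalM mulf_eq0 negb_or => /andP[/pA + /p'B]; split; auto.
- by move=> A B AB [p px pA]; exists p => // r hr /pA h; apply: AB; apply: h.
move=> _ [U' [V' [h [oU' oV' [k [a [b [areg breg hE]]]] ->]]]] [[U'q V'q]].
have /(chart_nbhs chU _ Uq)[p px pU'] : nbhs q.1 U' by apply: open_nbhs_nbhs.
have /(chart_nbhs chV _ Vq)[p' p'x p'V'] : nbhs q.2 V' by apply: open_nbhs_nbhs.
have [c [d [dx aE]]] := chart_regular_common chU Uq (fun i => areg i _ U'q).
have [c' [d' [d'x bE]]] := chart_regular_common chV Vq (fun i => breg i _ V'q).
pose s := \sum_i polyl N (c i) * polyr M (c' i).
have sE r : (U `*` V) r -> d.@[(phi r.1 : 'rV_M) 0] != 0 ->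
    d'.@[(psi r.2 : 'rV_N) 0] != 0 ->
    h r = s.@[chart_prod r 0] / (d.@[(phi r.1 : 'rV_M) 0] * d'.@[(psi r.2 : 'rV_N) 0]).
  move=> [Ur Vr] dr d'r; rewrite hE raddf_sum mulr_suml; apply: eq_bigr => i _ /=.
  by rewrite aE // bE // mevalM meval_polyl meval_polyr mulf_div.
rewrite sE // => /= sq.
exists (polyl N (p * d) * polyr M (p' * d') * s).
  rewrite !mevalM meval_polyl meval_polyr !mevalM !mulf_neq0 //.
  by apply: contra_neq sq => ->; rewrite mul0r.
move=> r [Ur Vr]; rewrite !mevalM meval_polyl meval_polyr !mevalM !mulf_eq0 !negb_or.
move=> /andP[/andP[/andP[pr dr] /andP[p'r d'r]] sr]; split.
  by split; [apply: pU'|apply: p'V'].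
by rewrite sE // mulf_neq0 // invr_neq0 // mulf_neq0.
Qed.

End Zprod.

(** The zeros of the ideal in [fibre_product_smooth_at] are exactly the images of the points of the
    fibre product over U x V, so irreducibility of the zero set near the point carries over. *)
Lemma fibre_product_locally_irreducible (K : closedFieldType) (X Y : funSpaceType K) n
    (f : X -> affspace K n) (g : Y -> affspace K n) (q : fibre_product f g) :
  ~ countable [set: K] -> fibre_product_smooth_at f g (set_val q) ->
  exists O : set (fibre_product f g), [/\ open O, O q & irreducible O].
Proof.
move=> unc [U [M [phi [F [V [N [psi [G [[chU chV UVq] fF gG sm]]]]]]]]].
have [p px pirr] := smooth_at_irreducible unc sm.
pose S := fibre_product f g.
pose O0 := [set r : zprod X Y | (U `*` V) r /\ p.@[chart_prod phi psi r 0] != 0].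
exists (set_val @^-1` O0); split.
- by exists O0 => //; exact: zprod_principal_open.
- by split.
split; first by exists q; split.
move=> F' G' F'c G'c OFG; apply: contrapT => /not_orP[/existsNP[r1 /not_implyP[Or1 F'r1]]
  /existsNP[r2 /not_implyP[Or2 G'r2]]].
(* A polynomial nonzero at r that vanishes on the part of H over U x V. *)
have away (H : set S) (r : S) : closed H -> (set_val @^-1` O0) r -> ~ H r ->
    exists2 a : {mpoly K[M + N]}, a.@[chart_prod phi psi (set_val r) 0] != 0 &
      forall s : S, (U `*` V) (set_val s) ->
        a.@[chart_prod phi psi (set_val s) 0] != 0 -> ~ H s.
  move=> Hc [UVr _] nHr; have [W oW WH] := closed_openC Hc.
  have Wr : W (set_val r) by move: nHr; rewrite -[~ H r]/((~` H) r) -WH.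
  have [a ar aW] := zprod_open_principal chU chV oW UVr Wr.
  by exists a => // s hs /(aW _ hs); rewrite -[W _]/((set_val @^-1` W) s) WH.
have [a ar1 aF] := away _ _ F'c Or1 F'r1.
have [b br2 bG] := away _ _ G'c Or2 G'r2.
(* Chart images are closed, so a zero of their vanishing ideals is the image of a point. *)
have lift (y : 'rV[K]_(M + N)) : (forall p, ideal_gen
    ([set polyl N p | p in vanishing_ideal (phi @` U)] `|`
     [set polyr M p | p in vanishing_ideal (psi @` V)] `|`
     [set polyl N (F i) - polyr M (G i) | i in setT]) p -> p.@[y 0] = 0) ->
    exists2 s : S, (U `*` V) (set_val s) & chart_prod phi psi (set_val s) = y.
  move=> Iy; rewrite -[y]hsubmxK in Iy *.
  have [u Uu pu] : exists2 u, U u & phi u = lsubmx y.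
    apply: (chart_closed_mem chU) => h hv.
    rewrite -(meval_polyl h (lsubmx y) (rsubmx y)); apply: Iy.
    by apply: idealg_sub; left; left; exists h.
  have [v Vv pv] : exists2 v, V v & psi v = rsubmx y.
    apply: (chart_closed_mem chV) => h hv.
    rewrite -(meval_polyr h (lsubmx y) (rsubmx y)); apply: Iy.
    by apply: idealg_sub; left; right; exists h.
  have fg : fibre_product f g (u, v).
    apply/rowP => i; rewrite /= fF // gG //; apply/eqP; rewrite -subr_eq0; apply/eqP.
    rewrite pu pv -(meval_polyl (F i) (lsubmx y) (rsubmx y)).
    rewrite -(meval_polyr (G i) (lsubmx y) (rsubmx y)) -mevalB; apply: Iy.
    by apply: idealg_sub; right; exists i.
  by exists (SigSub (mem_set fg)); rewrite /chart_prod /= ?pu ?pv.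
have zero (s : S) : (U `*` V) (set_val s) -> forall p, ideal_gen
    ([set polyl N p | p in vanishing_ideal (phi @` U)] `|`
     [set polyr M p | p in vanishing_ideal (psi @` V)] `|`
     [set polyl N (F i) - polyr M (G i) | i in setT]) p ->
    p.@[chart_prod phi psi (set_val s) 0] = 0.
  move=> [Us Vs]; apply: idealg_min.
    exact: meval_ideal.
  move=> _ [[[h hv <-]|[h hv <-]]|[i _ <-]] /=.
  - by rewrite meval_polyl; apply: hv; exists (set_val s).1.
  - by rewrite meval_polyr; apply: hv; exists (set_val s).2.
  - rewrite mevalB meval_polyl meval_polyr -fF // -gG //.
    by have := set_valP s => /= ->; rewrite subrr.
case: (pirr a b).
- move=> y /lift[s UVs <-] ps; apply/eqP; rewrite mulf_eq0.
  case: (OFG s); first by split.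
    by move=> Fs; apply/orP; left; apply: contrapT => /negP /(aF _ UVs).
  by move=> Gs; apply/orP; right; apply: contrapT => /negP /(bG _ UVs).
- case: Or1 => UV1 p1 /(_ _ (zero _ UV1) p1) /eqP; exact/negP.
- case: Or2 => UV2 p2 /(_ _ (zero _ UV2) p2) /eqP; exact/negP.
Qed.

(** * Irreducible and connected components *)

Section Components.
Variable X : topologicalType.
Implicit Types A B O : set X.

Lemma irreducible_connected B : irreducible B -> connected B.
Proof.
move=> [_ Birr] D [d Dd] [O oO DO] [C cC DC].
have [|BC|BO] := Birr C (~` O) cC (open_closedC oO).
- move=> x Bx; case: (pselect (O x)) => [Ox|]; last by right.
  by left; have : D x by [rewrite DO]; rewrite DC => -[].
- by rewrite DC; apply/setIidPl.
- by move: (Dd); rewrite {1}DO => -[/BO].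
Qed.

Lemma irreducible_dense B O : irreducible B -> open O -> B `&` O !=set0 ->
  B `<=` closure (B `&` O).
Proof.
move=> [_ Birr] oO [x [Bx Ox]].
have [|//|BO] := Birr (closure (B `&` O)) (~` O) (@closed_closure _ _) (open_closedC oO).
  move=> y By; case: (pselect (O y)) => [Oy|]; last by right.
  by left; apply: subset_closure.
by have := BO x Bx.
Qed.

Lemma irreducible_openI B O : irreducible B -> open O -> B `&` O !=set0 ->
  irreducible (B `&` O).
Proof.
move=> Birr oO BO; split=> // F G cF cG FG.
have := irreducible_dense Birr oO BO.
have sub (H : set X) : closed H -> B `<=` H `|` ~` O -> B `&` O `<=` H.
  by move=> _ BH y [/BH[//|]].
case: Birr => _ Birr _.
case: (Birr F (G `|` ~` O)) => //.
- by apply: closedU => //; exact: open_closedC.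
- move=> y By; case: (pselect (O y)) => [Oy|]; last by right; right.
  by case: (FG y) => // ?; [left|right; left].
- by move=> BF; left=> y [/BF].
- by move=> BG; right; apply: sub.
Qed.

(** The closure in A of an irreducible open piece is irreducible. An irreducible neighbourhood of
    any of its points meets the piece and so lies in the closure, which is thus also open in A;
    being connected, open and closed, it is a connected component. *)
Lemma irreducible_components_connected A :
  (forall x, A x -> exists O, [/\ open O, O x & irreducible (A `&` O)]) ->
  irreducible_components A = connected_components A.
Proof.
move=> loc.
pose C O := A `&` closure (A `&` O).
have Cirr O : irreducible (A `&` O) -> irreducible (C O).
  move=> [[x [Ax Ox]] AOirr]; split.
    by exists x; split=> //; apply: subset_closure.
  move=> F G cF cG CFG.
  have AOC : A `&` O `<=` C O by move=> y [Ay Oy]; split=> //; apply: subset_closure.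
  case: (AOirr F G cF cG (subset_trans AOC CFG)) => h; [left|right].
    by move=> y [_ /(closure_subset h)]; rewrite -(closure_id F).1.
  by move=> y [_ /(closure_subset h)]; rewrite -(closure_id G).1.
have Cmax O D : open O -> irreducible D -> D `<=` A -> D `&` O !=set0 -> D `<=` C O.
  move=> oO Dirr DA DO y Dy; split; first exact: DA.
  have := irreducible_dense Dirr oO DO Dy.
  by apply: closure_subset => z [/DA].
have Copen O x : irreducible (A `&` O) -> open O -> C O x ->
    exists2 W, nbhs x W & A `&` W `<=` C O.
  move=> AOirr oO [Ax xcl]; have [O' [oO' O'x AO'irr]] := loc _ Ax.
  exists O'; first exact: open_nbhs_nbhs.
  have [z [[Az Oz] O'z]] := xcl O' (open_nbhs_nbhs (conj oO' O'x)).
  apply: (Cmax _ _ oO AO'irr) => [|]; first exact: subIsetl.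
  by exists z; split=> //; split.
have Ccomp O x : open O -> O x -> A x -> irreducible (A `&` O) ->
    connected_component A x = C O.
  move=> oO Ox Ax AOirr.
  have Cx : C O x by split=> //; apply: subset_closure.
  apply/seteqP; split; last first.
    apply: connected_component_max => //; first exact: subIsetl.
    exact/irreducible_connected/Cirr.
  move=> y [E [Ex EA Econn] Ey].
  have EC : E `&` C O = E.
    apply: Econn.
    - by exists x; split.
    - exists (interior (C O `|` ~` A)); first exact: open_interior.
      apply/seteqP; split=> z [Ez].
        move=> Cz; split=> //; have [W Wz AW] := Copen _ _ AOirr oO Cz.
        apply: filterS Wz => w Ww; case: (pselect (A w)) => [Aw|]; last by right.
        by left; apply: AW.
      by move=> /interior_subset[Cz|/(_ (EA _ Ez))].
    - exists (closure (A `&` O)); first exact: closed_closure.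
      apply/seteqP; split=> z [Ez]; first by case.
      by move=> Cz; split=> //; split=> //; exact: EA.
  by move: Ey; rewrite -EC => -[].
apply/seteqP; split=> B.
- move=> [BA Birr Bmax]; have [[x Bx] _] := Birr.
  have Ax := BA _ Bx; have [O [oO Ox AOirr]] := loc _ Ax.
  exists x => //; rewrite (Ccomp _ _ oO Ox Ax AOirr).
  apply: Bmax; [exact: subIsetl|exact: Cirr|].
  by apply: Cmax => //; exists x.
- move=> [x Ax <-]; have [O [oO Ox AOirr]] := loc _ Ax.
  rewrite (Ccomp _ _ oO Ox Ax AOirr); split; [exact: subIsetl|exact: Cirr|].
  move=> D DA Dirr CD; apply/seteqP; split=> //.
  apply: Cmax => //; exists x; split=> //; apply: CD; split=> //.
  exact: subset_closure.
Qed.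

End Components.

(** * Smoothness and localization of charts *)

Section SmoothAt.
Variables (K : closedFieldType) (N : nat).
Implicit Types (I : set {mpoly K[N]}) (x : 'rV[K]_N).

(** With an arbitrary finite index type, systems of equations can be assembled over sum types, and
    independence is a statement about linear relations. *)
Lemma smooth_at_intro I x (T : finType) (f : T -> {mpoly K[N]}) :
  (forall p, I p -> p.@[x 0] = 0) -> (forall t, I (f t)) ->
  (forall p, I p -> exists2 q : {mpoly K[N]}, q.@[x 0] != 0 & idealg (range f) (q * p)) ->
  (forall v : T -> K, (forall j, \sum_t v t * (mderiv j (f t)).@[x 0] = 0) ->
     forall t, v t = 0) ->
  smooth_at I x.
Proof.
move=> Ix If Iloc fli; split=> //; exists #|T|, (f \o enum_val); split.
- by move=> i; apply: If.
- move=> p /Iloc[q q0 h]; exists q => //; apply: idealgS h => _ [t _ <-].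
  by exists (enum_rank t) => //=; rewrite enum_rankK.
- apply: inj_row_free => v v0; apply/rowP => k; rewrite [RHS]mxE -[k]enum_valK.
  apply: (fli (fun t => v 0 (enum_rank t))) => j.
  move/rowP/(_ j): v0; rewrite !mxE => v0; rewrite -[RHS]v0.
  rewrite (reindex (@enum_val T predT)) /=; last exact: onW_bij (enum_val_bij _).
  by apply: eq_bigr => l _; rewrite enum_valK mxE.
Qed.

Lemma smooth_at_indep c (f : 'I_c -> {mpoly K[N]}) x (v : 'I_c -> K) :
  row_free (\matrix_(i < c, j < N) (mderiv j (f i)).@[x 0]) ->
  (forall j, \sum_i v i * (mderiv j (f i)).@[x 0] = 0) -> forall i, v i = 0.
Proof.
move=> /row_freeP[B JB] v0 i.
have : (\row_i v i) *m 1%:M = 0 :> 'rV_c.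
  rewrite -JB mulmxA.
  have -> : (\row_i v i) *m (\matrix_(i < c, j < N) (mderiv j (f i)).@[x 0]) = 0.
    apply/rowP => j; rewrite !mxE -[RHS](v0 j).
    by apply: eq_bigr => k _; rewrite !mxE.
  by rewrite mul0mx.
by rewrite mulmx1 => /rowP/(_ i); rewrite !mxE.
Qed.

End SmoothAt.

Section PolylDeriv.
Variables (K : closedFieldType) (M N : nat).

Lemma polylM (p q : {mpoly K[M]}) : polyl N (p * q) = polyl N p * polyl N q.
Proof. by rewrite /polyl rmorphM. Qed.

Lemma polylD (p q : {mpoly K[M]}) : polyl N (p + q) = polyl N p + polyl N q.
Proof. by rewrite /polyl rmorphD. Qed.

Lemma polylC (c : K) : polyl N (c%:MP : {mpoly K[M]}) = c%:MP.
Proof. by rewrite /polyl comp_mpolyC. Qed.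

Lemma polylX (i : 'I_M) : polyl N ('X_i : {mpoly K[M]}) = 'X_(lshift N i).
Proof. by rewrite /polyl comp_mpolyXU -tnth_nth tnth_mktuple. Qed.

Lemma polyrM (p q : {mpoly K[N]}) : polyr M (p * q) = polyr M p * polyr M q.
Proof. by rewrite /polyr rmorphM. Qed.

Lemma polyrD (p q : {mpoly K[N]}) : polyr M (p + q) = polyr M p + polyr M q.
Proof. by rewrite /polyr rmorphD. Qed.

Lemma polyrC (c : K) : polyr M (c%:MP : {mpoly K[N]}) = c%:MP.
Proof. by rewrite /polyr comp_mpolyC. Qed.

Lemma polyrX (i : 'I_N) : polyr M ('X_i : {mpoly K[N]}) = 'X_(rshift M i).
Proof. by rewrite /polyr comp_mpolyXU -tnth_nth tnth_mktuple. Qed.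

Lemma mderiv_polyl_lshift (p : {mpoly K[M]}) j :
  mderiv (lshift N j) (polyl N p) = polyl N (mderiv j p).
Proof.
elim/mpoly_ring_ind: p => [c|i|p q hp hq|p q hp hq].
- by rewrite polylC !mderivC -mpolyC0 polylC.
- by rewrite polylX !mderivXU (inj_eq (@lshift_inj _ _)) -!mpolyC_nat polylC.
- by rewrite polylD !mderivD hp hq polylD.
- by rewrite polylM !mderivM hp hq polylD !polylM.
Qed.

Lemma mderiv_polyl_rshift (p : {mpoly K[M]}) j :
  mderiv (rshift M j) (polyl N p) = 0.
Proof.
elim/mpoly_ring_ind: p => [c|i|p q hp hq|p q hp hq].
- by rewrite polylC mderivC.
- by rewrite polylX mderivXU eq_rlshift.
- by rewrite polylD mderivD hp hq addr0.
- by rewrite polylM mderivM hp hq mul0r mulr0 addr0.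
Qed.

Lemma mderiv_polyr_rshift (p : {mpoly K[N]}) j :
  mderiv (rshift M j) (polyr M p) = polyr M (mderiv j p).
Proof.
elim/mpoly_ring_ind: p => [c|i|p q hp hq|p q hp hq].
- by rewrite polyrC !mderivC -mpolyC0 polyrC.
- by rewrite polyrX !mderivXU (inj_eq (@rshift_inj _ _)) -!mpolyC_nat polyrC.
- by rewrite polyrD !mderivD hp hq polyrD.
- by rewrite polyrM !mderivM hp hq polyrD !polyrM.
Qed.

Lemma mderiv_polyr_lshift (p : {mpoly K[N]}) j :
  mderiv (lshift N j) (polyr M p) = 0.
Proof.
elim/mpoly_ring_ind: p => [c|i|p q hp hq|p q hp hq].
- by rewrite polyrC mderivC.
- by rewrite polyrX mderivXU eq_lrshift.
- by rewrite polyrD mderivD hp hq addr0.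
- by rewrite polyrM mderivM hp hq mul0r mulr0 addr0.
Qed.

Lemma polyl_ideal (J : set {mpoly K[M + N]}) : is_ideal J -> is_ideal (@polyl K M N @^-1` J).
Proof.
move=> [J0 JD JM]; split=> /=.
- by rewrite -mpolyC0 polylC mpolyC0.
- by move=> p q hp hq; rewrite polylD; apply: JD.
- by move=> p q hq; rewrite polylM; apply: JM.
Qed.

Lemma polyr_ideal (J : set {mpoly K[M + N]}) : is_ideal J -> is_ideal (@polyr K M N @^-1` J).
Proof.
move=> [J0 JD JM]; split=> /=.
- by rewrite -mpolyC0 polyrC mpolyC0.
- by move=> p q hp hq; rewrite polyrD; apply: JD.
- by move=> p q hq; rewrite polyrM; apply: JM.
Qed.

End PolylDeriv.

(** * Shrinking a chart to a principal open subset *)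

Section Localize.
Variables (K : closedFieldType) (Y : funSpaceType K) (V0 : set Y) (N : nat).
Variables (psi0 : Y -> affspace K N) (q : {mpoly K[N]}).
Hypothesis ch : affine_chart V0 psi0.

Let V := V0 `&` [set y | q.@[(psi0 y : 'rV_N) 0] != 0].
(** The extra coordinate 1/q, with equation [s], makes the open set where q is nonzero closed in a
    larger affine space. *)
Let rho (b : affspace K N) : affspace K (N + 1) :=
  row_mx (b : 'rV_N) (const_mx (q.@[(b : 'rV_N) 0])^-1).
Let psi := rho \o psi0.
Let s : {mpoly K[N + 1]} := 'X_(rshift N ord0) * polyl 1 q - 1.

Let rhoE (b : affspace K N) : q.@[(b : 'rV_N) 0] != 0 -> forall i,
  (rho b : 'rV_(N + 1)) 0 i =
  ((match fintype.split i with inl j => 'X_j * q | inr _ => 1 end).@[(b : 'rV_N) 0]) /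
    q.@[(b : 'rV_N) 0].
Proof.
move=> qb i; rewrite mxE; case: (fintype.split i) => j.
  by rewrite mevalM mevalXU mulfK.
by rewrite mxE meval1 mul1r.
Qed.

Let psi_s y : V y -> s.@[(psi y : 'rV_(N + 1)) 0] = 0.
Proof.
move=> [_ /= qy]; rewrite mevalB mevalM mevalXU meval1 meval_polyl.
by rewrite row_mxEr mxE mulVf ?subrr.
Qed.

Lemma localize_chart : affine_chart V psi.
Proof.
split.
- apply/(chart_topology ch (@subIsetl _ _ _)).
  by eexists; first exact: (principal_open q).
- move=> y y' /set_mem[Vy _] /set_mem[Vy' _] /eq_row_mx[+ _].
  by apply: (chart_inj ch); rewrite inE.
- rewrite -[psi @` V]setCK; apply: open_closedC; apply: open_affspace => z nz.
  (* If z lies over the old chart, [s] separates it from the image; otherwise an equation of the old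
     chart does. *)
  case: (pselect ((psi0 @` V0) (lsubmx (z : 'rV_(N + 1))))) => [[y V0y yz]|nz'].
    exists s; last first.
      by move=> z' sz' [y' Vy' yz']; move/eqP: sz'; apply; rewrite -yz'; apply: psi_s.
    apply: contra_notN nz => /eqP.
    rewrite -[in s.@[_]](hsubmxK (z : 'rV_(N + 1))) /=.
    rewrite mevalB mevalM mevalXU meval1 meval_polyl.
    rewrite row_mxEr => /eqP; rewrite subr_eq0 -yz => /eqP e1.
    have qy : q.@[(psi0 y : 'rV_N) 0] != 0.
      by apply: contra_eq_neq e1 => ->; rewrite mulr0 eq_sym oner_neq0.
    exists y => //; rewrite /psi /rho /= -[RHS]hsubmxK yz; congr row_mx.
    rewrite yz in e1 qy; apply/rowP => j; rewrite [j]ord1 mxE; apply: (mulIf qy).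
    by rewrite mulVf // e1.
  have : exists2 p, vanishing_ideal (psi0 @` V0) p & p.@[lsubmx (z : 'rV_(N + 1)) 0] != 0.
    apply: contrapT => np; apply: nz'; apply: (closed_affspace (chart_closed ch)) => p pv.
    by apply/eqP; apply: contrapT => /negP pz; apply: np; exists p.
  move=> [p pv pz]; exists (polyl 1 p).
    by rewrite -(hsubmxK (z : 'rV_(N + 1))) meval_polyl.
  move=> z' + [y' [V0y' _] yz']; rewrite -yz' /= meval_polyl.
  by move/eqP; apply; apply: pv; exists y'.
- move=> W WV; split.
    move=> oW; have [O oO e] := (chart_topology ch (subset_trans WV (@subIsetl _ _ _))).1 oW.
    exists [set z : affspace K (N + 1) | O (lsubmx (z : 'rV_(N + 1)))].
      apply: open_affspace => z Oz.
      have /nbhs_affspace[p pz pO] : nbhs (lsubmx (z : 'rV_(N + 1)) : affspace K N) O.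
        exact: open_nbhs_nbhs.
      exists (polyl 1 p); first by rewrite -(hsubmxK (z : 'rV_(N + 1))) meval_polyl.
      by move=> z'; rewrite -(hsubmxK (z' : 'rV_(N + 1))) meval_polyl => /pO; rewrite /= row_mxKl.
    apply/seteqP; split=> y.
      by move=> Wy; split; [exact: WV|move: Wy; rewrite e => -[_]; rewrite /= row_mxKl].
    by move=> [[V0y qy]]; rewrite /= row_mxKl e.
  move=> [O oO e]; rewrite openE => y Wy; have := Wy; rewrite e => -[[V0y qy] Oy].
  have := rational_nbhs qy rhoE (open_nbhs_nbhs (conj oO Oy)).
  move=> /nbhs_affspace[p py pO].
  apply/(chart_nbhs ch _ V0y); exists (p * q); first by rewrite mevalM mulf_neq0.
  by move=> y' V0y'; rewrite mevalM mulf_eq0 negb_or => /andP[/pO Oy' qy'].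
- move=> y [V0y qy] f; split.
    move=> /(chart_regularP ch _ V0y)[a [b [bx fE]]].
    exists (fun z : affspace K (N + 1) => (polyl 1 a).@[(z : 'rV_(N + 1)) 0] /
                          (polyl 1 b).@[(z : 'rV_(N + 1)) 0]).
      apply/regular_affspace; exists (polyl 1 a), (polyl 1 b); split=> //.
      by rewrite meval_polyl.
    apply/(chart_nbhs ch _ V0y); exists b => // y' V0y' by'.
    by rewrite !meval_polyl fE.
  move=> [h hreg hf]; apply/(chart_regular ch V0y); exists (h \o rho) => //.
  exact: (rational_regular qy rhoE).
Qed.

(** Modulo [s] the last variable is the inverse of q, so a power of q removes it. *)
Let clear_denominator (P : {mpoly K[N + 1]}) : exists (p : {mpoly K[N]}) e,
  idealg [set s] (polyl 1 q ^+ e * P - polyl 1 p).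
Proof.
have [s0 sD sM] := idealg_ideal [set s].
elim/mpoly_ring_ind: P => [c|i|P1 P2 [p1 [e1 h1]] [p2 [e2 h2]]|
    P1 P2 [p1 [e1 h1]] [p2 [e2 h2]]].
- by exists c%:MP, 0%N; rewrite polylC expr0 mul1r subrr.
- case: (split_ordP i) => j ->.
    by exists 'X_j, 0%N; rewrite polylX expr0 mul1r subrr.
  exists 1, 1%N; rewrite expr1 mulrC -[polyl 1 1]/(polyl 1 1%:MP) polylC [j]ord1.
  exact: idealg_sub.
- exists (q ^+ e2 * p1 + q ^+ e1 * p2), (e1 + e2)%N.
  have pX e : polyl 1 (q ^+ e) = polyl 1 q ^+ e by rewrite /polyl rmorphXn.
  rewrite polylD !polylM !pX exprD.
  have -> : polyl 1 q ^+ e1 * polyl 1 q ^+ e2 * (P1 + P2) -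
     (polyl 1 q ^+ e2 * polyl 1 p1 + polyl 1 q ^+ e1 * polyl 1 p2) =
     polyl 1 q ^+ e2 * (polyl 1 q ^+ e1 * P1 - polyl 1 p1) +
     polyl 1 q ^+ e1 * (polyl 1 q ^+ e2 * P2 - polyl 1 p2) by ring.
  by apply: sD; apply: sM.
- exists (p1 * p2), (e1 + e2)%N; rewrite polylM exprD.
  have -> : polyl 1 q ^+ e1 * polyl 1 q ^+ e2 * (P1 * P2) - polyl 1 p1 * polyl 1 p2 =
     (polyl 1 q ^+ e2 * P2) * (polyl 1 q ^+ e1 * P1 - polyl 1 p1) +
     polyl 1 p1 * (polyl 1 q ^+ e2 * P2 - polyl 1 p2) by ring.
  by apply: sD; apply: sM.
Qed.

Lemma localize_smooth y : V y ->
  smooth_at (vanishing_ideal (psi0 @` V0)) (psi0 y) ->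
  smooth_at (vanishing_ideal (psi @` V)) (psi y).
Proof.
move=> Vy [_ [c [f [If Iloc free]]]]; have [V0y qy] := Vy.
apply: (@smooth_at_intro _ _ _ _ ('I_c + unit)%type
  (fun t => match t with inl i => polyl 1 (f i) | inr _ => s end)).
- by move=> p; apply; exists y.
- case=> [i|_] _ [y' Vy' <-]; last exact: psi_s.
  by rewrite meval_polyl; apply: If; exists y' => //; case: Vy'.
- move=> P IP.
  set J := idealg _; have Ji : is_ideal J by exact: idealg_ideal.
  have [J0 JD JM] := Ji.
  have sJ : idealg [set s] `<=` J.
    by apply: idealgS => _ ->; exists (inr tt).
  have [p [e hp]] := clear_denominator P.
  (* The product q p vanishes on all of V0: p vanishes on V because P does, and q vanishes outside
     V. *)
  have [u u0 uq] : exists2 u, u.@[(psi0 y : 'rV_N) 0] != 0 &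
      ideal_gen (range f) (u * (q * p)).
    apply: Iloc => _ [y' V0y' <-]; rewrite mevalM.
    have [->|qy'] := eqVneq q.@[(psi0 y' : 'rV_N) 0] 0; first by rewrite mul0r.
    have Vy' : V y' by [].
    suff : (polyl 1 q ^+ e * P - polyl 1 p).@[(psi y' : 'rV_(N + 1)) 0] = 0.
      rewrite mevalB mevalM IP; last by exists y'.
      by rewrite mulr0 sub0r meval_polyl => /eqP; rewrite oppr_eq0 => /eqP ->; rewrite mulr0.
    move: hp; apply: (idealg_min (J := [set p | p.@[(psi y' : 'rV_(N + 1)) 0] = 0])).
      exact: meval_ideal.
    by move=> _ ->; exact: psi_s.
  exists (polyl 1 (u * q) * polyl 1 q ^+ e).
    by rewrite !mevalM rmorphXn /= !meval_polyl mevalM !mulf_neq0 // expf_neq0.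
  have -> : polyl 1 (u * q) * polyl 1 q ^+ e * P =
     polyl 1 (u * q) * (polyl 1 q ^+ e * P - polyl 1 p) + polyl 1 (u * (q * p)).
    by rewrite !polylM; ring.
  apply: JD; first exact/JM/sJ.
  move: uq; apply: (idealg_min (J := @polyl K N 1 @^-1` J)); first exact: polyl_ideal.
  by move=> _ [i _ <-]; apply: idealg_sub; exists (inl i).
- move=> v v0.
  have vr : v (inr tt) = 0.
    have := v0 (rshift N ord0); rewrite big_sumType /= big1 ?add0r; last first.
      by move=> i _; rewrite mderiv_polyl_rshift meval0 mulr0.
    rewrite (bigD1 tt) //= big1 ?addr0 => [|[]//].
    rewrite mderivB mderivM mderivXU eqxx mul1r mderiv_polyl_rshift mulr0 addr0.
    rewrite -mpolyC1 mderivC subr0 meval_polyl => /eqP.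
    by rewrite mulf_eq0 (negPf qy) orbF => /eqP.
  case=> [i|[]//]; apply: (smooth_at_indep (v := v \o inl)) free _ i => j.
  have := v0 (lshift 1 j); rewrite big_sumType /= [X in _ + X]big1 ?addr0.
    by under eq_bigr do rewrite mderiv_polyl_lshift meval_polyl.
  by case=> _; rewrite vr mul0r.
Qed.

End Localize.

(** * Cyclic covers of graphs *)

(** X^m - c is separable: its derivative m X^(m-1) vanishes at no root, as m and c are nonzero. *)
Lemma pure_roots (K : closedFieldType) m (c : K) : (0 < m)%N -> (m%:R : K) != 0 ->
  c != 0 -> exists2 rs : seq K, uniq rs & size rs = m /\ forall a, a \in rs -> a ^+ m = c.
Proof.
move=> m0 mK c0; pose p : {poly K} := 'X^m - c%:P.
have pm : p \is monic by rewrite monicXnsubC.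
have [rs prs] := closed_field_poly_normal p; rewrite (monicP pm) scale1r in prs.
have rootE a : root p a = (a ^+ m == c).
  by rewrite rootE /p hornerD hornerN hornerXn hornerC subr_eq0.
exists rs.
  rewrite -separable_prod_XsubC -prs unlock; apply: Pdiv.ClosedField.root_coprimep => a.
  rewrite rootE => /eqP am; rewrite /p derivB derivXn derivC subr0 hornerMn hornerXn.
  rewrite -mulr_natr mulf_neq0 // expf_eq0 negb_and; apply/orP; right.
  by apply: contra_neq c0 => a0; rewrite -am a0 expr0n eqn0Ngt m0.
split; first by have := size_prod_XsubC rs id; rewrite -prs size_XnsubC // => -[].
by move=> a ars; apply/eqP; rewrite -rootE prs root_prod_XsubC.
Qed.

Lemma mpoly_zero (K : closedFieldType) N (p : {mpoly K[N]}) :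
  ~ countable [set: K] -> (forall y, p.@[y] = 0) -> p = 0.
Proof.
move=> unc pv; have Zi : is_ideal ([set 0] : set {mpoly K[N]}).
  by split=> // [_ _ -> ->|a _ ->]; rewrite /= ?addr0 ?mulr0.
have [k /= /eqP] := nullstellensatz unc Zi (fun y _ => pv y).
by rewrite expf_eq0 => /andP[_ /eqP].
Qed.

Section RootCover.
Variables (K : closedFieldType) (N m : nat) (k l : 'I_N) (E L : {mpoly K[N]}).
Hypothesis unc : ~ countable [set: K].
Hypotheses (m0 : (0 < m)%N) (mK : (m%:R : K) != 0) (kl : k != l).
Hypothesis E_dep : forall v v' : 'I_N -> K,
  (forall i, i != k -> i != l -> v i = v' i) -> E.@[v] = E.@[v'].
Hypothesis L_dep : forall v v' : 'I_N -> K,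
  (forall i, i != k -> i != l -> v i = v' i) -> L.@[v] = L.@[v'].
Hypothesis L0 : L != 0.

Definition root_cover : set (affspace K N) :=
  [set w | (w : 'rV_N) 0 k = E.@[(w : 'rV_N) 0] /\
           (w : 'rV_N) 0 l ^+ m = L.@[(w : 'rV_N) 0]].

Definition root_cover_eqn (b : bool) : {mpoly K[N]} :=
  if b then 'X_k - E else 'X_l ^+ m - L.

Lemma root_cover_eqn_vanish b : vanishing_ideal root_cover (root_cover_eqn b).
Proof.
move=> w [wk wl]; case: b; rewrite /root_cover_eqn mevalB ?rmorphXn /= mevalXU.
  by rewrite wk subrr.
by rewrite wl subrr.
Qed.

Let g : {poly {mpoly K[N]}} := 'X^m - L%:P.

(** Replaces X_k by E and X_l by the variable of a univariate ring, where one can divide by the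
    monic polynomial [g]. *)
Definition root_cover_div : {mpoly K[N]} -> {poly {mpoly K[N]}} := locked
  (mmap (polyC \o @mpolyC N K)
    (fun i => if i == k then E%:P else if i == l then 'X else ('X_i)%:P)).

Let div := root_cover_div.

Let divC c : div c%:MP = c%:MP%:P.
Proof. by rewrite /div /root_cover_div -lock mmapC. Qed.
Let divX i : div 'X_i = if i == k then E%:P else if i == l then 'X else ('X_i)%:P.
Proof. by rewrite /div /root_cover_div -lock mmapX mmap1U. Qed.
Let divD p q : div (p + q) = div p + div q.
Proof. by rewrite /div /root_cover_div -lock mmapD. Qed.
Let divM p q : div (p * q) = div p * div q.
Proof. by rewrite /div /root_cover_div -lock; exact: rmorphM. Qed.

Let div_horner p : idealg (range root_cover_eqn) (p - (div p).['X_l]).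
Proof.
have [J0 JD JM] := idealg_ideal (range root_cover_eqn).
elim/mpoly_ring_ind: p => [c|i|p q hp hq|p q hp hq].
- by rewrite divC hornerC subrr.
- rewrite divX; have [->|ik] := eqVneq i k.
    by rewrite hornerC; apply: idealg_sub; exists true.
  by have [->|il] := eqVneq i l; rewrite ?hornerX ?hornerC subrr.
- by rewrite divD hornerD opprD addrACA; apply: JD.
- rewrite divM hornerM.
  have -> : p * q - (div p).['X_l] * (div q).['X_l] =
     q * (p - (div p).['X_l]) + (div p).['X_l] * (q - (div q).['X_l]) by ring.
  by apply: JD; apply: JM.
Qed.

Let point (w : 'I_N -> K) (a : K) (i : 'I_N) : K :=
  if i == k then E.@[w] else if i == l then a else w i.

Let div_point w a p : (map_poly (meval w) (div p)).[a] = p.@[point w a].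
Proof.
elim/mpoly_ring_ind: p => [c|i|p q hp hq|p q hp hq].
- by rewrite divC map_polyC hornerC /= !mevalC.
- rewrite divX mevalXU /point; case: eqP => _; first by rewrite map_polyC hornerC.
  case: eqP => _; first by rewrite map_polyX hornerX.
  by rewrite map_polyC hornerC /= mevalXU.
- by rewrite divD rmorphD hornerD hp hq mevalD.
- by rewrite divM rmorphM hornerM hp hq mevalM.
Qed.

(* Modulo the two equations p is of degree < m in X_l; it vanishes at the m
   points of the cover over each point where L is nonzero. *)
Lemma vanishing_root_cover : vanishing_ideal root_cover `<=`
  idealg (range root_cover_eqn).
Proof.
move=> p pv; have gm : g \is monic by rewrite monicXnsubC.
have e := Pdiv.RingMonic.rdivp_eq gm (div p).
have sr := Pdiv.CommonRing.ltn_rmodpN0 (div p) (monic_neq0 gm).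
move: e sr; set q := Pdiv.CommonRing.rdivp _ _; set r := Pdiv.CommonRing.rmodp _ _ => e sr.
have r0 : r = 0.
  apply/polyP => i; rewrite coef0.
  (* The product vanishes at every point: where L is nonzero, its m distinct m-th roots are roots of
     the specialized remainder, which has degree less than m. *)
  have : r`_i * L = 0.
    apply: mpoly_zero => // w; rewrite mevalM.
    have [->|Lw] := eqVneq L.@[w] 0; first by rewrite mulr0.
    suff rw : map_poly (meval w) r = 0 by rewrite -coef_map rw coef0 mul0r.
    have [rs urs [srs rsm]] := pure_roots m0 mK Lw.
    apply/eqP; apply: contraT => rw0.
    suff /(max_poly_roots rw0)/(_ urs) : all (root (map_poly (meval w) r)) rs.
      rewrite srs ltnNge => /negP; case.
      apply: leq_trans (size_poly _ _) _.
      by move: sr; rewrite size_XnsubC.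
    apply/allP => a /rsm am; apply/rootP.
    have : (map_poly (meval w) (div p)).[a] = 0.
      rewrite div_point -meval_row; apply: pv.
      rewrite /root_cover /= !meval_row !mxE /point eqxx eq_sym (negPf kl) eqxx.
      have dep i' : i' != k -> i' != l -> point w a i' = w i'.
        by rewrite /point => /negPf -> /negPf ->.
      by rewrite am (E_dep dep) (L_dep dep).
    rewrite e rmorphD rmorphM hornerD hornerM /g rmorphB /= map_polyXn map_polyC.
    by rewrite hornerD hornerN hornerXn hornerC am subrr mulr0 add0r.
  by move/eqP; rewrite mulf_eq0 (negPf L0) orbF => /eqP.
have [J0 JD JM] := idealg_ideal (range root_cover_eqn).
rewrite -[p](subrK (div p).['X_l]); apply: JD; first exact: div_horner.
rewrite e r0 addr0 hornerM; apply: JM.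
rewrite /g hornerD hornerN hornerXn hornerC.
by apply: idealg_sub; exists false.
Qed.

End RootCover.

(** The components of g are fractions near y with a common denominator q. Shrinking to the set where
    q is nonzero, with 1/q as a coordinate, makes them polynomials, as [fibre_product_smooth_at]
    requires. *)
Lemma smooth_poly_chart (K : closedFieldType) (Y : funSpaceType K) n
    (g : Y -> affspace K n) (y : Y) : smooth_variety Y -> morphism g ->
  exists (V : set Y) N (psi : Y -> affspace K N) (G : 'I_n -> {mpoly K[N]}),
  [/\ affine_chart V psi, V y,
      forall y, V y -> forall i, (g y : 'rV_n) 0 i = (G i).@[(psi y : 'rV_N) 0] &
      smooth_at (vanishing_ideal (psi @` V)) (psi y)].
Proof.
move=> sY [_ gm]; have [V0 [N [psi0 [ch V0y sm]]]] := sY y.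
have [|p [q [qy gE]]] := @chart_regular_common _ _ _ _ _ ch y n
  (fun i => (fun z : affspace K n => ('X_i : {mpoly K[n]}).@[(z : 'rV_n) 0]) \o g) V0y.
  by move=> i; apply: gm; exact: regular_poly.
do 3!eexists; exists (fun i => polyl 1 (p i) * 'X_(rshift N ord0)); split.
- exact: (localize_chart q ch).
- by split.
- move=> y' [V0y' qy'] i; have := gE _ V0y' qy' i; rewrite /= mevalXU => ->.
  by rewrite mevalM meval_polyl mevalXU row_mxEr mxE.
- exact: localize_smooth.
Qed.

Section RootCoverSmooth.
Variables (K : closedFieldType) (n m : nat) (k0 : 'I_n) (E L : {mpoly K[n + 2]}).
Let k : 'I_(n + 2) := lshift 2 k0.
Let t : 'I_(n + 2) := rshift n ord0.
Let l : 'I_(n + 2) := rshift n ord_max.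
Hypothesis unc : ~ countable [set: K].
Hypotheses (m0 : (0 < m)%N) (mK : (m%:R : K) != 0).
Hypothesis E_dep : forall v v' : 'I_(n + 2) -> K,
  (forall i, i != k -> i != l -> v i = v' i) -> E.@[v] = E.@[v'].
Hypothesis L_dep : forall v v' : 'I_(n + 2) -> K,
  (forall i, i != k -> i != l -> v i = v' i) -> L.@[v] = L.@[v'].
Hypothesis L0 : L != 0.

Variables (X Y : funSpaceType K) (f : X -> affspace K n) (g : Y -> affspace K n).
Variables (U : set X) (phi : X -> affspace K (n + 2)).
Hypotheses (ch : affine_chart U phi) (phiU : phi @` U = root_cover m k l E L).
Hypothesis fphi : forall x, U x -> f x = lsubmx (phi x : 'rV_(n + 2)).

(** The Jacobian is triangular. The column of a leaves only X_l^m - L, with entry m a^(m-1); then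
    the column of t leaves only X_k - E, the columns of eta leave the equations X_i - G_i, and those
    of Y leave the equations of Y, independent by smoothness. *)
Lemma root_cover_fibre_smooth x y : smooth_variety Y -> morphism g -> U x ->
  f x = g y ->
  (mderiv t E).@[(phi x : 'rV_(n + 2)) 0] != 0 ->
  (mderiv l E).@[(phi x : 'rV_(n + 2)) 0] = 0 ->
  (mderiv l L).@[(phi x : 'rV_(n + 2)) 0] = 0 ->
  (phi x : 'rV_(n + 2)) 0 l != 0 ->
  fibre_product_smooth_at f g (x, y).
Proof.
move=> sY gm Ux fg Et El Ll xl.
have [V [N [psi [G [chV Vy gG [Vv [c [h [hI hloc hfree]]]]]]]]] := smooth_poly_chart y sY gm.
exists U, (n + 2)%N, phi, (fun i => 'X_(lshift 2 i)), V, N, psi, G; split=> //.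
  by move=> x' Ux' i; rewrite mevalXU fphi // mxE.
rewrite phiU; set I := ideal_gen _.
have Ii : is_ideal I by exact: idealg_ideal.
have kl : k != l by rewrite /k /l eq_lrshift.
pose eqn := root_cover_eqn m k l E L.
apply: (@smooth_at_intro _ _ _ _ (bool + 'I_c + 'I_n)%type (fun s => match s with
  | inl (inl b) => polyl N (eqn b)
  | inl (inr i) => polyr (n + 2) (h i)
  | inr i => polyl N 'X_(lshift 2 i) - polyr (n + 2) (G i)
  end)).
- apply: idealg_min.
    exact: meval_ideal.
  move=> _ [[[p pv <-]|[p pv <-]]|[i _ <-]] /=.
  + by rewrite meval_polyl; apply: pv; rewrite -phiU; exists x.
  + by rewrite meval_polyr; apply: Vv.
  + by rewrite mevalB meval_polyl meval_polyr mevalXU -gG // -fg fphi // mxE subrr.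
- case=> [[b|i]|i]; apply: idealg_sub.
  + by left; left; exists (eqn b) => //; exact: root_cover_eqn_vanish.
  + by left; right; exists (h i).
  + by right; exists i.
- set J := idealg _; have Ji : is_ideal J by exact: idealg_ideal.
  have [J0 JD JM] := Ji.
  apply: idealg_min.
    split.
    + by exists 1; rewrite ?meval1 ?oner_neq0 // mulr0.
    + move=> a b [q1 q10 h1] [q2 q20 h2]; exists (q1 * q2).
        by rewrite mevalM mulf_neq0.
      by rewrite mulrDr {1}[q1 * q2]mulrC -!mulrA; apply: JD; apply: JM.
    + by move=> a b [q q0 hq]; exists q => //; rewrite mulrCA; apply: JM.
  move=> _ [[[p pv <-]|[p pv <-]]|[i _ <-]] /=.
  + exists 1; rewrite ?meval1 ?oner_neq0 // mul1r.
    have := vanishing_root_cover unc m0 mK kl E_dep L_dep L0 pv; move: p {pv}.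
    apply: (idealg_min (J := @polyl K (n + 2) N @^-1` J)); first exact: polyl_ideal.
    by move=> _ [b _ <-]; apply: idealg_sub; exists (inl (inl b)).
  + have [q q0 hq] := hloc _ pv; exists (polyr (n + 2) q); first by rewrite meval_polyr.
    rewrite -polyrM; move: (q * p) hq.
    apply: (idealg_min (J := @polyr K (n + 2) N @^-1` J)); first exact: polyr_ideal.
    by move=> _ [i _ <-]; apply: idealg_sub; exists (inl (inr i)).
  + exists 1; rewrite ?meval1 ?oner_neq0 // mul1r.
    by apply: idealg_sub; exists (inr i).
- move=> v v0.
  have dG i j : mderiv (lshift N j) (polyl N 'X_(lshift 2 i) - polyr (n + 2) (G i)) =
      (j == lshift 2 i)%:R.
    rewrite mderivB mderiv_polyl_lshift mderiv_polyr_lshift subr0 mderivXU.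
    by rewrite -!mpolyC_nat polylC.
  have col j : v (inl (inl true)) * (mderiv j (eqn true)).@[(phi x : 'rV_(n + 2)) 0] +
      v (inl (inl false)) * (mderiv j (eqn false)).@[(phi x : 'rV_(n + 2)) 0] +
      \sum_i v (inr i) * (j == lshift 2 i)%:R = 0.
    have := v0 (lshift N j); rewrite !big_sumType big_bool /= [X in _ + X + _]big1 ?addr0.
      rewrite !mderiv_polyl_lshift !meval_polyl => e; rewrite -[RHS]e; congr (_ + _).
      by apply: eq_bigr => i _; rewrite dG -mpolyC_nat mevalC.
    by move=> i _; rewrite mderiv_polyr_lshift meval0 mulr0.
  have vf : v (inl (inl false)) = 0.
    have := col l; rewrite [X in _ + X]big1 ?addr0; last first.
      by move=> i _; rewrite /l eq_rlshift mulr0.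
    rewrite !mderivB mderivXU eq_sym (negPf kl) sub0r mevalN El oppr0 mulr0 add0r.
    rewrite mderivXn.
    rewrite mevalB Ll subr0 mevalM rmorphXn /= -mpolyC_nat mevalC mevalXU => /eqP.
    by rewrite !mulf_eq0 (negPf mK) expf_eq0 (negPf xl) andbF !orbF => /eqP.
  have vt : v (inl (inl true)) = 0.
    have := col t; rewrite vf mul0r addr0 [X in _ + X]big1 ?addr0; last first.
      by move=> i _; rewrite /t eq_rlshift mulr0.
    rewrite mderivB mderivXU /t /k eq_rlshift sub0r mevalN => /eqP.
    by rewrite mulf_eq0 oppr_eq0 (negPf Et) orbF => /eqP.
  have vG i : v (inr i) = 0.
    have := col (lshift 2 i); rewrite vf vt !mul0r !add0r (bigD1 i) //= eqxx mulr1.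
    rewrite big1 ?addr0 // => j ji.
    by rewrite (inj_eq (@lshift_inj _ _)) eq_sym (negPf ji) mulr0.
  case=> [[[]|i]|i] //.
  apply: (smooth_at_indep (v := fun i => v (inl (inr i)))) hfree _ i => j.
  have := v0 (rshift (n + 2) j); rewrite !big_sumType big_bool /= vt vf !mul0r !add0r.
  rewrite [X in _ + X]big1 ?addr0 => [|i' _]; last by rewrite vG mul0r.
  by under eq_bigr do rewrite mderiv_polyr_rshift meval_polyr.
Qed.

End RootCoverSmooth.

(** * The charts of Z *)

Lemma closed_zeros (K : closedFieldType) N (S : set {mpoly K[N]}) :
  closed [set w : affspace K N | forall p, S p -> p.@[(w : 'rV_N) 0] = 0].
Proof.
rewrite -[X in closed X]setCK; apply: open_closedC; apply: open_affspace => w nw.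
have [p [Sp pw]] : exists p, S p /\ p.@[(w : 'rV_N) 0] != 0.
  apply: contrapT => np; apply: nw => p Sp; apply/eqP; apply: contrapT => /negP pw.
  by apply: np; exists p.
by exists p => // y py /(_ p Sp) /eqP; apply/negP.
Qed.

Lemma nbhs_openP (T : topologicalType) (x : T) (P : set T) :
  nbhs x P <-> exists2 B, open_nbhs x B & B `<=` P.
Proof. by rewrite nbhsE. Qed.

(** * Gluing two closed subsets of affine space *)

Section TwoCharts.
Variables (K : closedFieldType) (T : funSpaceType K) (N : nat).
Variables (A A' : set (affspace K N)) (z : A -> T) (z' : A' -> T).
Variables (rho : affspace K N -> affspace K N) (q : {mpoly K[N]}) (r : 'I_N -> {mpoly K[N]}).
Hypothesis rhoE : forall w : affspace K N, q.@[(w : 'rV_N) 0] != 0 -> forall i,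
  (rho w : 'rV_N) 0 i = (r i).@[(w : 'rV_N) 0] / q.@[(w : 'rV_N) 0].
Hypothesis Aclosed : closed A.
Hypothesis openTP : forall W : set T, open W <-> open (z @^-1` W) /\ open (z' @^-1` W).
Hypothesis regT : forall x (f : T -> K), regular_at x f <->
  (forall w, z w = x -> regular_at w (f \o z)) /\
  (forall w, z' w = x -> regular_at w (f \o z')).
Hypothesis zinj : injective z.
Hypothesis z'q : forall w', q.@[(set_val w' : 'rV_N) 0] != 0 -> exists w, z w = z' w'.
Hypothesis zz' : forall w w', z w = z' w' ->
  q.@[(set_val w' : 'rV_N) 0] != 0 /\ set_val w = rho (set_val w').

(** Stated for one of the two pieces, with the rational transition rho from the other; it is applied
    twice, with the roles of the charts of Z exchanged. *)
Lemma two_charts : exists phi : T -> affspace K N,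
  [/\ affine_chart (range z) phi, phi @` range z = A & forall w, phi (z w) = set_val w].
Proof.
have [phi phiz] : exists phi : T -> affspace K N, forall w, phi (z w) = set_val w.
  have ex x : exists v : affspace K N, forall w, z w = x -> v = set_val w.
    have [[w zw]|nw] := pselect (exists w, z w = x); last first.
      by exists (0 : 'rV_N) => w zw; case: nw; exists w.
    by exists (set_val w) => w1; rewrite -zw => /zinj ->.
  by have [phi phiP] := choice ex; exists phi => w; apply: (phiP _ w).
have phiA : phi @` range z = A.
  apply/seteqP; split=> [_ [_ [w _ <-] <-]|w Aw]; first by rewrite phiz; exact: set_valP.
  by exists (z (SigSub (mem_set Aw))); [exists (SigSub (mem_set Aw))|rewrite phiz].
have openO (O : set (affspace K N)) : open O -> open (range z `&` phi @^-1` O).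
  move=> oO; apply/openTP; split.
    exists O => //; apply/seteqP; split=> w /=.
      by move=> Ow; split; [exists w|rewrite /= phiz].
    by case=> _; rewrite /= phiz.
  (* Seen from the other piece, O is the set where the transition is defined and lands in O. *)
  exists [set w | q.@[(w : 'rV_N) 0] != 0 /\ O (rho w)].
    rewrite openE => w [qw Ow]; rewrite /interior.
    apply: filterI; first by apply: open_nbhs_nbhs; split=> //; exact: principal_open.
    by apply: (rational_nbhs qw rhoE); exact: open_nbhs_nbhs.
  apply/seteqP; split=> w' /=.
    move=> [qw' Ow']; have [w zw] := z'q qw'; split; first by exists w.
    by rewrite -zw /= phiz; have [_ ->] := zz' zw.
  by move=> [[w _ zw]]; have [qw' e] := zz' zw; rewrite -zw phiz e.
have oR : open (range z) by rewrite -[range z]setIT -(preimage_setT phi); apply/openO/openT.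
exists phi; split=> //; split.
- exact: oR.
- by move=> _ _ /set_mem[w _ <-] /set_mem[w1 _ <-]; rewrite !phiz => /val_inj ->.
- by rewrite phiA.
- move=> W Wz; split=> [/openTP[[O oO OW] _]|[O oO ->]]; last exact: openO.
  exists O => //; apply/seteqP; split=> x.
    move=> Wx; split; first exact: Wz.
    have [w _ zw] := Wz _ Wx; rewrite /= -zw phiz -[O _]/((set_val @^-1` O) w) OW /=.
    by rewrite zw.
  by move=> [[w _ <-]]; rewrite /= phiz -[O _]/((set_val @^-1` O) w) OW.
move=> x [w _ zw] f; split.
  move=> /regT[/(_ w zw) + _] => -[h hreg /nbhs_openP[B [[O oO OB] Bw] Bf]].
  exists h; first by rewrite -zw phiz.
  apply/nbhs_openP; exists (range z `&` phi @^-1` O).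
    split; first exact: openO.
    by split; [exists w|rewrite /= -zw phiz -[O _]/((set_val @^-1` O) w) OB].
  move=> _ [[w1 _ <-]]; rewrite /= phiz => Ow1; apply: Bf; rewrite -OB; exact: Ow1.
move=> [h hreg /nbhs_openP[W [oW Wx] Wf]].
have [oW1 oW2] := (openTP W).1 oW.
have [oR1 oR2] := (openTP (range z)).1 oR.
apply/regT; split.
  move=> w1 zw1; exists h; first by rewrite -phiz zw1.
  apply/nbhs_openP; exists (z @^-1` W); first by split=> //=; rewrite zw1.
  by move=> w2 /Wf; rewrite /= phiz.
move=> w' zw'; have zww' : z w = z' w' by rewrite zw zw'.
have [qw' e] := zz' zww'; exists (h \o rho).
  by apply: (rational_regular qw' rhoE); rewrite -e -phiz zw.
apply/nbhs_openP; exists (z' @^-1` (range z `&` W)).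
  split; last by split; [exists w|rewrite /= zw'].
  apply: openI => //; exact: oR2.
move=> w2 [[w3 _ zw3] /Wf]; rewrite /= -zw3 phiz.
by have [_ ->] := zz' zw3.
Qed.

End TwoCharts.

Local Notation coord := Defs.coord.

Section Coefficients.
Variables (K : closedFieldType) (n : nat).
Hypothesis hn : (3 <= n)%N.
Implicit Types (eta : 'rV[K]_n).

Lemma coord_ord eta (i : 'I_n) : coord i eta = eta 0 i.
Proof. by rewrite /coord valK. Qed.

Lemma coef_P eta j : (P_ eta)`_j =
  if j == 0%N then - coord (n - 1) eta else if j == 1%N then 1
  else if j == 2 then coord (n - 2) eta
  else if (j <= n)%N then coord (j - 3) eta else 0.
Proof.
rewrite /P_ !coefD coefN coefC coefX coefZ coefXn coef_sum.
have -> : \sum_(3 <= i < n.+1) (coord (i - 3) eta *: 'X^i)`_j =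
    if (3 <= j < n.+1)%N then coord (j - 3) eta else 0.
  case: ifP => hj.
    rewrite (big_rem j) ?mem_index_iota //= coefZ coefXn eqxx mulr1.
    rewrite big_seq big1 ?addr0 // => i.
    rewrite mem_rem_uniq ?iota_uniq // inE => /andP[ij _].
    by rewrite coefZ coefXn eq_sym (negPf ij) mulr0.
  rewrite big_seq big1 // => i; rewrite mem_index_iota => hi.
  rewrite coefZ coefXn; case: eqP => [ji|_]; last by rewrite mulr0.
  by rewrite ji hi in hj.
by case: j => [|[|[|j]]] /=; rewrite ?ltnS ?mulr0 ?mulr1 ?addr0 ?add0r ?sub0r ?subr0.
Qed.

Lemma P_poly eta : P_ eta = \poly_(j < n.+1) (P_ eta)`_j.
Proof.
apply/polyP => j; rewrite coef_poly; case: ltnP => // nj.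
rewrite coef_P; case: j nj => [|[|[|j]]] nj /=; [by []|by lia|by lia|].
by rewrite leqNgt nj.
Qed.

Lemma Q_poly eta : Q_ eta = \poly_(j < n.+1) (P_ eta)`_(n - j).
Proof.
rewrite /Q_ poly_def (reindex_inj rev_ord_inj) /=; apply: eq_bigr => j _.
by rewrite subSS subKn // -ltnS.
Qed.

Lemma horner_deriv_poly (c : nat -> K) t :
  (\poly_(j < n.+1) c j)^`().[t] = \sum_(j < n.+1) j%:R * c j * t ^+ j.-1.
Proof.
rewrite poly_def raddf_sum horner_sum; apply: eq_bigr => j _ /=.
by rewrite derivZ derivXn hornerZ hornerMn hornerXn -mulr_natl; ring.
Qed.

Lemma Q_horner eta u : u != 0 -> (Q_ eta).[u] = u ^+ n * (P_ eta).[u^-1].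
Proof.
move=> u0; rewrite Q_poly P_poly !horner_poly mulr_sumr.
rewrite (reindex_inj rev_ord_inj) /=; apply: eq_bigr => j _.
have jn : (j <= n)%N by rewrite -ltnS.
rewrite subSS subKn // -P_poly mulrCA; congr (_ * _).
by rewrite exprVn -expfB_cond ?(negPf u0) ?add0n.
Qed.

(** Differentiating Q(u) = u^n P(1/u) gives u Q'(u) + u^(n-1) P'(1/u) = n Q(u). At a root this is
    -Q'(u) = u^m P'(1/u), so the two cover equations match under v = u a. *)
Lemma Q_deriv_horner eta u : u != 0 -> (Q_ eta).[u] = 0 ->
  (Q_ eta)^`().[u] = - u ^+ (n - 2) * (P_ eta)^`().[u^-1].
Proof.
move=> u0 Qu; apply: (mulfI u0); apply/eqP; rewrite -subr_eq0; apply/eqP.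
suff -> : u * (Q_ eta)^`().[u] - u * (- u ^+ (n - 2) * (P_ eta)^`().[u^-1]) =
    n%:R * (Q_ eta).[u] by rewrite Qu mulr0.
rewrite mulrA mulrN -exprS mulNr opprK.
rewrite Q_poly P_poly !horner_deriv_poly horner_poly -P_poly !mulr_sumr.
rewrite [X in _ + X](reindex_inj rev_ord_inj) -big_split; apply: eq_bigr => j _ /=.
have jn : (j <= n)%N by rewrite -ltnS.
have -> : u * (j%:R * (P_ eta)`_(n - j) * u ^+ j.-1) =
    j%:R * ((P_ eta)`_(n - j) * u ^+ j).
  case: (val j) => [|i]; first by rewrite !mul0r mulr0.
  by rewrite /= exprS; ring.
rewrite subSS.
have -> : u ^+ (n - 2).+1 * ((n - j)%:R * (P_ eta)`_(n - j) * u^-1 ^+ (n - j).-1) =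
    (n - j)%:R * ((P_ eta)`_(n - j) * u ^+ j).
  have [nj|nj] := posnP (n - j)%N; first by rewrite nj !mul0r mulr0.
  have -> : u ^+ (n - 2).+1 = u ^+ j * u ^+ (n - j).-1.
    by rewrite -exprD; congr (_ ^+ _); lia.
  rewrite exprVn; have := expf_neq0 (n - j).-1 u0 => h.
  by field.
by rewrite -mulrDl -natrD subnKC.
Qed.

End Coefficients.

(* Both charts of Z are of this form: in the finite chart k is the coordinate
   A_0, in the infinity chart it is C_n, and a^m is the derivative in t of the
   function whose graph is cut out by the equation of the root. *)
Definition is_root_chart (K : closedFieldType) n (A : set (affspace K (n + 2))) : Prop :=
  exists (k0 : 'I_n) (E L : {mpoly K[n + 2]}),
  let k : 'I_(n + 2) := lshift 2 k0 in
  let t : 'I_(n + 2) := rshift n ord0 in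
  let l : 'I_(n + 2) := rshift n ord_max in
  [/\ A = root_cover (n - 2) k l E L,
     forall v v' : 'I_(n + 2) -> K,
       (forall i, i != k -> i != l -> v i = v' i) -> E.@[v] = E.@[v'],
     forall v v' : 'I_(n + 2) -> K,
       (forall i, i != k -> i != l -> v i = v' i) -> L.@[v] = L.@[v'],
     L != 0 &
     [/\ mderiv t E = L, mderiv l E = 0 & mderiv l L = 0]].

Section ChartEquations.
Variables (K : closedFieldType) (n : nat).
Hypothesis hn : (3 <= n)%N.
Local Notation t := (rshift n ord0 : 'I_(n + 2)).
Local Notation l := (rshift n ord_max : 'I_(n + 2)).

Section Family.
Variables (k0 : 'I_n) (d : nat -> {mpoly K[n + 2]}).
Local Notation k := (lshift 2 k0).
Hypothesis d_dep : forall i, (0 < i <= n)%N -> forall v v' : 'I_(n + 2) -> K,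
  (forall j, j != k -> j != l -> v j = v' j) -> (d i).@[v] = (d i).@[v'].
Hypothesis dt : forall i, (0 < i <= n)%N -> mderiv t (d i) = 0.
Hypothesis dl : forall i, (0 < i <= n)%N -> mderiv l (d i) = 0.
Hypothesis d1 : (d 1%N).@[fun i => (i != t)%:R] != 0.

Definition graph_eqn : {mpoly K[n + 2]} := \sum_(1 <= i < n.+1) d i * 'X_t ^+ i.
Definition graph_deriv : {mpoly K[n + 2]} :=
  \sum_(1 <= i < n.+1) i%:R * d i * 'X_t ^+ i.-1.

Lemma root_chart_family (A : set (affspace K (n + 2))) :
  A = root_cover (n - 2) k l graph_eqn graph_deriv -> is_root_chart A.
Proof.
move=> ->.
have tl : l != t by rewrite /= (inj_eq (@rshift_inj _ _)).
have tk : t != k by rewrite eq_rlshift.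
have in_range i : i \in index_iota 1 n.+1 -> (0 < i <= n)%N.
  by rewrite mem_index_iota ltnS.
exists k0, graph_eqn, graph_deriv; split=> //.
- move=> v v' vv'; rewrite !raddf_sum /= big_seq [RHS]big_seq.
  apply: eq_bigr => i /in_range hi; rewrite !mevalM !rmorphXn /= !mevalXU.
  by rewrite (d_dep hi vv') vv' // eq_sym.
- move=> v v' vv'; rewrite !raddf_sum /= big_seq [RHS]big_seq.
  apply: eq_bigr => i /in_range hi; rewrite !mevalM !rmorphXn /= !mevalXU.
  by rewrite (d_dep hi vv') vv' -?mpolyC_nat ?mevalC // eq_sym.
(* At the point with t = 0 and all other coordinates 1, only the term i = 1 survives. *)
- apply: contra_neq d1 => /(congr1 (meval (fun i => (i != t)%:R))).
  rewrite meval0 raddf_sum /= big_ltn ?ltnS; last by lia.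
  rewrite !mevalM !meval1 mul1r mulr1.
  rewrite big_seq big1 ?addr0 // => -[|[|i]]; rewrite mem_index_iota // => _.
  by rewrite mevalM rmorphXn /= mevalXU eqxx expr0n mulr0.
split.
- rewrite raddf_sum /= big_seq [RHS]big_seq; apply: eq_bigr => i /in_range hi.
  by rewrite mderivM dt // mderivXn; ring.
- rewrite raddf_sum /= big_seq big1 // => i /in_range hi.
  by rewrite mderivM dl // mderivXn_neq // mul0r mulr0 addr0.
- rewrite raddf_sum /= big_seq big1 // => i /in_range hi.
  rewrite !mderivM dl // mderivXn_neq // -mpolyC_nat mderivC.
  by rewrite !(mul0r, mulr0, addr0).
Qed.

Lemma meval_graph_eqn (w : 'rV[K]_(n + 2)) :
  graph_eqn.@[w 0] = \sum_(1 <= i < n.+1) (d i).@[w 0] * w 0 t ^+ i.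
Proof.
rewrite raddf_sum; apply: eq_bigr => i _ /=.
by rewrite mevalM rmorphXn /= mevalXU.
Qed.

Lemma meval_graph_deriv (w : 'rV[K]_(n + 2)) :
  graph_deriv.@[w 0] = \sum_(1 <= i < n.+1) i%:R * (d i).@[w 0] * w 0 t ^+ i.-1.
Proof.
rewrite raddf_sum; apply: eq_bigr => i _ /=.
by rewrite !mevalM rmorphXn /= mevalXU -mpolyC_nat mevalC.
Qed.

End Family.

Definition mcoord (j : nat) : {mpoly K[n + 2]} :=
  if insub j is Some i then 'X_(lshift 2 (i : 'I_n)) else 0.

Lemma meval_mcoord (w : 'rV[K]_(n + 2)) j : (mcoord j).@[w 0] = coord j (lsubmx w).
Proof.
rewrite /mcoord /Defs.coord; case: insubP => [i _ _|_]; last by rewrite meval0.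
by rewrite mevalXU mxE.
Qed.

Lemma mcoord_dep (k0 : 'I_n) (j : nat) (v v' : 'I_(n + 2) -> K) : j != k0 ->
  (forall i, i != lshift 2 k0 -> i != l -> v i = v' i) ->
  (mcoord j).@[v] = (mcoord j).@[v'].
Proof.
move=> jk vv'; rewrite /mcoord; case: insubP => [i _ ij|_]; last by rewrite !meval0.
rewrite !mevalXU vv' ?eq_lrshift // (inj_eq (@lshift_inj _ _)).
by rewrite -val_eqE ij.
Qed.

Lemma mderiv_mcoord j s : mderiv (rshift n s) (mcoord j) = 0.
Proof.
rewrite /mcoord; case: insub => [i|]; last by rewrite mderiv0.
by rewrite mderivXU eq_rlshift.
Qed.

Definition mcoef (j : nat) : {mpoly K[n + 2]} :=
  if j == 0%N then - mcoord (n - 1) else if j == 1%N then 1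
  else if j == 2 then mcoord (n - 2) else if (j <= n)%N then mcoord (j - 3) else 0.

Lemma meval_mcoef (w : 'rV[K]_(n + 2)) j : (mcoef j).@[w 0] = (P_ (lsubmx w))`_j.
Proof.
rewrite coef_P // /mcoef.
case: j => [|[|[|j]]] /=; rewrite ?mevalN ?meval1 ?meval_mcoord //.
by case: ifP => _; rewrite ?meval_mcoord ?meval0.
Qed.

(** The nested conditional is the position of the coefficient of T^j among (C_3, .., C_n, A_2, A_0);
    for j = 1 the coefficient is the constant 1. *)
Lemma mcoef_dep (k0 : 'I_n) (j : nat) (v v' : 'I_(n + 2) -> K) :
  (j <= n)%N ->
  (if j == 0%N then n - 1 else if j == 2 then n - 2 else j - 3)%N != k0 \/ j = 1%N ->
  (forall i, i != lshift 2 k0 -> i != l -> v i = v' i) ->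
  (mcoef j).@[v] = (mcoef j).@[v'].
Proof.
move=> jn hj vv'; rewrite /mcoef.
case: j jn hj => [|[|[|j]]] jn /= hj.
- by rewrite !mevalN (@mcoord_dep k0 _ v v') //; case: hj.
- by rewrite !meval1.
- by apply: (@mcoord_dep k0) => //; case: hj.
- by rewrite jn; apply: (@mcoord_dep k0) => //; case: hj.
Qed.

Lemma mderiv_mcoef j s : mderiv (rshift n s) (mcoef j) = 0.
Proof.
rewrite /mcoef; case: j => [|[|[|j]]] /=; rewrite ?mderivN ?mderiv_mcoord ?oppr0 //.
  by rewrite -mpolyC1 mderivC.
by case: ifP => _; rewrite ?mderiv_mcoord ?mderiv0.
Qed.

Lemma horner_split (c : nat -> K) a :
  (\poly_(j < n.+1) c j).[a] = c 0%N + \sum_(1 <= i < n.+1) c i * a ^+ i.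
Proof.
rewrite horner_poly -(big_mkord xpredT (fun j => c j * a ^+ j)) big_ltn //.
by rewrite expr0 mulr1.
Qed.

Lemma horner_deriv_split (c : nat -> K) a :
  (\poly_(j < n.+1) c j)^`().[a] = \sum_(1 <= i < n.+1) i%:R * c i * a ^+ i.-1.
Proof.
rewrite horner_deriv_poly -(big_mkord xpredT (fun j => j%:R * c j * a ^+ j.-1)) big_ltn //.
by rewrite !mul0r add0r.
Qed.

Lemma finite_root_chart : is_root_chart (finite_chart K n).
Proof.
have n1 : (n - 1 < n)%N by lia.
apply: (@root_chart_family (Ordinal n1) mcoef).
- move=> i /andP[i0 iN] v v'; apply: mcoef_dep => //=.
  by case: i i0 iN => [|[|[|i]]] //= _ iN; [right|left; lia|left; lia].
- by move=> i _; apply: mderiv_mcoef.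
- by move=> i _; apply: mderiv_mcoef.
- by rewrite meval1 oner_neq0.
have e (w : 'rV_(n + 2)) : (graph_eqn mcoef).@[w 0] =
    \sum_(1 <= i < n.+1) (P_ (lsubmx w))`_i * w 0 t ^+ i.
  by rewrite meval_graph_eqn; apply: eq_bigr => i _; rewrite meval_mcoef.
have e' (w : 'rV_(n + 2)) : (graph_deriv mcoef).@[w 0] =
    \sum_(1 <= i < n.+1) i%:R * (P_ (lsubmx w))`_i * w 0 t ^+ i.-1.
  by rewrite meval_graph_deriv; apply: eq_bigr => i _; rewrite meval_mcoef.
have e0 (w : 'rV_(n + 2)) : (P_ (lsubmx w))`_0 = - w 0 (lshift 2 (Ordinal n1)).
  by rewrite coef_P //= -[(n - 1)%N]/(val (Ordinal n1)) coord_ord mxE.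
have eP (w : affspace K (n + 2)) : (P_ (peta w)).[pfst w] =
    - (w : 'rV_(n + 2)) 0 (lshift 2 (Ordinal n1)) + (graph_eqn mcoef).@[(w : 'rV_(n + 2)) 0].
  by rewrite P_poly // horner_split e -e0.
have eP' (w : affspace K (n + 2)) : (P_ (peta w))^`().[pfst w] =
    (graph_deriv mcoef).@[(w : 'rV_(n + 2)) 0].
  by rewrite P_poly // horner_deriv_split e'.
apply/seteqP; split=> w; rewrite /finite_chart /root_cover /= eP eP' => -[h ->]; split=> //.
  by move/eqP: h; rewrite addrC subr_eq0 => /eqP.
by rewrite h addNr.
Qed.

Lemma infinity_root_chart : is_root_chart (infinity_chart K n).
Proof.
have n3 : (n - 3 < n)%N by lia.
(* Solving Q(u) = 0 for C_n moves the other coefficients across the equation; the sign agrees with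
   v^m = -Q'(u). *)
pose d i : {mpoly K[n + 2]} := - mcoef (n - i).
apply: (@root_chart_family (Ordinal n3) d).
- move=> i /andP[i0 iN] v v' vv'; rewrite !mevalN; congr (- _).
  apply: mcoef_dep vv' => /=; first exact: leq_subr.
  have [h0|h0] := eqVneq (n - i)%N 0%N; first by left; lia.
  have [h2|h2] := eqVneq (n - i)%N 2; first by left; lia.
  by have [h1|h1] := eqVneq (n - i)%N 1%N; [right|left; lia].
- by move=> i _; rewrite mderivN mderiv_mcoef oppr0.
- by move=> i _; rewrite mderivN mderiv_mcoef oppr0.
- rewrite mevalN oppr_eq0 /mcoef.
  have mc j : (j < n)%N -> (mcoord j).@[fun i => (i != t)%:R] = 1.
    move=> jn; rewrite /mcoord insubT mevalXU eq_lrshift //.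
  have -> : (n - 1 == 0)%N = false by lia.
  have -> : (n - 1 == 1)%N = false by lia.
  by case: ifP => _; [|case: ifP => h; last by lia]; rewrite mc ?oner_neq0 //; lia.
have e (w : 'rV_(n + 2)) : (graph_eqn d).@[w 0] =
    - \sum_(1 <= i < n.+1) (P_ (lsubmx w))`_(n - i) * w 0 t ^+ i.
  rewrite meval_graph_eqn -sumrN; apply: eq_bigr => i _.
  by rewrite mevalN meval_mcoef mulNr.
have e' (w : 'rV_(n + 2)) : (graph_deriv d).@[w 0] =
    - \sum_(1 <= i < n.+1) i%:R * (P_ (lsubmx w))`_(n - i) * w 0 t ^+ i.-1.
  rewrite meval_graph_deriv -sumrN; apply: eq_bigr => i _.
  by rewrite mevalN meval_mcoef mulrN mulNr.
have e0 (w : 'rV_(n + 2)) : (P_ (lsubmx w))`_(n - 0) = w 0 (lshift 2 (Ordinal n3)).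
  rewrite subn0 coef_P //.
  have -> : (n == 0)%N = false by lia.
  have -> : (n == 1)%N = false by lia.
  have -> : (n == 2)%N = false by lia.
  by rewrite leqnn -[(n - 3)%N]/(val (Ordinal n3)) coord_ord mxE.
have eQ (w : affspace K (n + 2)) : (Q_ (peta w)).[pfst w] =
    (w : 'rV_(n + 2)) 0 (lshift 2 (Ordinal n3)) - (graph_eqn d).@[(w : 'rV_(n + 2)) 0].
  by rewrite Q_poly // horner_split e -e0 opprK.
have eQ' (w : affspace K (n + 2)) : - (Q_ (peta w))^`().[pfst w] =
    (graph_deriv d).@[(w : 'rV_(n + 2)) 0].
  by rewrite Q_poly // horner_deriv_split e'.
apply/seteqP; split=> w; rewrite /infinity_chart /root_cover /= eQ eQ' => -[h ->]; split=> //.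
  by move/eqP: h; rewrite subr_eq0 => /eqP.
by rewrite h subrr.
Qed.

End ChartEquations.

Section ZCharts.
Variables (K : closedFieldType) (n : nat).
Hypothesis hn : (3 <= n)%N.
Local Notation t := (rshift n ord0 : 'I_(n + 2)).
Local Notation l := (rshift n ord_max : 'I_(n + 2)).

Lemma zfin_inj : injective (@zfin K n).
Proof. by move=> w w' /eqquotP/= /eqP. Qed.

Lemma zinf_inj : injective (@zinf K n).
Proof. by move=> w w' /eqquotP/= /eqP. Qed.

Lemma zfin_zinf (w : finite_chart K n) (w' : infinity_chart K n) :
  zfin w = zinf w' <-> glued (set_val w) (set_val w').
Proof. by split=> [/eqquotP|h]; [|apply/eqquotP]. Qed.

Lemma zproj_zfin (w : finite_chart K n) : zproj (zfin w) = peta (set_val w).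
Proof.
rewrite /zproj; have : (\pi_{eq_quot (@glue_rel K n)} (repr (zfin w)) = zfin w)%qT.
  exact: reprK.
case: (repr (zfin w)) => w1 /eqquotP /=; first by move/eqP ->.
by rewrite /glue_rel => /and3P[/eqP ->].
Qed.

Lemma zproj_zinf (w : infinity_chart K n) : zproj (zinf w) = peta (set_val w).
Proof.
rewrite /zproj; have : (\pi_{eq_quot (@glue_rel K n)} (repr (zinf w)) = zinf w)%qT.
  exact: reprK.
case: (repr (zinf w)) => w1 /eqquotP /=; last by move/eqP ->.
by rewrite /glue_rel => /and3P[/eqP ->].
Qed.

Lemma zcover (z : Z K n) : (exists w, z = zfin w) \/ (exists w, z = zinf w).
Proof.
rewrite -[z]reprK; case: (repr z) => w; [left|right]; by exists w.
Qed.

(* The transition [u = 1 / t, v = a / t]; its inverse is given by the same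
   formula. *)
Definition flip (w : affspace K (n + 2)) : affspace K (n + 2) :=
  row_mx (peta w : 'rV_n) (\row_(i < 2) if i == ord0 then (pfst w)^-1 else psnd w / pfst w).

Lemma peta_flip (w : affspace K (n + 2)) : peta (flip w) = peta w.
Proof. by rewrite /peta row_mxKl. Qed.

Lemma pfst_flip (w : affspace K (n + 2)) : pfst (flip w) = (pfst w)^-1.
Proof. by rewrite /pfst row_mxEr mxE eqxx. Qed.

Lemma psnd_flip (w : affspace K (n + 2)) : psnd (flip w) = psnd w / pfst w.
Proof. by rewrite /psnd row_mxEr mxE. Qed.

Lemma affspace_eq (w w' : affspace K (n + 2)) :
  peta w = peta w' -> pfst w = pfst w' -> psnd w = psnd w' -> w = w'.
Proof.
move=> e1 e2 e3; rewrite -[w](hsubmxK (w : 'rV_(n + 2))) -[w'](hsubmxK (w' : 'rV_(n + 2))).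
congr row_mx; first exact: e1.
apply/rowP => i; rewrite !mxE; have [->|i0] := eqVneq i ord0; first exact: e2.
have -> : i = ord_max by apply: val_inj; case: i i0 => [[|[|]]].
exact: e3.
Qed.

Definition flip_num (i : 'I_(n + 2)) : {mpoly K[n + 2]} :=
  match fintype.split i with
  | inl j => 'X_(lshift 2 j) * 'X_t
  | inr j => if j == ord0 then 1 else 'X_l
  end.

Lemma flipE (w : affspace K (n + 2)) :
  ('X_t : {mpoly K[n + 2]}).@[(w : 'rV_(n + 2)) 0] != 0 -> forall i,
  (flip w : 'rV_(n + 2)) 0 i = (flip_num i).@[(w : 'rV_(n + 2)) 0]
    / ('X_t : {mpoly K[n + 2]}).@[(w : 'rV_(n + 2)) 0].
Proof.
rewrite mevalXU => w0 i; rewrite mxE /flip_num; case: (fintype.split i) => j.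
  by rewrite mevalM !mevalXU mulfK // mxE.
by rewrite mxE; case: eqP => _; rewrite ?meval1 ?mul1r // mevalXU.
Qed.

Lemma glued_flipr (w w' : affspace K (n + 2)) : glued w w' <-> pfst w' != 0 /\ w = flip w'.
Proof.
split=> [/and3P[/eqP e1 /eqP e2 /eqP e3]|[w0 ->]].
  have w0 : pfst w' != 0 by apply: contra_eq_neq e2 => ->; rewrite mul0r eq_sym oner_neq0.
  split=> //; apply: affspace_eq; rewrite ?peta_flip ?pfst_flip ?psnd_flip //.
    by apply: (mulfI w0); rewrite e2 mulfV.
  by rewrite e3 mulrAC mulfV // mul1r.
by rewrite /glued peta_flip pfst_flip psnd_flip eqxx mulfV // eqxx mulrCA mulfV // mulr1 eqxx.
Qed.

Lemma glued_flipl (w w' : affspace K (n + 2)) : glued w w' <-> pfst w != 0 /\ w' = flip w.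
Proof.
split=> [/and3P[/eqP e1 /eqP e2 /eqP e3]|[w0 ->]].
  have w0 : pfst w != 0 by apply: contra_eq_neq e2 => ->; rewrite mulr0 eq_sym oner_neq0.
  split=> //; apply: affspace_eq; rewrite ?peta_flip ?pfst_flip ?psnd_flip //.
    by apply: (mulIf w0); rewrite e2 mulVf.
  by rewrite e3 mulrC; congr (_ * _); apply: (mulIf w0); rewrite e2 mulVf.
by rewrite /glued peta_flip pfst_flip psnd_flip eqxx mulVf // eqxx mulrC eqxx.
Qed.

Lemma flip_finite (w : affspace K (n + 2)) :
  infinity_chart K n w -> pfst w != 0 -> finite_chart K n (flip w).
Proof.
move=> [Qw vw] w0; split.
  rewrite peta_flip pfst_flip; move: Qw; rewrite Q_horner // => /eqP.
  by rewrite mulf_eq0 expf_eq0 (negPf w0) andbF => /eqP.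
rewrite peta_flip pfst_flip psnd_flip expr_div_n vw Q_deriv_horner //.
by rewrite !mulNr opprK mulrC mulKf ?expf_neq0.
Qed.

Lemma flip_infinity (w : affspace K (n + 2)) :
  finite_chart K n w -> pfst w != 0 -> infinity_chart K n (flip w).
Proof.
move=> [Pw aw] w0; have wi0 : (pfst w)^-1 != 0 by rewrite invr_neq0.
have Qw : (Q_ (peta w)).[(pfst w)^-1] = 0 by rewrite Q_horner // invrK Pw mulr0.
split; rewrite peta_flip pfst_flip //.
by rewrite psnd_flip Q_deriv_horner // invrK !mulNr opprK expr_div_n aw exprVn mulrC.
Qed.

Lemma closed_root_chart (A : set (affspace K (n + 2))) : is_root_chart A -> closed A.
Proof.
move=> [k0 [E [L [-> _ _ _ _]]]].
have := @closed_zeros K _ (range (root_cover_eqn (n - 2) (lshift 2 k0) l E L)).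
congr closed; apply/seteqP; split=> w.
  move=> h; split.
    have := h _ (ex_intro2 _ _ true I erefl); rewrite mevalB mevalXU => /eqP.
    by rewrite subr_eq0 => /eqP.
  have := h _ (ex_intro2 _ _ false I erefl); rewrite mevalB rmorphXn /= mevalXU => /eqP.
  by rewrite subr_eq0 => /eqP.
by move=> h _ [b _ <-]; exact: root_cover_eqn_vanish.
Qed.

Lemma zfin_chart : exists phi : Z K n -> affspace K (n + 2),
  [/\ affine_chart (range (@zfin K n)) phi, phi @` range (@zfin K n) = finite_chart K n &
      forall w, phi (zfin w) = set_val w].
Proof.
apply: (@two_charts _ _ _ _ _ _ (@zinf K n) flip 'X_t flip_num flipE _ _ _ zfin_inj).
- by apply: closed_root_chart; exact: finite_root_chart.
- by move=> W; split=> h; exact: h.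
- by move=> x f; split=> h; exact: h.
- move=> w'; rewrite mevalXU => w0.
  exists (SigSub (mem_set (flip_finite (set_valP w') w0))).
  by apply/zfin_zinf/glued_flipr; split.
- by move=> w w' /zfin_zinf/glued_flipr[w0 e]; rewrite mevalXU.
Qed.

Lemma zinf_chart : exists phi : Z K n -> affspace K (n + 2),
  [/\ affine_chart (range (@zinf K n)) phi, phi @` range (@zinf K n) = infinity_chart K n &
      forall w, phi (zinf w) = set_val w].
Proof.
apply: (@two_charts _ _ _ _ _ _ (@zfin K n) flip 'X_t flip_num flipE _ _ _ zinf_inj).
- by apply: closed_root_chart; exact: infinity_root_chart.
- by move=> W; split=> -[].
- by move=> x f; split=> -[].
- move=> w'; rewrite mevalXU => w0.
  exists (SigSub (mem_set (flip_infinity (set_valP w') w0))).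
  by apply/esym/zfin_zinf/glued_flipl; split.
- by move=> w w' /esym/zfin_zinf/glued_flipl[w0 e]; rewrite mevalXU.
Qed.

Hypothesis unc : ~ countable [set: K].
Hypothesis char0 : forall i, (0 < i)%N -> (i%:R : K) != 0.
Variables (Gam : funSpaceType K) (g : Gam -> affspace K n).
Hypotheses (sGam : smooth_variety Gam) (gm : morphism g).

Lemma root_chart_smooth (A : set (affspace K (n + 2))) (z : A -> Z K n) phi w y :
  is_root_chart A -> affine_chart (range z) phi -> phi @` range z = A ->
  (forall w, phi (z w) = set_val w) ->
  (forall w, zproj (z w) = peta (set_val w)) ->
  zproj (z w) = g y -> psnd (set_val w) != 0 ->
  fibre_product_smooth_at (@zproj K n) g (z w, y).
Proof.
move=> [k0 [E [L [AE E_dep L_dep L0 [Et El Ll]]]]] ch phiA phiz zp wy w0.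
have n20 : (0 < n - 2)%N by lia.
have Aw := set_valP w.
have Lw : L.@[(set_val w : 'rV_(n + 2)) 0] != 0.
  by move: Aw; rewrite {1}AE => -[_ <-]; rewrite expf_neq0.
apply: (root_cover_fibre_smooth (m := n - 2) (k0 := k0) (E := E) (L := L) unc n20 (char0 n20)
          E_dep L_dep L0 ch) => //.
- by rewrite phiA.
- by move=> _ [w1 _ <-]; rewrite phiz zp.
- by rewrite Et phiz.
- by rewrite El meval0.
- by rewrite Ll meval0.
- by rewrite phiz.
Qed.

Lemma zfin_smooth (w : finite_chart K n) y : zproj (zfin w) = g y ->
  psnd (set_val w) != 0 -> fibre_product_smooth_at (@zproj K n) g (zfin w, y).
Proof.
have [phi [ch phiA phiz]] := zfin_chart.
exact: (root_chart_smooth (finite_root_chart K hn) ch phiA phiz zproj_zfin).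
Qed.

Lemma zinf_smooth (w : infinity_chart K n) y : zproj (zinf w) = g y ->
  psnd (set_val w) != 0 -> fibre_product_smooth_at (@zproj K n) g (zinf w, y).
Proof.
have [phi [ch phiA phiz]] := zinf_chart.
exact: (root_chart_smooth (infinity_root_chart K hn) ch phiA phiz zproj_zinf).
Qed.

End ZCharts.

(** * Simple roots and the image of the source *)

Section SimpleRoot.
Variables (K : closedFieldType) (n : nat).
Hypothesis hn : (3 <= n)%N.
Implicit Types (eta : 'rV[K]_n).

(** Leaving a and b free serves both charts: P is homogenized in (X_1, X_0), Q in (X_0, X_1). *)
Definition bihom (k : nat) (r : {poly K}) (a b : {mpoly K[2]}) : {mpoly K[2]} :=
  \sum_(j < k.+1) r`_j *: (a ^+ j * b ^+ (k - j)).

Lemma bihom_mulXsub k (r : {poly K}) c a b : (size r <= k.+1)%N ->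
  bihom k.+1 (r * ('X - c%:P)) a b = (a - c *: b) * bihom k r a b.
Proof.
move=> sr; rewrite /bihom mulrBl !mulr_sumr.
under eq_bigr do rewrite mulrBr coefB coefMX coefMC scalerBl.
rewrite sumrB big_ord_recl /= scale0r add0r [X in _ - X]big_ord_recr /=.
rewrite (nth_default _ sr) mul0r scale0r addr0; congr (_ - _); apply: eq_bigr => j _.
  by rewrite /bump /= add1n subSS exprS -scalerAr mulrA.
by rewrite (subSn (leq_ord j)) exprS -scalerAr -scalerAl scalerA mulrCA.
Qed.

Lemma Ph_bihom eta : Ph eta = bihom n (P_ eta) 'X_ord0 'X_ord_max.
Proof. by []. Qed.

Lemma Ph_bihom_inf eta : Ph eta = bihom n (Q_ eta) 'X_ord_max 'X_ord0.
Proof.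
rewrite Ph_bihom /bihom (reindex_inj rev_ord_inj) /=; apply: eq_bigr => j _.
have jn : (j <= n)%N by rewrite -ltnS.
by rewrite subSS (subKn jn) Q_poly coef_poly ltn_ord; congr (_ *: _); exact: mulrC.
Qed.

Definition unhom (a b : {poly K}) : {mpoly K[2]} -> {poly K} := locked
  (mmap (@polyC K) (fun i => if i == ord0 then a else b)).

Lemma unhomM a b p q : unhom a b (p * q) = unhom a b p * unhom a b q.
Proof. by rewrite /unhom -lock; exact: rmorphM. Qed.

Lemma unhomD a b p q : unhom a b (p + q) = unhom a b p + unhom a b q.
Proof. by rewrite /unhom -lock; exact: rmorphD. Qed.

Lemma unhomC a b c : unhom a b c%:MP = c%:P.
Proof. by rewrite /unhom -lock mmapC. Qed.

Lemma unhomX a b i : unhom a b 'X_i = if i == ord0 then a else b.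
Proof. by rewrite /unhom -lock mmapX mmap1U. Qed.

Lemma unhom_bihom a b k r i j :
  unhom a b (bihom k r 'X_i 'X_j) =
  \sum_(h < k.+1) r`_h *: (unhom a b 'X_i ^+ h * unhom a b 'X_j ^+ (k - h)).
Proof.
rewrite /unhom -lock /bihom rmorph_sum; apply: eq_bigr => h _ /=.
by rewrite mmapZ rmorphM !rmorphXn mul_polyC.
Qed.

Lemma unhom_horner a b p c :
  (unhom a b p).[c] = p.@[fun i => if i == ord0 then a.[c] else b.[c]].
Proof.
elim/mpoly_ring_ind: p => [e|i|p q hp hq|p q hp hq].
- by rewrite unhomC hornerC mevalC.
- by rewrite unhomX mevalXU; case: ifP.
- by rewrite unhomD hornerD hp hq mevalD.
- by rewrite unhomM hornerM hp hq mevalM.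
Qed.

Lemma unhom_lin a b (c d : K) :
  unhom a b (c *: 'X_ord0 - d *: 'X_ord_max) = c *: a - d *: b.
Proof.
rewrite -!mul_mpolyC -mulNr -rmorphN /= unhomD !unhomM !unhomC !unhomX /=.
by rewrite !mul_polyC scaleNr.
Qed.

Lemma size_P eta : (size (P_ eta) <= n.+1)%N.
Proof. by rewrite P_poly // size_poly. Qed.

(** Write P = r (T - t), so that P'(t) = r(t). A cofactor of the linear form dehomogenizes to r, and
    r homogenized in degree n - 1 is a cofactor. *)
Lemma simple_proj_root_finite eta t : (P_ eta).[t] = 0 ->
  simple_proj_root (Ph eta) t 1 <-> (P_ eta)^`().[t] != 0.
Proof.
move=> /rootP/factor_theorem[r Pr]; split.
  move=> [G FG Gt]; have := congr1 (unhom 'X 1) FG.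
  rewrite unhomM unhom_lin Ph_bihom unhom_bihom !unhomX /=.
  under eq_bigr do rewrite expr1n mulr1.
  rewrite -poly_def -P_poly // scale1r alg_polyC => ->.
  rewrite derivM hornerD !hornerM hornerXsubC subrr mul0r addr0 derivXsubC hornerC mul1r.
  by move: Gt; rewrite unhom_horner hornerX hornerC.
have sr : (size r <= n.-1.+1)%N.
  have [->|r0] := eqVneq r 0; first by rewrite size_poly0.
  have := size_P eta; rewrite Pr size_Mmonic ?monicXsubC // size_XsubC addn2 /= => h.
  by rewrite prednK //; lia.
have e : (P_ eta)^`().[t] = r.[t].
  by rewrite Pr derivM hornerD !hornerM hornerXsubC subrr mulr0 add0r derivXsubC hornerC mulr1.
rewrite e => rt; exists (bihom n.-1 r 'X_ord0 'X_ord_max).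
  rewrite scale1r -bihom_mulXsub // -Pr prednK //; lia.
rewrite /bihom raddf_sum /=.
suff -> : \sum_(i < n.-1.+1) (r`_i *: ('X_ord0 ^+ i * 'X_ord_max ^+ (n.-1 - i))).@[fun i0 : 'I_2 =>
   if i0 == ord0 then t else 1] = r.[t] by [].
rewrite (horner_coef_wide _ sr); apply: eq_bigr => i _.
by rewrite mevalZ mevalM !rmorphXn /= !mevalXU /= expr1n mulr1.
Qed.

Lemma simple_proj_root_infinity eta u : (Q_ eta).[u] = 0 ->
  simple_proj_root (Ph eta) 1 u <-> (Q_ eta)^`().[u] != 0.
Proof.
have sQ : (size (Q_ eta) <= n.+1)%N by rewrite Q_poly size_poly.
move=> /rootP/factor_theorem[r Qr]; split.
  move=> [G FG Gt]; have := congr1 (unhom 1 'X) FG.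
  rewrite unhomM unhom_lin Ph_bihom_inf unhom_bihom !unhomX /=.
  under eq_bigr do rewrite expr1n mulr1.
  rewrite -poly_def scale1r alg_polyC.
  have -> : \poly_(i < n.+1) (Q_ eta)`_i = Q_ eta.
    apply/polyP => i; rewrite coef_poly; case: ltnP => // ni.
    by rewrite nth_default // (leq_trans sQ).
  move=> ->.
  rewrite derivM hornerD !hornerM -opprB !hornerN hornerXsubC subrr oppr0 mul0r addr0.
  rewrite derivN derivXsubC hornerN hornerC mulN1r oppr_eq0.
  by move: Gt; rewrite unhom_horner hornerX hornerC.
have sr : (size r <= n.-1.+1)%N.
  have [->|r0] := eqVneq r 0; first by rewrite size_poly0.
  have := sQ; rewrite Qr size_Mmonic ?monicXsubC // size_XsubC addn2 /= => h.
  by rewrite prednK //; lia.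
have e : (Q_ eta)^`().[u] = r.[u].
  by rewrite Qr derivM hornerD !hornerM hornerXsubC subrr mulr0 add0r derivXsubC hornerC mulr1.
(* At [1 : u] the linear form is u X_1 - X_0, the opposite of the homogenized T - u. *)
rewrite e => ru; exists (- bihom n.-1 r 'X_ord_max 'X_ord0).
  rewrite scale1r mulrN -mulNr opprB -bihom_mulXsub // -Qr prednK ?Ph_bihom_inf //; lia.
rewrite mevalN oppr_eq0 /bihom raddf_sum /=.
suff -> : \sum_(i < n.-1.+1) (r`_i *: ('X_ord_max ^+ i * 'X_ord0 ^+ (n.-1 - i))).@[fun i0 : 'I_2 =>
   if i0 == ord0 then 1 else u] = r.[u] by [].
rewrite (horner_coef_wide _ sr); apply: eq_bigr => i _.
by rewrite mevalZ mevalM !rmorphXn /= !mevalXU /= expr1n mulr1.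
Qed.

End SimpleRoot.

(** * Recovering a source point from a root *)

Section LinearFactors.
Variable K : closedFieldType.
Implicit Types (q : {poly K}) (x y p : K).

Lemma coef_one_sub_mul y q j :
  ((1 - y *: 'X) * q)`_j = q`_j - y * (if j == 0%N then 0 else q`_j.-1).
Proof. by rewrite mulrBl mul1r -scalerAl coefB coefZ coefXM. Qed.

Lemma coef_lin_mul p x q j :
  ((p *: 'X - x%:P) * q)`_j = p * (if j == 0%N then 0 else q`_j.-1) - x * q`_j.
Proof. by rewrite mulrBl -scalerAl coefB coefZ coefXM coefCM. Qed.

Lemma coef_one_sub_exp0 y k : ((1 - y *: 'X) ^+ k)`_0 = 1.
Proof.
elim: k => [|k IH]; first by rewrite expr0 coef1.
by rewrite exprS coef_one_sub_mul IH mulr0 subr0.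
Qed.

Lemma coef_one_sub_exp1 y k : ((1 - y *: 'X) ^+ k)`_1 = - (k%:R * y).
Proof.
elim: k => [|k IH]; first by rewrite expr0 coef1 mul0r oppr0.
by rewrite exprS coef_one_sub_mul IH /= coef_one_sub_exp0 -natr1; ring.
Qed.

Lemma coef_one_sub_exp_gt y k j : (k < j)%N -> ((1 - y *: 'X) ^+ k)`_j = 0.
Proof.
elim: k j => [|k IH] [|j] // kj; first by rewrite expr0 coef1.
by rewrite exprS coef_one_sub_mul /= !IH ?mulr0 ?subr0 // ltnW.
Qed.

Lemma coef_one_sub_exp_top y k : ((1 - y *: 'X) ^+ k)`_k = (- y) ^+ k.
Proof.
elim: k => [|k IH]; first by rewrite expr0 coef1.
by rewrite exprS coef_one_sub_mul /= IH coef_one_sub_exp_gt // exprS; ring.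
Qed.

Lemma double_root_dvd (r : {poly K}) a : r.[a] = 0 -> r^`().[a] = 0 ->
  exists s, r = s * ('X - a%:P) ^+ 2.
Proof.
move=> /rootP/factor_theorem[r1 ->].
rewrite derivM hornerD !hornerM hornerXsubC subrr mulr0 add0r derivXsubC hornerC mulr1.
by move=> /rootP/factor_theorem[s ->]; exists s; rewrite expr2 mulrA.
Qed.

End LinearFactors.

Section Source.
Variables (K : closedFieldType) (n : nat).
Hypothesis hn : (3 <= n)%N.
Hypothesis char0 : forall i, (0 < i)%N -> (i%:R : K) != 0.
Implicit Types (eta : 'rV[K]_n) (x y p : K).

Lemma Kmap_eq (s : 'rV[K]_n) eta : Phi s = P_ eta -> Kmap s = eta.
Proof.
move=> e; apply/rowP => i; rewrite mxE e !coef_P //.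
have ilt := ltn_ord i.
case: ifP => i1.
  rewrite !addn3 /= -addn3 addnK coord_ord ifT //; lia.
case: eqP => [i2|i2]; first by rewrite -[in LHS]i2 coord_ord.
have -> : (n - 1)%N = i by lia.
by rewrite opprK coord_ord.
Qed.

(** The two conditions are the coefficients of 1 and T in the bracket of [Phi]; the higher
    coefficients are the coordinates z_j themselves. *)
Lemma source_of_bracket eta x y (z3 : K) (b : {poly K}) : (size b <= n.-1)%N ->
  P_ eta = (1 - y *: 'X) ^+ (n - 1) * ((1 + x * y) *: 'X - x%:P)
           + ((1 + x * y) *: 'X - x%:P) ^+ 2 * b ->
  b`_0 = (n%:R * y + z3 * x) / 2 -> b`_1 = n%:R * y ^+ 2 + z3 * (1 + x * y) ->
  exists s : 'rV[K]_n, [/\ Kmap s = eta, cx s = x & cy s = y].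
Proof.
move=> sb Pe b0 b1.
(* Counting from 0, position k >= 3 holds z_(k+1), the coefficient of T^(k-1). *)
pose s : 'rV[K]_n := \row_i match val i with
  | 0 => x | 1 => y | 2 => z3 | _ => b`_(i.-1) end.
have sE k (hk : (k < n)%N) : coord k s =
    match k with 0 => x | 1 => y | 2 => z3 | _ => b`_k.-1 end.
  by rewrite /Defs.coord insubT mxE /=.
have cxs : cx s = x by rewrite /cx sE //; lia.
have cys : cy s = y by rewrite /cy sE //; lia.
exists s; split=> //; apply: Kmap_eq; rewrite Pe /Phi /cp cxs cys.
congr (_ + _ * _); apply/polyP => k.
rewrite !coefD !coefZ !coefD !coefZ !coefC !coefX coef_sum.
have -> : cz 3 s = z3 by rewrite /cz sE //; lia.
have sumE : \sum_(4 <= j < n.+1) (cz j s *: 'X^(j - 2))`_k =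
    if (1 < k < n.-1)%N then b`_k else 0.
  case: ifP => hk.
    rewrite (big_rem (k + 2)%N) /=; last by rewrite mem_index_iota; lia.
    rewrite coefZ coefXn addnK eqxx mulr1 big_seq big1 => [|i].
      rewrite addr0 /cz sE; last by lia.
      by case: k hk => [|[|k]] //; rewrite addn2.
    rewrite mem_rem_uniq ?iota_uniq // inE mem_index_iota => /andP[ik hi].
    rewrite coefZ coefXn; case: eqP => [e|_]; last by rewrite mulr0.
    by move: ik; rewrite e subnK ?eqxx //; lia.
  rewrite big_seq big1 // => i; rewrite mem_index_iota => hi.
  rewrite coefZ coefXn; case: eqP => [e|_]; last by rewrite mulr0.
  by move: hk; rewrite e; lia.
have two0 : (2 : K) != 0 by exact: (char0 (i := 2)).
rewrite sumE; case: k {sumE} => [|[|k]] /=.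
- by rewrite b0; field.
- by rewrite b1; ring.
- case: ifP => hk; rewrite !(mulr0, add0r, addr0) //.
  by rewrite nth_default // (leq_trans sb) //; lia.
Qed.

(* In the case x = 0 the coefficient of T^2 determines y. *)
Lemma source_exists eta x y (b : {poly K}) : (size b <= n.-1)%N ->
  P_ eta = (1 - y *: 'X) ^+ (n - 1) * ((1 + x * y) *: 'X - x%:P)
           + ((1 + x * y) *: 'X - x%:P) ^+ 2 * b ->
  (x = 0 -> (2 - n%:R) * y = 2 * coord (n - 2) eta) ->
  exists s : 'rV[K]_n, [/\ Kmap s = eta, cx s = x & cy s = y].
Proof.
move=> sb Pe xy.
have two0 : (2 : K) != 0 by exact: (char0 (i := 2)).
have natn : ((n - 1)%:R : K) = n%:R - 1 by rewrite natrB //; lia.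
pose W := (1 - y *: 'X) ^+ (n - 1) + ((1 + x * y) *: 'X - x%:P) * b.
have PW : P_ eta = ((1 + x * y) *: 'X - x%:P) * W by rewrite Pe /W; ring.
have W0 : W`_0 = 1 - x * b`_0.
  by rewrite coefD coef_lin_mul coef_one_sub_exp0 /=; ring.
have W1 : W`_1 = - ((n%:R - 1) * y) + (1 + x * y) * b`_0 - x * b`_1.
  by rewrite coefD coef_lin_mul coef_one_sub_exp1 natn /=; ring.
have c1 := coef_P eta 1; rewrite PW coef_lin_mul /= W0 W1 in c1.
have [x0|x0] := eqVneq x 0.
  (* For x = 0 and p = 1, z_3 is read off b_1. The T^2-coefficient gives A_2 = b_0 - (n - 1) y,
     which with (2 - n) y = 2 A_2 yields 2 b_0 = n y. *)
  apply: (@source_of_bracket _ _ _ (b`_1 - n%:R * y ^+ 2) b) => //; last first.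
    by rewrite x0 mul0r addr0 mulr1 addrC subrK.
  have c2 := coef_P eta 2; rewrite PW coef_lin_mul /= W1 x0 in c2.
  have {}xy := xy x0; rewrite -c2 in xy.
  have -> : n%:R * y = 2 * b`_0; last by rewrite x0 mulr0 addr0 mulrC mulKf.
  apply/eqP; rewrite -subr_eq0; apply/eqP.
  by move/eqP: xy; rewrite -subr_eq0 => /eqP xy; rewrite -[RHS]xy; ring.
(* Here z_3 is read off b_0, and the T-coefficient 1 of P then gives b_1 after cancelling x
   twice. *)
apply: (@source_of_bracket _ _ _ ((2 * b`_0 - n%:R * y) / x) b) => //.
  by field; rewrite x0 two0.
apply: (mulfI x0); apply: (mulfI x0); apply/eqP; rewrite -subr_eq0; apply/eqP.
move/eqP: c1; rewrite -subr_eq0 => /eqP c1; rewrite -[RHS]c1.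
by field; rewrite x0.
Qed.

Lemma size_one_sub_exp_mul y k x p :
  (size ((1 - y *: 'X) ^+ k * (p *: 'X - x%:P))%R <= k.+2)%N.
Proof.
apply/leq_sizeP => j kj; rewrite mulrC coef_lin_mul !coef_one_sub_exp_gt //; last by lia.
  by case: ifP => _; rewrite !mulr0 subr0.
by case: j kj => // j; rewrite !ltnS /=; lia.
Qed.

(** With p = 1/a and x = t/a, the relation p = 1 + xy gives p (1 - yt) = 1, so 1 - yt = a. Then (1 -
    yT)^(n-1) (pT - x) has derivative a^(n-1) p = a^(n-2) = P'(t) at t, and its difference from P
    has a double root there. *)
Lemma source_exists_finite eta (t a : K) : (P_ eta).[t] = 0 ->
  a ^+ (n - 2) = (P_ eta)^`().[t] -> a != 0 -> (t = 0 -> a = 1) ->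
  exists s : 'rV[K]_n, [/\ Kmap s = eta, cx s = t / a & cp s = a^-1].
Proof.
move=> Pt at' a0 ta.
pose x := t / a; pose p := a^-1.
have p0 : p != 0 by rewrite invr_neq0.
(* For x = 0 the relation p = 1 + xy leaves y free, and the value required by [source_exists] is
   taken. *)
pose y := if x == 0 then 2 * coord (n - 2) eta / (2 - n%:R) else (p - 1) / x.
have pE : p = 1 + x * y.
  rewrite /y; case: eqVneq => [x0|x0]; last by field.
  rewrite x0 mul0r addr0 /p ta ?invr1 //; apply/eqP.
  by move/eqP: x0; rewrite mulf_eq0 invr_eq0 (negPf a0) orbF.
have xp : x / p = t by rewrite /x /p invrK mulfVK.
pose r := P_ eta - (1 - y *: 'X) ^+ (n - 1) * (p *: 'X - x%:P).
have lin_t : (p *: 'X - x%:P).[t] = 0.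
  by rewrite hornerD hornerN hornerZ hornerX hornerC -xp; field.
have sub_t : (1 - y *: 'X).[t] = a.
  have xt : x = p * t by rewrite mulrC.
  rewrite hornerD hornerN hornerZ hornerX hornerC; apply: (mulfI p0).
  by rewrite mulVf // mulrBr mulr1 mulrCA -xt {1}pE [y * x]mulrC addrK.
have rt : r.[t] = 0 by rewrite hornerD hornerN hornerM lin_t mulr0 Pt subrr.
have rt' : r^`().[t] = 0.
  have dlin : (p *: 'X - x%:P)^`() = p%:P.
    by rewrite derivD derivN derivZ derivX derivC subr0 alg_polyC.
  rewrite derivB hornerD hornerN derivM hornerD !hornerM lin_t mulr0 add0r.
  rewrite dlin hornerC horner_exp sub_t -at'.
  have -> : (n - 1 = (n - 2).+1)%N by lia.
  by rewrite exprSr -mulrA mulfV // mulr1 subrr.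
have [s rs] := double_root_dvd rt rt'.
have linE : p *: 'X - x%:P = p%:P * ('X - t%:P).
  by rewrite mulrBr mul_polyC -polyCM -xp mulrCA mulfV // mulr1.
have [|||s' [Ks xs ys]] := @source_exists eta x y ((p ^- 2) *: s).
- rewrite (leq_trans (size_scale_leq _ _)) //.
  have [->|s0] := eqVneq s 0; first by rewrite size_poly0.
  have : (size r <= n.+1)%N.
    apply: (leq_trans (size_polyD _ _)); rewrite size_polyN geq_max; apply/andP; split.
      exact: size_P.
    by apply: (leq_trans (size_one_sub_exp_mul _ _ _ _)); lia.
  rewrite rs size_Mmonic ?monic_exp ?monicXsubC // size_exp_XsubC; lia.
- rewrite -pE linE exprMn -[P_ eta](subrK ((1 - y *: 'X) ^+ (n - 1) * (p%:P * ('X - t%:P)))).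
  rewrite -linE -/r rs addrC; congr (_ + _).
  rewrite -mul_polyC mulrACA -rmorphXn -polyCM mulfV ?expf_neq0 // mul1r mulrC //.
- move=> x0; rewrite /y x0 eqxx mulrCA mulfV ?mulr1 //.
  by rewrite -opprB oppr_eq0 -natrB ?char0 //; lia.
by exists s'; rewrite /cp xs ys.
Qed.

(** For p = 0 the factor pT - x is the constant -1/v and y = -v, so the bracket can be solved for
    directly. Its degree is at most n - 2: the coefficient of T^n in P is zero, and v^m = -Q'(0)
    cancels that of T^(n-1). *)
Lemma source_exists_infinity eta (v : K) : (Q_ eta).[0] = 0 ->
  v ^+ (n - 2) = - (Q_ eta)^`().[0] -> v != 0 ->
  exists s : 'rV[K]_n, [/\ Kmap s = eta, cx s = v^-1 & cp s = 0].
Proof.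
move=> Q0 vQ v0.
have Pn : (P_ eta)`_n = 0.
  by move: Q0; rewrite horner_coef0 Q_poly coef_poly subn0.
have Pn1 : (P_ eta)`_(n - 1) = - v ^+ (n - 2).
  rewrite vQ opprK horner_coef0 coef_deriv Q_poly coef_poly ifT //; lia.
have xy : 1 + v^-1 * - v = 0 by rewrite mulrN mulVf // subrr.
have [|||s [Ks xs ys]] := @source_exists eta v^-1 (- v)
   (v ^+ 2 *: (P_ eta + (1 + v *: 'X) ^+ (n - 1) * v^-1%:P)).
- rewrite (leq_trans (size_scale_leq _ _)) //; apply/leq_sizeP => j nj.
  have -> : 1 + v *: 'X = 1 - (- v) *: 'X by rewrite scaleNr opprK.
  rewrite coefD coefMC.
  have [jn|nj'] := ltnP (n - 1) j.
    rewrite coef_one_sub_exp_gt // mul0r addr0; have [->//|jn'] := eqVneq j n.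
    rewrite nth_default // (leq_trans (size_P hn eta)) //; lia.
  have -> : j = (n - 1)%N by lia.
  rewrite Pn1 coef_one_sub_exp_top opprK.
  have -> : (n - 1 = (n - 2).+1)%N by lia.
  by rewrite exprSr mulfK // addNr.
- have -> : 1 - (- v) *: 'X = 1 + v *: 'X by rewrite scaleNr opprK.
  rewrite xy scale0r sub0r sqrrN mulrN -polyC_exp mul_polyC scalerA exprVn.
  by rewrite mulVf ?expf_neq0 // scale1r addrC addrK.
- by move/eqP; rewrite invr_eq0 (negPf v0).
by exists s; rewrite /cp xs ys.
Qed.


Lemma cp_cx0 (s : 'rV[K]_n) : cx s = 0 -> cp s = 1.
Proof. by move=> x0; rewrite /cp x0 mul0r addr0. Qed.

Lemma U_zfin (w : finite_chart K n) : @U_ K n (zfin w) <->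
  psnd (set_val w) != 0 /\ (pfst (set_val w) = 0 -> psnd (set_val w) = 1).
Proof.
split=> [[s [[p0 [w' [/zfin_inj <- _ -> ->]]]|[x0 [w' [/zfin_zinf + _ ux vx]]]]]|].
- split; first by rewrite invr_neq0.
  move=> /eqP; rewrite mulf_eq0 invr_eq0 (negPf p0) orbF => /eqP /cp_cx0 ->.
  by rewrite invr1.
- move=> /and3P[_ /eqP e1 /eqP e2]; split.
    apply: contra_eq_neq vx; rewrite e2 => ->.
    by rewrite mulr0 eq_sym invr_neq0.
  move=> t0; move: e1; rewrite t0 mulr0 => /eqP; rewrite eq_sym.
  by rewrite oner_eq0.
- move=> [a0 ta]; have [Pt at'] := set_valP w.
  have [s [Ks xs ps]] := source_exists_finite Pt at' a0 ta.
  exists s; left; split; first by rewrite ps invr_neq0.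
  by exists w; split=> //; rewrite ps ?invrK // xs mulfVK.
Qed.

Lemma U_zinf (w : infinity_chart K n) : @U_ K n (zinf w) <-> psnd (set_val w) != 0.
Proof.
split=> [[s [[p0 [w' [/esym/zfin_zinf + _ tp ap]]]|[x0 [w' [/zinf_inj <- _ _ ->]]]]]|].
- move=> /and3P[_ /eqP e1 /eqP ->]; rewrite mulf_neq0 // ?ap ?invr_neq0 //.
  by apply: contra_eq_neq e1 => ->; rewrite mul0r eq_sym oner_neq0.
- by rewrite invr_neq0.
- move=> v0; have [u0|u0] := eqVneq (pfst (set_val w)) 0.
    have [Qu vQ] := set_valP w; rewrite u0 in Qu vQ.
    have [s [Ks xs ps]] := source_exists_infinity Qu vQ v0.
    exists s; right; rewrite xs invr_neq0 //; split=> //.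
    by exists w; split=> //; rewrite ?invrK // ps mul0r.
  (* For u nonzero the point also lies in the finite chart, with t = 1/u nonzero. *)
  have Fw := flip_finite hn (set_valP w) u0.
  have <- : zfin (SigSub (mem_set Fw)) = zinf w.
    by apply/zfin_zinf/glued_flipr.
  apply/U_zfin; rewrite /= psnd_flip pfst_flip; split.
    by rewrite mulf_neq0 // invr_neq0.
  by move/eqP; rewrite invr_eq0 (negPf u0).
Qed.

(** At t = 0 one has P'(0) = 1, so a is an m-th root of unity, and a = 1 exactly when 1 + a + .. +
    a^(m-1), the polynomial [G], is nonzero. This turns the condition a = 1 into an open one. *)
Lemma open_U : open (@U_ K n).
Proof.
pose t : 'I_(n + 2) := rshift n ord0; pose l : 'I_(n + 2) := rshift n ord_max.
pose G : {mpoly K[n + 2]} := \sum_(i < n - 2) 'X_l ^+ i.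
pose D (q : {mpoly K[n + 2]}) := [set y : affspace K (n + 2) | q.@[(y : 'rV_(n + 2)) 0] != 0].
have GE (y : affspace K (n + 2)) : G.@[(y : 'rV_(n + 2)) 0] = \sum_(i < n - 2) psnd y ^+ i.
  by rewrite raddf_sum; apply: eq_bigr => i _ /=; rewrite rmorphXn /= mevalXU.
have oD q : open (D q) by exact: principal_open.
split.
- exists (D 'X_l `&` (D 'X_t `|` D G)); first by apply: openI => //; exact: openU.
  apply/seteqP; split=> w; rewrite /preimage /D /= GE !mevalXU.
    move=> [a0 h]; apply/U_zfin; split=> // t0.
    case: h => [|Gw]; first by rewrite -[X in X != 0]/(pfst (set_val w)) t0 eqxx.
    have [_] := set_valP w; rewrite t0 horner_coef0 coef_deriv coef_P /= mulr1n => am.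
    move/eqP: am; rewrite -subr_eq0 subrX1 mulf_eq0 (negPf Gw) orbF subr_eq0.
    by move/eqP.
  move=> /U_zfin[a0 ta]; split=> //.
  have [t0|t0] := eqVneq (pfst (set_val w)) 0; [right|by left].
  under eq_bigr do rewrite ta // expr1n.
  by rewrite sumr_const card_ord char0 //; lia.
- exists (D 'X_l) => //.
  by apply/seteqP; split=> w; rewrite /preimage /D /= mevalXU => /U_zinf.
Qed.

End Source.

(** * Conclusion over the complex numbers *)

(** A countable set is Lebesgue null, but [0, 1] has measure 1. *)
Lemma reals_uncountable (R : realType) : ~ countable [set: R].
Proof.
move=> cR; have c01 : countable (`[0, 1]%classic : set R).
  by apply: sub_countable cR; exact: subset_card_le.
have := lebesgue_measure.countable_lebesgue_measure0 c01.
rewrite lebesgue_measure.lebesgue_measure_itv /= constructive_ereal.lte_fin Num.Theory.ltr01.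
by move=> [] /eqP; rewrite subr0 oner_eq0.
Qed.

Lemma complex_uncountable (R : realType) : ~ countable [set: R[i]].
Proof.
move=> /countable_injP[f finj]; apply: (@reals_uncountable R).
apply/countable_injP; exists (f \o real_complex R) => x y _ _ /finj.
by rewrite !in_setT => /(_ isT isT) /(congr1 (@complex.Re R)).
Qed.

Lemma complex_natr_neq0 (R : realType) k : (0 < k)%N -> (k%:R : R[i]) != 0.
Proof. by move=> k0; rewrite Num.Theory.pnatr_eq0 -lt0n. Qed.

(** The preimage is subbasic, cut out by the function 1. A [funSpaceType] alone does not make
    constants regular; the charts of [Gam] do. *)
Lemma zprod_preimage_open (K : closedFieldType) n (Gam : funSpaceType K)
    (W : set (Z K n)) : variety Gam -> open W ->
  open [set q : zprod (Z K n) Gam | W q.1].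
Proof.
move=> [[k [U [N [phi [ch cover]]]]] _] oW; apply: zprod_subbasic_open.
exists W, setT, (fun=> 1); split=> //; first exact: openT.
  exists 1%N, (fun _ => fun=> 1), (fun _ => fun=> 1); split.
  - move=> _ z _; split=> w _; exists (fun=> 1) => //.
    + by have := regular_poly (set_val w) 1; congr regular_at; apply/funext => y; rewrite meval1.
    + exact: filterE.
    + by have := regular_poly (set_val w) 1; congr regular_at; apply/funext => y; rewrite meval1.
    + exact: filterE.
  - move=> _ y _; have : (\bigcup_i U i) y by rewrite cover.
    move=> [i _ Uy]; apply/(chart_regularP (ch i) _ Uy); exists 1, 1.
    by rewrite meval1 oner_neq0; split=> // *; rewrite !meval1 divr1.
  - by apply/funext => q; rewrite big_ord1 mulr1.
by apply/seteqP; split=> q /=; [move=> ?; split; [split|exact: oner_neq0]|case=> -[]].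
Qed.

(* A point of the infinity chart has projective root [1 : u], so t is never 0
   there and the second condition is void. *)
Theorem proposition6p1 (R : realType) (n : nat) (hn : (3 <= n)%N)
    (Gam : funSpaceType R[i]) (hGam : variety Gam)
    (g : Gam -> affspace R[i] n) (hg : morphism g) :
  [/\ open (UG g),
      forall (q : ZG g) (w : finite_chart R[i] n),
        (set_val q).1 = zfin w ->
        (UG g q <->
         simple_proj_root (Ph (g (set_val q).2)) (pfst (set_val w)) 1 /\
         (pfst (set_val w) = 0 -> psnd (set_val w) = 1)),
      forall (q : ZG g) (w : infinity_chart R[i] n),
        (set_val q).1 = zinf w ->
        (UG g q <->
         simple_proj_root (Ph (g (set_val q).2)) 1 (pfst (set_val w))) &
      smooth_variety Gam ->
        (forall q : ZG g, UG g q ->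
           fibre_product_smooth_at (@zproj R[i] n) g (set_val q)) /\
        irreducible_components (UG g) = connected_components (UG g)].
Proof.
have unc := @complex_uncountable R; have char0 := @complex_natr_neq0 R.
have m0 : (0 < n - 2)%N by rewrite subn_gt0.
have oUG : open (UG g).
  exists [set q : zprod (Z R[i] n) Gam | U_ q.1] => //.
  by apply: zprod_preimage_open => //; exact: open_U.
have fibre (q : ZG g) : zproj (set_val q).1 = g (set_val q).2 := set_valP q.
split=> //.
- move=> q w qw; rewrite -fibre qw zproj_zfin /UG /= qw.
  have [Pt at'] := set_valP w.
  (* The root is simple exactly when P'(t) = a^m is nonzero, that is, when a is. *)
  rewrite (U_zfin hn char0) simple_proj_root_finite //.
  by rewrite -at' expf_eq0 m0.
- move=> q w qw; rewrite -fibre qw zproj_zinf /UG /= qw.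
  have [Qu vu] := set_valP w.
  rewrite (U_zinf hn char0) simple_proj_root_infinity //.
  by rewrite -[(Q_ _)^`().[_] == 0]oppr_eq0 -vu expf_eq0 m0.
- move=> sGam.
  have sm (q : ZG g) : UG g q -> fibre_product_smooth_at (@zproj R[i] n) g (set_val q).
    move: q => q; rewrite /UG /=; have := fibre q; case: (set_val q) => z y /= zy Uz.
    have [[w zw]|[w zw]] := zcover z; move: zy Uz; rewrite zw => zy.
      by move=> /(U_zfin hn char0)[a0 _]; exact: zfin_smooth.
    by move=> /(U_zinf hn char0) a0; exact: zinf_smooth.
  split=> //; apply: irreducible_components_connected => q Uq.
  have [O [oO Oq Oirr]] := fibre_product_locally_irreducible unc (sm q Uq).
  (* O is irreducible in the whole fibre product; intersecting with the open set [UG g] keeps it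
     so. *)
  exists O; split=> //; rewrite setIC.
  by apply: irreducible_openI => //; exists q.
Qed.
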